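(* Let $M$ be a connected smooth manifold of dimension $n$, regarded (the viewpoint being local) as an open ball of $\mathbb{R}^n$ centered at a reference point, which may be shrunk if necessary. Let $m\le n$, let $f,g_1,\ldots,g_m$ be smooth vector fields on $M$, and consider the affine control system $\dot{x}=f(x)+\sum_{j=1}^m g_j(x)u_j$ with controls $u=(u_1,\ldots,u_m)\in\mathcal{U}$. Suppose that $f,g_1,\ldots,g_m$ span a subspace $\mathcal{D}$ of constant rank. If $\mathcal{D}$ has type $(\nu,\ell)$, $1\le\ell\le n$, then $M$ is foliated by $\ell$-dimensional submanifolds that are invariant under controls of the system. This type condition is given by a system of partial differential equations of order $(\nu+1)$ for $f$ and $g_j$, $j=1,\ldots,m$.
   Context: Smooth means $C^\infty$. The set $\mathcal{U}$ of admissible controls consists of all piecewise constant functions $u:[0,\infty)\to\mathbb{R}^m$ with finitely many discontinuities. For $p\in M$ and $u\in\mathcal{U}$, $\Gamma(p,t,u)$ denotes the value at time $t$ of the continuous, piecewise smooth solution $x(t)$, uniquely determined by $p$ and $u$, of $\dot{x}=f(x)+\sum_{j=1}^m g_j(x)u_j(t)$, $x(0)=p$. Invariance: a submanifold $N$ of $M$ is said to be invariant under controls of the system if $x_0\in N$ implies that $\Gamma(x_0,t,u)\in N$ for all $u\in\mathcal{U}$ and for all $t\ge 0$. A distribution of rank $k$ is a smooth sub-bundle of fibre dimension $k$ of the tangent bundle $TM$. Derived flag and type: given a distribution $\mathcal{D}$, set $\mathcal{D}^{(0)}=\mathcal{D}$ and, for each $j=1,2,\ldots$, $\mathcal{D}^{(j)}=\mathcal{D}^{(j-1)}+[\mathcal{D}^{(j-1)},\mathcal{D}^{(j-1)}]$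 (the span of the sections of $\mathcal{D}^{(j-1)}$ and of the Lie brackets of pairs of such sections), assuming that $\mathcal{D}^{(j-1)}$ and $\mathcal{D}^{(j)}$ have constant rank. Let $\nu$ be the smallest non-negative integer such that $\mathcal{D}^{(\nu)}=\mathcal{D}^{(\nu+1)}$. If $\mathcal{D}^{(\nu)}$ has rank $\ell$, then $\mathcal{D}$ is said to be of type $(\nu,\ell)$. *)

(* Defs.v *)
From HB Require Import structures.
From mathcomp Require Import all_boot all_order all_algebra.
From mathcomp Require Import all_classical all_reals all_analysis.

Set Implicit Arguments.
Unset Strict Implicit.
Unset Printing Implicit Defensive.

Import Order.TTheory GRing.Theory Num.Theory.
Import numFieldNormedType.Exports.

Local Open Scope classical_set_scope.
Local Open Scope ring_scope.

Section Smooth.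
Context {R : realType} {n : nat}.
Implicit Types (Om U : set 'rV[R]_n) (X Y : 'rV[R]_n -> 'rV[R]_n).

(* The library norm on 'rV[R]_n is the sup norm, so its ball is a cube. *)
Definition eball (p : 'rV[R]_n) (r : R) : set 'rV[R]_n :=
  [set x | \sum_i (x 0 i - p 0 i) ^+ 2 < r ^+ 2].

Definition partial {W : normedModType R} (i : 'I_n) (F : 'rV[R]_n -> W) :
    'rV[R]_n -> W :=
  fun x => 'D_(delta_mx 0 i) F x.

Definition iter_partial {W : normedModType R} (s : seq 'I_n)
    (F : 'rV[R]_n -> W) : 'rV[R]_n -> W :=
  foldr partial F s.

(* C^infty on the open set Om: every iterated partial derivative is (Frechet)
   differentiable, hence continuous, at every point of Om.  The values of F
   outside Om are irrelevant. *)
Definition smooth_on {W : normedModType R} Om (F : 'rV[R]_n -> W) : Prop :=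
  forall (s : seq 'I_n) x, Om x -> differentiable (iter_partial s F) x.

(* In coordinates, [X, Y] = DY.X - DX.Y *)
Definition lie_bracket X Y : 'rV[R]_n -> 'rV[R]_n :=
  fun x => 'D_(X x) Y x - 'D_(Y x) X x.

End Smooth.

Section Distributions.
Context {R : realType} {n : nat}.
Implicit Types (Om : set 'rV[R]_n) (X Y : 'rV[R]_n -> 'rV[R]_n).

Definition lin_span (A : set 'rV[R]_n) : set 'rV[R]_n :=
  [set v | exists2 s : seq 'rV[R]_n,
             (forall w, w \in s -> A w) & v \in << s >>%VS].

(* A field of subsets of the tangent spaces; in what follows each fibre is a
   linear span. *)
Definition tangent_family := 'rV[R]_n -> set 'rV[R]_n.
Implicit Types D E : tangent_family.

Definition constant_rank Om D (k : nat) : Prop :=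
  forall x, Om x ->
    exists2 V : {vspace 'rV[R]_n}, \dim V = k & D x = [set v | v \in V].

Definition eq_on Om D E : Prop := forall x, Om x -> D x = E x.

Definition section_of Om D X : Prop :=
  smooth_on Om X /\ forall x, Om x -> D x (X x).

(* D + [D, D] *)
Definition derive_family Om D : tangent_family := fun x =>
  lin_span ([set v | exists2 X, section_of Om D X & v = X x] `|`
            [set v | exists X Y, [/\ section_of Om D X, section_of Om D Y &
                                     v = lie_bracket X Y x]]).

Definition derived_flag Om D (j : nat) : tangent_family :=
  iter j (derive_family Om) D.

(* The constant-rank clause with j = 0 makes D a distribution whenever D is
   spanned by smooth vector fields, the only case in which this is used; the
   same holds for the later members of the flag. *)
Definition has_type Om D (nu l : nat) : Prop :=
  [/\ forall j, (j <= nu.+1)%N ->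
        exists k, constant_rank Om (derived_flag Om D j) k,
      eq_on Om (derived_flag Om D nu) (derived_flag Om D nu.+1),
      forall j, (j < nu)%N ->
        ~ eq_on Om (derived_flag Om D j) (derived_flag Om D j.+1)
    & constant_rank Om (derived_flag Om D nu) l].

End Distributions.

Section ControlSystem.
Context {R : realType} {n m : nat}.
Implicit Types (Om N : set 'rV[R]_n) (f : 'rV[R]_n -> 'rV[R]_n)
  (g : 'I_m -> 'rV[R]_n -> 'rV[R]_n) (u : R -> 'rV[R]_m).

(* None indexes the drift f and Some j the field g_j. *)
Definition system_field f g (k : option 'I_m) : 'rV[R]_n -> 'rV[R]_n :=
  if k is Some j then g j else f.

Definition system_span f g : tangent_family := fun x =>
  lin_span [set v | exists k, v = system_field f g k x].

(* u is constant on every subinterval of [0, +oo[ that avoids a finite set;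
   its values at the exceptional times are arbitrary. *)
Definition admissible u : Prop :=
  exists s : seq R, forall a b, 0 <= a -> a <= b ->
    (forall c, c \in s -> ~~ (a <= c <= b)) -> u a = u b.

(* Graph of the partial function Gamma: q = Gamma(p, t, u), i.e. the solution
   exists in Om on [0, t] and takes the value q at time t.  Solutions need not
   stay in Om forever.  Piecewise smoothness of x follows from continuity and
   from the equation off finitely many times. *)
Definition Gamma Om f g (p : 'rV[R]_n) (t : R) u (q : 'rV[R]_n) : Prop :=
  exists x : R -> 'rV[R]_n,
    [/\ {within `[0, t], continuous x},
        x 0 = p, x t = q,
        forall s, 0 <= s <= t -> Om (x s)
      & exists e : seq R, forall s, 0 < s < t -> s \notin e ->
          is_derive s 1 x (f (x s) + \sum_j u s 0 j *: g j (x s))].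

Definition invariant_under_controls Om f g N : Prop :=
  forall x0 u t q, N x0 -> admissible u -> 0 <= t ->
    Gamma Om f g x0 t u q -> N q.

End ControlSystem.

Section Foliations.
Context {R : realType} {n : nat}.
Implicit Types (M U N : set 'rV[R]_n) (phi : 'rV[R]_n -> 'rV[R]_n).

(* phi is a diffeomorphism from the open set U onto the open set phi(U). *)
Definition is_chart U phi : Prop :=
  [/\ open U, smooth_on U phi, open (phi @` U)
    & exists2 psi : 'rV[R]_n -> 'rV[R]_n,
        smooth_on (phi @` U) psi & forall x, U x -> psi (phi x) = x].

(* The l-dimensional slice where the last n - l coordinates equal those of c;
   the first l coordinates of c are irrelevant. *)
Definition slice U phi (l : nat) (c : 'rV[R]_n) : set 'rV[R]_n :=
  [set x | U x /\ forall i : 'I_n, (l <= i)%N -> phi x 0 i = c 0 i].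

Definition embedded_submanifold M (l : nat) N : Prop :=
  N `<=` M /\
  forall x, N x -> exists U phi c,
    [/\ is_chart U phi, U x, U `<=` M & N `&` U = slice U phi l c].

Definition open_box (B : set 'rV[R]_n) : Prop :=
  exists a b : 'rV[R]_n, B = [set y | forall i, a 0 i < y 0 i < b 0 i].

Definition flat_chart (F : set (set 'rV[R]_n)) U phi (l : nat) : Prop :=
  [/\ is_chart U phi, open_box (phi @` U)
    & forall L, F L -> exists C : set 'rV[R]_n,
        L `&` U = \bigcup_(c in C) slice U phi l c].

Definition is_foliation M (l : nat) (F : set (set 'rV[R]_n)) : Prop :=
  [/\ forall L, F L -> [/\ L !=set0, connected L & embedded_submanifold M l L],
      forall L1 L2, F L1 -> F L2 -> L1 `&` L2 !=set0 -> L1 = L2,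
      \bigcup_(L in F) L = M
    & forall x, M x -> exists U phi,
        [/\ U x, U `<=` M & flat_chart F U phi l]].

End Foliations.

Section PDE.
Context {R : realType} {n m : nat}.

(* Differential polynomials in the components of f and the g_j:
   DPartial k i s stands for the iterated partial derivative along s of the
   i-th component of system_field f g k. *)
Inductive diff_poly : Type :=
| DConst of R
| DPartial of option 'I_m & 'I_n & seq 'I_n
| DAdd of diff_poly & diff_poly
| DMul of diff_poly & diff_poly.

Fixpoint dp_order (P : diff_poly) : nat :=
  match P with
  | DConst _ => 0
  | DPartial _ _ s => size s
  | DAdd P1 P2 | DMul P1 P2 => maxn (dp_order P1) (dp_order P2)
  end.

Fixpoint dp_eval (f : 'rV[R]_n -> 'rV[R]_n) (g : 'I_m -> 'rV[R]_n -> 'rV[R]_n)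
    (P : diff_poly) (x : 'rV[R]_n) : R :=
  match P with
  | DConst c => c
  | DPartial k i s => iter_partial s (system_field f g k) x 0 i
  | DAdd P1 P2 => dp_eval f g P1 x + dp_eval f g P2 x
  | DMul P1 P2 => dp_eval f g P1 x * dp_eval f g P2 x
  end.

(* The equations P = 0, together with nondegeneracy conditions: at each point
   at least one member of each list in pde_nondeg is nonzero (as in "some minor
   of size k does not vanish"). *)
Record pde_system := PDESystem {
  pde_eqs : seq diff_poly;
  pde_nondeg : seq (seq diff_poly)
}.

Definition pde_order_le (S : pde_system) (k : nat) : bool :=
  all (fun P => (dp_order P <= k)%N) (pde_eqs S ++ flatten (pde_nondeg S)).

Definition pde_solution (S : pde_system) (Om : set 'rV[R]_n)
    (f : 'rV[R]_n -> 'rV[R]_n) (g : 'I_m -> 'rV[R]_n -> 'rV[R]_n) : Prop :=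
  forall x, Om x ->
    all (fun P => dp_eval f g P x == 0) (pde_eqs S) /\
    all (has (fun P => dp_eval f g P x != 0)) (pde_nondeg S).

End PDE.

Arguments diff_poly : clear implicits.
Arguments pde_system : clear implicits.

(* Main.v *)
Require Import Defs.
From HB Require Import structures.
From mathcomp Require Import all_boot all_order all_algebra.
From mathcomp Require Import all_classical all_reals all_analysis.
From mathcomp Require Import perm ring lra.

Set Implicit Arguments.
Unset Strict Implicit.
Unset Printing Implicit Defensive.

Import Order.TTheory GRing.Theory Num.Theory.
Import numFieldNormedType.Exports.
Local Open Scope classical_set_scope.
Local Open Scope ring_scope.

(** The first part is a Frobenius theorem. Let [D] be the last member of the
    derived flag. It has constant rank [l], and brackets of its sections stay in
    it. Near the reference point it has a frame whose projections to [l]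
    suitable linear coordinates are the coordinate fields; brackets of such
    fields have projection 0 and lie in [D], on which the projection is
    injective, so the frame commutes. Flowing along the combination of
    frame fields that brings the projected coordinates of a point to 0 sends it
    to a transversal, and because the frame commutes this retraction is constant
    along [D] ([first_integral]). The projected coordinates and the retraction
    form a chart; its inverse follows the frame from the transversal, so that
    uniqueness of solutions takes the place of the inverse function theorem
    ([frobenius_chart]). A trajectory of the system moves along [D] and
    therefore keeps the last coordinates of the chart constant, whence the
    leaves, which are the connected components of their level sets in a small
    ball, are invariant ([foliation_of_chart]).

    The chart has to be smooth, which rests on smooth dependence of solutions on
    initial values ([flow_smooth]). Solutions come from Picard iteration in a
    weighted norm ([picard_lindelof]). Differentiability in the initial value
    follows from Gronwall's inequality ([flow_derivative]); higher derivatives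
    come for free, because a solution together with one of its variations is a
    solution of a lifted field of the same kind.

    The second part computes the flag. While the ranks are constant, the [j]-th
    member is spanned by the iterated brackets of depth at most [j] of the given
    fields ([derived_flag_rows]). Their components are differential polynomials
    of order [j], so prescribing the ranks through depth [nu + 1] amounts to the
    vanishing of some minors and the non-vanishing of others, of order at most
    [nu + 1] ([type_system_correct]). *)

(** * Smooth maps *)

Section Calculus.
Context {R : realType}.

Lemma differentiable_mxP {V : normedModType R} {p q : nat}
    (F : V -> 'M[R]_(p, q)) x :
  differentiable F x <-> forall i j, differentiable (fun y => F y i j) x.
Proof.
split=> [dF i j|dF].
  exact: (differentiable_comp dF (differentiable_coord _ i j)).
have -> : F = \sum_(i < p) \sum_(j < q) (fun y => F y i j *: delta_mx i j).
  apply/funext => y; rewrite fct_sumE {1}(matrix_sum_delta (F y)).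
  by apply: eq_bigr => i _; rewrite fct_sumE.
apply: differentiable_sum => i; apply: differentiable_sum => j.
exact: differentiableZl.
Qed.

(** The estimates of Gronwall type below come with explicit constants, so
    derivatives are introduced and used in epsilon form. *)
Lemma differentiable_eps {V W : normedModType R} (F : V -> W) x
    (L : {linear V -> W}) : continuous L ->
  (forall e : R, 0 < e -> \forall h \near 0, `|F (h + x) - F x - L h| <= e * `|h|) ->
  differentiable F x /\ ('d F x = L :> (V -> W)).
Proof.
move=> cL FL.
have E : F \o shift x = cst (F x) + L +o_0 id.
  apply/eqaddoP => e e0; near=> h => /=.
  rewrite /shift /= opprD addrA; near: h; exact: FL.
have dE := diff_unique cL E.
split=> //; apply/diff_locallyxP; split; first by rewrite dE.
move=> h; rewrite dE.
by have /(congr1 (fun f => f h)) := E.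
Unshelve. all: by end_near. Qed.

Lemma eps_differentiable {V W : normedModType R} (F : V -> W) x :
  differentiable F x -> forall e : R, 0 < e ->
   \forall h \near 0, `|F (h + x) - F x - 'd F x h| <= e * `|h|.
Proof.
move=> dF e e0; have /eqaddoP/(_ e e0) := diff_locally dF.
by apply: filterS => h /=; rewrite /shift /= opprD addrA.
Qed.

Lemma near_differentiable {V W : normedModType R} (F G : V -> W) x :
  (\near x, F x = G x) -> differentiable F x -> differentiable G x.
Proof.
move=> FG dF.
have Fx := nbhs_singleton FG.
have cF : continuous 'd F x by exact: diff_continuous.
apply: (proj1 (@differentiable_eps _ _ G x ('d F x) cF _)) => e e0.
have := eps_differentiable dF e0.
have FG' : \forall h \near (0:V), F (h + x) = G (h + x).
  by have := FG; rewrite (near_shift 0) subr0.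
apply: filter_app; near=> h; rewrite -(near FG' h) // -Fx //.
Unshelve. all: by end_near. Qed.

Lemma deriveE_partial {n} {W : normedModType R} (F : 'rV[R]_n -> W) x v :
  differentiable F x -> 'D_v F x = \sum_j v 0 j *: partial j F x.
Proof.
move=> dF; rewrite deriveE // {1}(row_sum_delta v) linear_sum.
by apply: eq_bigr => j _; rewrite linearZ /partial deriveE.
Qed.

Lemma derive_comp {U V W : normedModType R} (F : V -> W) (G : U -> V) x v :
  differentiable G x -> differentiable F (G x) ->
  'D_v (F \o G) x = 'D_('D_v G x) F (G x).
Proof.
move=> dG dF; rewrite !deriveE //; last exact: differentiable_comp.
by rewrite diff_comp.
Qed.

Lemma derive_coord {V : normedModType R} {p q} (F : V -> 'M[R]_(p, q)) x v i j :
  differentiable F x -> 'D_v F x i j = 'D_v (fun y => F y i j) x.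
Proof. by move=> dF; rewrite derive_mx ?mxE //; exact: diff_derivable. Qed.

End Calculus.

Section Ck.
Context {R : realType} {n : nat}.
Implicit Types (Om : set 'rV[R]_n).

(** Differentiability to a finite order is isolated because stability under
    products and composition is proved by induction on the order, and
    [smooth_on] offers no order to induct on. *)
Definition Ck {W : normedModType R} (k : nat) Om (F : 'rV[R]_n -> W) :=
  forall s, (size s <= k)%N -> forall x, Om x -> differentiable (iter_partial s F) x.

Lemma smoothE {W : normedModType R} Om (F : 'rV[R]_n -> W) :
  smooth_on Om F <-> forall k, Ck k Om F.
Proof.
split=> [sF k s _ x|sF s x Ox]; first exact: sF.
exact: (sF (size s)).
Qed.

Lemma CkSP {W : normedModType R} k Om (F : 'rV[R]_n -> W) :
  Ck k.+1 Om F <->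
  (forall x, Om x -> differentiable F x) /\ forall i, Ck k Om (partial i F).
Proof.
split=> [cF|[dF cF]].
  split=> [x|i s sk x Ox]; first exact: (cF [::]).
  by have := cF (rcons s i); rewrite size_rcons /iter_partial foldr_rcons; apply.
move=> s; case/lastP: s => [|s i]; first by move=> _; exact: dF.
by rewrite size_rcons /iter_partial foldr_rcons; exact: cF.
Qed.

Lemma Ck_diff {W : normedModType R} k Om (F : 'rV[R]_n -> W) x :
  Ck k Om F -> Om x -> differentiable F x.
Proof. by move=> cF; exact: (cF [::]). Qed.

Lemma Ck_leq {W : normedModType R} k k' Om (F : 'rV[R]_n -> W) :
  (k' <= k)%N -> Ck k Om F -> Ck k' Om F.
Proof. by move=> kk cF s sk; apply: cF; exact: leq_trans kk. Qed.

Lemma CkS {W : normedModType R} k Om (F : 'rV[R]_n -> W) :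
  Ck k.+1 Om F -> Ck k Om F.
Proof. exact: Ck_leq. Qed.

Lemma Ck_sub {W : normedModType R} k Om U (F : 'rV[R]_n -> W) :
  U `<=` Om -> Ck k Om F -> Ck k U F.
Proof. by move=> UO cF s sk x /UO; exact: cF. Qed.

Lemma smooth_sub {W : normedModType R} Om U (F : 'rV[R]_n -> W) :
  U `<=` Om -> smooth_on Om F -> smooth_on U F.
Proof. by move=> UO cF s x /UO; exact: cF. Qed.

Lemma open_near Om x (P : 'rV[R]_n -> Prop) : open Om -> Om x ->
  (forall y, Om y -> P y) -> \near x, P x.
Proof. by move=> oO Ox OP; apply: filterS (open_nbhs_nbhs (conj oO Ox)). Qed.

Lemma partial_ext {W : normedModType R} Om (F G : 'rV[R]_n -> W) i : open Om ->
  (forall x, Om x -> F x = G x) -> forall x, Om x -> partial i F x = partial i G x.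
Proof.
move=> oO FG x Ox; rewrite /partial; apply: near_eq_derive.
exact: open_near FG.
Qed.

Lemma iter_partial_ext {W : normedModType R} Om (F G : 'rV[R]_n -> W) s : open Om ->
  (forall x, Om x -> F x = G x) ->
  forall x, Om x -> iter_partial s F x = iter_partial s G x.
Proof. by move=> oO FG; elim: s => //= i s; exact: partial_ext. Qed.

Lemma Ck_ext {W : normedModType R} k Om (F G : 'rV[R]_n -> W) : open Om ->
  (forall x, Om x -> F x = G x) -> Ck k Om F -> Ck k Om G.
Proof.
move=> oO FG cF s sk x Ox; apply: near_differentiable (cF s sk x Ox).
by apply: (open_near oO Ox); exact: iter_partial_ext.
Qed.

Lemma smooth_ext {W : normedModType R} Om (F G : 'rV[R]_n -> W) : open Om ->
  (forall x, Om x -> F x = G x) -> smooth_on Om F -> smooth_on Om G.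
Proof. by move=> oO FG /smoothE cF; apply/smoothE => k; exact: Ck_ext (cF k). Qed.

Lemma Ck_cst {W : normedModType R} k Om (w : W) : Ck k Om (fun=> w).
Proof.
have E s : exists w', iter_partial s (fun _ : 'rV[R]_n => w) = cst w'.
  elim: s => [|i s /= [w' ->]]; first by exists w.
  by exists 0; apply/funext => x; rewrite /partial derive_cst.
by move=> s _ x _; have [w' ->] := E s; exact: differentiable_cst.
Qed.

Lemma CkD {W : normedModType R} k Om (F G : 'rV[R]_n -> W) : open Om ->
  Ck k Om F -> Ck k Om G -> Ck k Om (fun x => F x + G x).
Proof.
move=> oO; elim: k F G => [|k IH] F G cF cG.
  case=> // _ x Ox; apply: differentiableD; [exact: Ck_diff cF _|exact: Ck_diff cG _].
have /CkSP[dF pF] := cF; have /CkSP[dG pG] := cG.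
apply/CkSP; split=> [x Ox|i]; first by apply: differentiableD; [exact: dF|exact: dG].
apply: (Ck_ext oO _ (IH _ _ (pF i) (pG i))) => x Ox.
by rewrite /partial -deriveD //; apply: diff_derivable; [exact: dF|exact: dG].
Qed.

Lemma Ck_sum {W : normedModType R} k Om (I : Type) (r : seq I) (P : pred I)
    (F : I -> 'rV[R]_n -> W) : open Om ->
  (forall i, P i -> Ck k Om (F i)) -> Ck k Om (fun x => \sum_(i <- r | P i) F i x).
Proof.
move=> oO cF; elim: r => [|i r IH].
  apply: (Ck_ext (F := fun=> 0) oO); last exact: Ck_cst.
  by move=> x _; rewrite big_nil.
case Pi: (P i).
  by apply: (Ck_ext oO _ (CkD oO (cF i Pi) IH)) => x _; rewrite big_cons Pi.
by apply: (Ck_ext oO _ IH) => x _; rewrite big_cons Pi.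
Qed.

(** By the Leibniz rule the partial derivatives of a product are sums of
    products of one order less. *)
Lemma CkM k Om (F G : 'rV[R]_n -> R) : open Om ->
  Ck k Om F -> Ck k Om G -> Ck k Om (fun x => F x * G x).
Proof.
move=> oO; elim: k F G => [|k IH] F G cF cG.
  case=> // _ x Ox; apply: differentiableM; [exact: Ck_diff cF _|exact: Ck_diff cG _].
have /CkSP[dF pF] := cF; have /CkSP[dG pG] := cG.
apply/CkSP; split=> [x Ox|i]; first by apply: differentiableM; [exact: dF|exact: dG].
apply: (Ck_ext oO _ (CkD oO (IH _ _ (CkS cF) (pG i)) (IH _ _ (CkS cG) (pF i)))).
move=> x Ox; rewrite /partial.
by rewrite [RHS]deriveM //; apply: diff_derivable; [exact: dF|exact: dG].
Qed.

Lemma CkV k Om (F : 'rV[R]_n -> R) : open Om -> (forall x, Om x -> F x != 0) ->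
  Ck k Om F -> Ck k Om (fun x => (F x)^-1).
Proof.
move=> oO F0; elim: k => [|k IH] cF.
  case=> // _ x Ox; apply: differentiableV; [exact: Ck_diff cF _|exact: F0].
have /CkSP[dF pF] := cF; have IHk := IH (CkS cF).
apply/CkSP; split=> [x Ox|i]; first by apply: differentiableV; [exact: dF|exact: F0].
have H : Ck k Om (fun x => -1 * ((F x)^-1 * (F x)^-1 * partial i F x)).
  by apply: CkM => //; [exact: Ck_cst|do 2 apply: CkM => //].
apply: (Ck_ext oO _ H).
move=> x Ox; rewrite /partial [RHS]deriveV ?F0 //; last first.
  by apply: diff_derivable; exact: dF.
by rewrite -exprVn expr2 /GRing.scale /= mulN1r mulNr.
Qed.

Lemma Ck_mxP {p q} k Om (F : 'rV[R]_n -> 'M[R]_(p, q)) : open Om ->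
  Ck k Om F <-> forall i j, Ck k Om (fun x => F x i j).
Proof.
move=> oO; elim: k F => [|k IH] F.
  split=> [cF i j|cF]; case=> // _ x Ox /=.
    by move: i j; apply/differentiable_mxP; exact: Ck_diff cF _.
  by apply/differentiable_mxP => i j; exact: Ck_diff (cF i j) _.
have E l : (forall x, Om x -> differentiable F x) -> forall i j x, Om x ->
    partial l F x i j = partial l (fun x => F x i j) x.
  by move=> dF i j x Ox; rewrite /partial derive_coord //; exact: dF.
split=> [/CkSP[dF pF] i j|cF]; apply/CkSP; split=> [x Ox|l].
- by move: i j; apply/differentiable_mxP; exact: dF.
- have /IH/(_ i j) := pF l; apply: Ck_ext => // x Ox; exact: E.
- by apply/differentiable_mxP => i j; exact: Ck_diff (cF i j) _.
apply/IH => i j; have /CkSP[_ /(_ l)] := cF i j; apply: Ck_ext => // x Ox.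
by rewrite E // => y Oy; apply/differentiable_mxP => i' j'; exact: Ck_diff (cF i' j') _.
Qed.

Lemma smooth_mxP {p q} Om (F : 'rV[R]_n -> 'M[R]_(p, q)) : open Om ->
  smooth_on Om F <-> forall i j, smooth_on Om (fun x => F x i j).
Proof.
move=> oO; split=> [/smoothE cF i j|cF]; apply/smoothE => k.
  by move: i j; apply/Ck_mxP.
by apply/Ck_mxP => // i j; have /smoothE := cF i j.
Qed.

Lemma smooth_rVP {p} Om (F : 'rV[R]_n -> 'rV[R]_p) : open Om ->
  smooth_on Om F <-> forall j, smooth_on Om (fun x => F x 0 j).
Proof.
move=> oO; split=> [/(smooth_mxP _ oO)|] cF; first by move=> j; exact: cF.
by apply/smooth_mxP => // i j; rewrite ord1.
Qed.

Lemma smooth_cst {W : normedModType R} Om (w : W) : smooth_on Om (fun=> w).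
Proof. by apply/smoothE => k; exact: Ck_cst. Qed.

Lemma smoothD {W : normedModType R} Om (F G : 'rV[R]_n -> W) : open Om ->
  smooth_on Om F -> smooth_on Om G -> smooth_on Om (fun x => F x + G x).
Proof.
by move=> oO /smoothE cF /smoothE cG; apply/smoothE => k; exact: CkD.
Qed.

Lemma smooth_sum {W : normedModType R} Om (I : Type) (r : seq I) (P : pred I)
    (F : I -> 'rV[R]_n -> W) : open Om ->
  (forall i, P i -> smooth_on Om (F i)) ->
  smooth_on Om (fun x => \sum_(i <- r | P i) F i x).
Proof.
move=> oO cF; apply/smoothE => k; apply: Ck_sum => // i Pi.
by have /smoothE := cF i Pi.
Qed.

Lemma smoothM Om (F G : 'rV[R]_n -> R) : open Om ->
  smooth_on Om F -> smooth_on Om G -> smooth_on Om (fun x => F x * G x).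
Proof.
by move=> oO /smoothE cF /smoothE cG; apply/smoothE => k; exact: CkM.
Qed.

Lemma smooth_prod Om (I : Type) (r : seq I) (P : pred I)
    (F : I -> 'rV[R]_n -> R) : open Om ->
  (forall i, P i -> smooth_on Om (F i)) ->
  smooth_on Om (fun x => \prod_(i <- r | P i) F i x).
Proof.
move=> oO cF; elim: r => [|i r IH].
  apply: (smooth_ext (F := fun=> (1 : R)) oO); last exact: smooth_cst.
  by move=> x _; rewrite big_nil.
case Pi: (P i).
  by apply: (smooth_ext oO _ (smoothM oO (cF i Pi) IH)) => x _; rewrite big_cons Pi.
by apply: (smooth_ext oO _ IH) => x _; rewrite big_cons Pi.
Qed.

Lemma smoothV Om (F : 'rV[R]_n -> R) : open Om -> (forall x, Om x -> F x != 0) ->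
  smooth_on Om F -> smooth_on Om (fun x => (F x)^-1).
Proof. by move=> oO F0 /smoothE cF; apply/smoothE => k; exact: CkV. Qed.

Lemma smooth_partial {W : normedModType R} Om (F : 'rV[R]_n -> W) i :
  smooth_on Om F -> smooth_on Om (partial i F).
Proof.
by move=> /smoothE cF; apply/smoothE => k; have /CkSP[] := cF k.+1.
Qed.

Lemma smooth_diff {W : normedModType R} Om (F : 'rV[R]_n -> W) x :
  smooth_on Om F -> Om x -> differentiable F x.
Proof. by move=> sF; exact: (sF [::]). Qed.

Lemma smooth_continuous {W : normedModType R} Om (F : 'rV[R]_n -> W) x :
  smooth_on Om F -> Om x -> {for x, continuous F}.
Proof. by move=> sF Ox; exact: differentiable_continuous (smooth_diff sF Ox). Qed.

Lemma smooth_coord Om i : smooth_on Om (fun x : 'rV[R]_n => x 0 i).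
Proof.
apply/smoothE => -[|k].
  by case=> // _ x _; exact: differentiable_coord.
apply/CkSP; split=> [x _|j]; first exact: differentiable_coord.
apply: (Ck_sub (@subsetT _ _)).
apply: (Ck_ext (F := fun=> (delta_mx 0 j : 'rV[R]_n) 0 i) openT) => [x _|].
  rewrite /partial.
  have := @derive_mx _ _ _ _ id x _ (@derivable_id _ _ x (delta_mx 0 j : 'rV[R]_n)).
  by rewrite derive_id => /matrixP/(_ 0 i); rewrite !mxE.
exact: Ck_cst.
Qed.

End Ck.

Section Composition.
Context {R : realType} {a b : nat}.

(** By the chain rule the partial derivatives of a composite are sums of
    products of a partial derivative of [G] and a composite of one order less. *)
Lemma Ck_comp k (V : set 'rV[R]_a) (U : set 'rV[R]_b) (F : 'rV[R]_a -> R)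
    (G : 'rV[R]_b -> 'rV[R]_a) : open V -> open U ->
  (forall x, U x -> V (G x)) -> Ck k V F -> Ck k U G -> Ck k U (F \o G).
Proof.
move=> oV oU UV; elim: k F => [|k IH] F cF cG.
  by case=> // _ x Ux; apply: differentiable_comp;
    [exact: Ck_diff cG _|exact: Ck_diff cF (UV _ Ux)].
have /CkSP[dF pF] := cF; have /CkSP[dG pG] := cG.
apply/CkSP; split=> [x Ux|i].
  by apply: differentiable_comp; [exact: dG|exact: dF (UV _ Ux)].
have H : Ck k U (fun x => \sum_j partial i G x 0 j * (partial j F \o G) x).
  apply: Ck_sum => // j _; apply: CkM => //; last exact: IH (pF j) (CkS cG).
  by move: (0 : 'I_1) j; apply/Ck_mxP.
apply: (Ck_ext oU _ H) => x Ux.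
rewrite [in RHS]/partial derive_comp; [|exact: dG|exact: dF (UV _ Ux)].
by rewrite deriveE_partial; last exact: dF (UV _ Ux).
Qed.

Lemma smooth_comp {p q} (V : set 'rV[R]_a) (U : set 'rV[R]_b)
    (F : 'rV[R]_a -> 'M[R]_(p, q)) (G : 'rV[R]_b -> 'rV[R]_a) :
  open V -> open U ->
  (forall x, U x -> V (G x)) -> smooth_on V F -> smooth_on U G ->
  smooth_on U (F \o G).
Proof.
move=> oV oU UV /(smooth_mxP _ oV) sF /smoothE sG; apply/smooth_mxP => // i j.
apply/smoothE => k; apply: (Ck_comp (V := V) (F := fun x => F x i j)) => //.
by have /smoothE := sF i j.
Qed.

Lemma smooth_linear (U : set 'rV[R]_a) (A : 'M[R]_(a, b)) : open U ->
  smooth_on U (fun x => x *m A).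
Proof.
move=> oU; apply/smooth_rVP => // j.
apply: (smooth_ext (F := fun x => \sum_i x 0 i * A i j) oU).
  by move=> x _; rewrite mxE.
apply: smooth_sum => // i _; apply: smoothM => //; first exact: smooth_coord.
exact: smooth_cst.
Qed.

Lemma differentiable_mulmxr (A : 'M[R]_(a, b)) x :
  differentiable (mulmxr A : 'rV[R]_a -> 'rV[R]_b) x.
Proof. exact: smooth_diff (smooth_linear A openT) I. Qed.

Lemma continuous_mulmxr (A : 'M[R]_(a, b)) :
  continuous (mulmxr A : 'rV[R]_a -> 'rV[R]_b).
Proof. by move=> x; exact: differentiable_continuous (differentiable_mulmxr A x). Qed.

Lemma derive_mulmxr (A : 'M[R]_(a, b)) v x :
  'D_v (mulmxr A : 'rV[R]_a -> 'rV[R]_b) x = v *m A.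
Proof.
rewrite deriveE ?diff_lin //; first exact: continuous_mulmxr.
exact: differentiable_mulmxr.
Qed.

End Composition.

(** * Differentiation along a real variable *)

Section OneVariable.
Context {R : realType}.

Lemma is_derive_mxP {V : normedModType R} {p q} (F : V -> 'M[R]_(p, q)) x v l :
  is_derive x v F l <-> forall i j, is_derive x v (fun y => F y i j) (l i j).
Proof.
split=> [[dF <-] i j|H].
  split; first by move: i j; apply/derivable_mxP.
  by rewrite derive_mx // mxE.
have dF : derivable F x v by apply/derivable_mxP => i j; have [] := H i j.
split=> //; apply/matrixP => i j; rewrite derive_mx // mxE.
by have [_ ->] := H i j.
Qed.

Lemma is_derive_rVP {V : normedModType R} {q} (F : V -> 'rV[R]_q) x v l :
  is_derive x v F l <-> forall j, is_derive x v (fun y => F y 0 j) (l 0 j).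
Proof.
split=> [/is_derive_mxP H j|H]; first exact: H.
by apply/is_derive_mxP => i j; rewrite ord1; exact: H.
Qed.

Lemma is_derive_continuous {V : normedModType R} (F : R -> V) (x : R) l :
  is_derive x 1 F l -> {for x, continuous F}.
Proof.
move=> [dF _]; apply: differentiable_continuous; exact/derivable1_diffP.
Qed.

Lemma norm_rV_le {p q} (x : 'M[R]_(p, q)) c : 0 <= c ->
  (`|x| <= c) <-> (forall i j, `|x i j| <= c).
Proof.
move=> c0; rewrite /Num.norm /= mx_normrE; split=> [xc i j|xc].
  by apply: le_trans xc; exact: (le_bigmax _ (fun ij => `|x ij.1 ij.2|) (i, j)).
by apply/bigmax_leP; split=> // -[i j] _ /=; exact: xc.
Qed.

Lemma norm_coord_le {p q} (x : 'M[R]_(p, q)) i j : `|x i j| <= `|x|.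
Proof. by move: i j; apply/norm_rV_le. Qed.

Lemma is_derive_ndecr (f df : R -> R) (a b : R) : a <= b ->
  (forall x, a <= x <= b -> is_derive x 1 f (df x)) ->
  (forall x, a <= x <= b -> 0 <= df x) -> f a <= f b.
Proof.
move=> ab fd df0; have [x||c] := @MVT_segment R f df a b ab.
- by rewrite in_itv /= => /andP[ax xb]; apply: fd; rewrite !ltW.
- apply: continuous_in_subspaceT => x; rewrite inE /= in_itv /= => xab.
  exact: is_derive_continuous (fd _ xab).
rewrite in_itv /= => /df0 c0 E; rewrite -subr_ge0 E.
by rewrite mulr_ge0 // subr_ge0.
Qed.

Lemma is_derive_dominated (f df g dg : R -> R) (a b : R) : a <= b ->
  (forall x, a <= x <= b -> is_derive x 1 f (df x)) ->
  (forall x, a <= x <= b -> is_derive x 1 g (dg x)) ->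
  (forall x, a <= x <= b -> `|df x| <= dg x) -> `|f b - f a| <= g b - g a.
Proof.
move=> ab fd gd fg.
have H1 : g a - f a <= g b - f b.
  apply: (@is_derive_ndecr (g - f) (dg - df)) => // x xab.
    by apply: is_deriveB; [exact: gd|exact: fd].
  by rewrite subr_ge0 (le_trans _ (fg _ xab)) // ler_norm.
have H2 : g a + f a <= g b + f b.
  apply: (@is_derive_ndecr (g + f) (dg + df)) => // x xab.
    by apply: is_deriveD; [exact: gd|exact: fd].
  by rewrite -lerBlDr sub0r (le_trans _ (fg _ xab)) // -normrN ler_norm.
rewrite ler_norml; apply/andP; split; lra.
Qed.

Lemma is_derive_diff {V : normedModType R} (f : R -> V) (x : R) df :
  is_derive x 1 f df -> differentiable f x /\ 'd f x 1 = df.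
Proof.
move=> [fd <-]; have df' : differentiable f x by apply/derivable1_diffP.
by rewrite -deriveE.
Qed.

Lemma is_derive_comp_real {V : normedModType R} (f : R -> V) (u : R -> R) (x : R) df du :
  is_derive x 1 u du -> is_derive (u x) 1 f df ->
  is_derive x 1 (fun t => f (u t)) (du *: df).
Proof.
move=> /is_derive_diff[ud uE] /is_derive_diff[fd fE].
split; first by apply/diff_derivable/(differentiable_comp ud fd).
rewrite (derive_comp _ ud fd) !deriveE // uE.
by rewrite -fE -linearZ /GRing.scale /= mulr1.
Qed.

Lemma is_derive_comp_vec {U V : normedModType R} (F : U -> V) (y : R -> U) (t : R) dy :
  is_derive t 1 y dy -> differentiable F (y t) ->
  is_derive t 1 (fun s => F (y s)) ('D_dy F (y t)).
Proof.
move=> /is_derive_diff[yd yE] Fd.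
split; first by apply/diff_derivable/(differentiable_comp yd Fd).
by rewrite (derive_comp _ yd Fd) !deriveE // yE.
Qed.

Lemma is_derive_opp_time {V : normedModType R} (f : R -> V) (x : R) df :
  is_derive (- x) 1 f df -> is_derive x 1 (fun t => f (- t)) (- df).
Proof.
by move=> fd; rewrite -scaleN1r; apply: is_derive_comp_real fd.
Qed.

(** Integration divides the growth rate [exp (L |t|)] by [L]: measured against
    this weight, integrating an [L / 2]-Lipschitz expression contracts. *)
Lemma is_derive_weight_bound (f df : R -> R) (L C : R) : 0 < L -> 0 <= C ->
  (forall x : R, is_derive x 1 f (df x)) ->
  (forall x, `|df x| <= C * (L * expR (L * `|x|))) ->
  forall t, `|f t - f 0| <= C * expR (L * `|t|).
Proof.
move=> L0 C0.
have main (h dh : R -> R) (t : R) : (forall x : R, is_derive x 1 h (dh x)) ->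
    (forall x, `|dh x| <= C * (L * expR (L * `|x|))) -> 0 <= t ->
    `|h t - h 0| <= C * expR (L * `|t|).
  move=> hd hb t0.
  pose g s := C * expR (L * s); pose dg s := C * (L * expR (L * s)).
  have gd (x : R) : is_derive x 1 g (dg x).
    apply: is_deriveZ; apply: (is_derive_comp_real (u := fun s => L * s)).
    rewrite -[L in X in is_derive _ _ _ X]mulr1; exact: is_deriveZ.
  have := @is_derive_dominated h dh g dg 0 t t0.
  rewrite /g mulr0 expR0 mulr1 (ger0_norm t0) => H.
  apply: (@le_trans _ _ (C * expR (L * t) - C)); last by lra.
  apply: H.
  by move=> x /andP[x0 _]; have := hb x; rewrite (ger0_norm x0).
move=> fd fb t; case: (leP 0 t) => t0; first exact: (main f df).
rewrite -[t]opprK normrN -[f 0](congr1 f (oppr0 R)).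
apply: (main (fun x => f (- x)) (fun x => - df (- x))).
- by move=> x; apply: is_derive_opp_time.
- by move=> x; rewrite normrN -(normrN x); exact: fb.
- by rewrite oppr_ge0 ltW.
Qed.

Lemma is_derive_unique (f g df : R -> R) (T : R) :
  f 0 = g 0 -> (forall x : R, `|x| < T -> is_derive x 1 f (df x)) ->
  (forall x : R, `|x| < T -> is_derive x 1 g (df x)) ->
  forall x, `|x| < T -> f x = g x.
Proof.
move=> fg0 fd gd x xT.
have main (a b : R) : a <= b -> `|a| < T -> `|b| < T -> f a - g a = f b - g b.
  move=> ab aT bT.
  have wT z : a <= z <= b -> `|z| < T.
    move=> /andP[az zb]; move: aT bT; rewrite !ltr_norml => /andP[? ?] /andP[? ?].
    by apply/andP; split; lra.
  have := @is_derive_dominated (f - g) (df - df) (cst 0) (cst 0) a b ab.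
  rewrite [cst 0 b - cst 0 a]subrr => H.
  have : `|(f - g) b - (f - g) a| <= 0.
    apply: H => z zab.
    - by apply: is_deriveB; [apply: fd|apply: gd]; exact: wT.
    - by rewrite [(df - df) z]subrr normr0.
  by rewrite normr_le0 => /eqP E; apply/esym/subr0_eq.
have T0 : `|0 : R| < T by rewrite normr0 (le_lt_trans _ xT).
have [x0|x0] := leP x 0.
  by have := main _ _ x0 xT T0; rewrite fg0 subrr => /subr0_eq.
by have := main _ _ (ltW x0) T0 xT; rewrite fg0 subrr => /esym/subr0_eq.
Qed.

Lemma primitive_window (f : R -> R) (T : R) : continuous f -> 0 < T ->
  exists F : R -> R, F 0 = 0 /\ forall t : R, `|t| < T -> is_derive t 1 F (f t).
Proof.
move=> cf T0.
pose F := fun x => \int[lebesgue_measure]_(t in `[- T, x]) f t.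
exists (fun x => F x - F 0); split; first exact: subrr.
move=> t; rewrite ltr_norml => /andP[Tt tT].
have fi : lebesgue_measure.-integrable `[- T, T] (EFin \o f).
  apply: continuous_compact_integrable; first exact: segment_compact.
  exact: continuous_subspaceT.
have [dF FE] := continuous_FTC1_closed tT fi Tt (cf t).
have H : is_derive t 1 F (f t) by split; [exact: dF|rewrite -derive1E; exact: FE].
have := is_deriveB H (is_derive_cst (F 0) t 1); rewrite subr0.
exact.
Qed.

(** The integrals based at the left ends of larger and larger windows agree
    after normalisation at 0, so they glue to one primitive on the line. *)
Lemma primitive (f : R -> R) : continuous f ->
  exists F : R -> R, F 0 = 0 /\ forall t : R, is_derive t 1 F (f t).
Proof.
move=> cf.
have /choice[F FP] : forall N : nat, exists F : R -> R, F 0 = 0 /\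
    forall t : R, `|t| < N.+1%:R -> is_derive t 1 F (f t).
  by move=> N; apply: primitive_window.
have FE N M t : (N <= M)%N -> `|t| < N.+1%:R -> F N t = F M t.
  move=> NM; apply: (@is_derive_unique _ _ f N.+1%:R).
  - by rewrite (FP N).1 (FP M).1.
  - exact: (FP N).2.
  - by move=> x xN; apply: (FP M).2; apply: (lt_le_trans xN); rewrite ler_nat.
pose G t := F (Num.truncn `|t|) t.
exists G; split; first by rewrite /G (FP _).1.
move=> t; pose N := (Num.truncn `|t|).+1.
have tN (s : R) : `|s| < (Num.truncn `|s|).+1%:R by exact: truncnS_gt.
have GE s : `|s| < N%:R -> G s = F N s.
  move=> sN; rewrite /G; apply: FE => //.
  have : (Num.truncn `|s|)%:R <= `|s| by rewrite truncn_le.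
  by move=> /le_lt_trans/(_ sN); rewrite ltr_nat => /ltnW.
have tN1 : `|t| < N.+1%:R by apply: (lt_trans (tN t)); rewrite ltr_nat.
apply: near_eq_is_derive ((FP N).2 t tN1).
have : \forall s \near t, `|s| < N%:R.
  have cn : {for t, continuous (fun s : R => `|s|)} by exact: norm_continuous.
  apply: (cn [set r | r < N%:R]); apply: open_nbhs_nbhs.
  by split; [exact: open_lt|exact: tN].
by apply: filterS => s /GE.
Qed.

Lemma clampE (a b t : R) : a <= t <= b -> Num.min b (Num.max a t) = t.
Proof. by move=> /andP[at_ tb]; rewrite max_r // min_r. Qed.

Lemma geometric_limit (u : nat -> R) (C : R) :
  (forall k, `|u k.+1 - u k| <= C / 2 ^+ k) ->
  exists l, forall k, `|l - u k| <= 2 * C / 2 ^+ k.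
Proof.
move=> uC.
have C0 : 0 <= C by have := uC 0%N; rewrite expr0 divr1; exact: le_trans.
have H k j : `|u (k + j)%N - u k| <= 2 * C / 2 ^+ k - 2 * C / 2 ^+ (k + j).
  elim: j => [|j IH]; first by rewrite addn0 !subrr normr0.
  rewrite addnS; have := uC (k + j)%N.
  have -> : u (k + j).+1 - u k = (u (k+j).+1 - u (k+j)%N) + (u (k+j)%N - u k) by lra.
  move=> H2; apply: le_trans (ler_normD _ _) _.
  apply: (le_trans (lerD H2 IH)); rewrite exprS invfM.
  by set a := _ ^- (k + j); lra.
have H' k j : `|u (k + j)%N - u k| <= 2 * C / 2 ^+ k.
  by apply: (le_trans (H k j)); rewrite gerBl divr_ge0 ?exprn_ge0 ?mulr_ge0.
have cu : cvgn u.
  apply/cauchy_cvgP/cauchy_exP => e e0.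
  have : \forall k \near \oo, 2 * C / 2 ^+ k < e.
    have H0 : 2 * C * (2^-1) ^+ k @[k --> \oo] --> 2 * C * 0.
      by apply: cvgM; [exact: cvg_cst|apply: cvg_expr; rewrite ger0_norm // invf_lt1 // ltr1n].
    move: H0; rewrite mulr0 => /cvgrPdist_lt/(_ _ e0); apply: filterS => k.
    by rewrite sub0r normrN exprVn => /(le_lt_trans _); apply; exact: ler_norm.
  move=> [k _ /(_ k (leqnn _)) ke]; exists (u k); exists k => // j /= kj.
  rewrite /ball /= distrC -(subnKC kj).
  exact: le_lt_trans (H' _ _) ke.
exists (lim (u @ \oo)) => k; apply/ler_addgt0Pr => e e0.
have /cvgrPdist_lt/(_ _ e0)[N _ NP] := cu.
have := NP (k + N)%N (leq_addl _ _) => H1.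
have -> : lim (u @ \oo) - u k = (lim (u @ \oo) - u (k + N)%N) + (u (k + N)%N - u k) by lra.
apply: le_trans (ler_normD _ _) _; rewrite addrC lerD //; exact: ltW.
Qed.

End OneVariable.

Section LineDerivative.
Context {R : realType}.

Lemma is_derive_row_mx {a b} (u : R -> 'rV[R]_a) (v : R -> 'rV[R]_b) (t : R) du dv :
  is_derive t 1 u du -> is_derive t 1 v dv ->
  is_derive t 1 (fun s => row_mx (u s) (v s)) (row_mx du dv).
Proof.
move=> /is_derive_rVP hu /is_derive_rVP hv.
apply/is_derive_rVP => j; case: (splitP j) => k jk.
  have -> : j = lshift b k by exact: val_inj.
  by under eq_fun do rewrite row_mxEl; rewrite row_mxEl.
have -> : j = rshift a k by exact: val_inj.
by under eq_fun do rewrite row_mxEr; rewrite row_mxEr.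
Qed.

Lemma is_derive_scale {a} (c : 'rV[R]_a) (f : R -> R) (t : R) df :
  is_derive t 1 f df -> is_derive t 1 (fun s => f s *: c) (df *: c).
Proof.
move=> fd; apply/is_derive_rVP => k.
have -> : (fun y : R => (f y *: c) 0 k) = c 0 k \*: f.
  by apply/funext => y; rewrite !mxE mulrC.
by rewrite !mxE mulrC; exact: is_deriveZ.
Qed.

Lemma is_derive_scaleM {a} (v : R -> 'rV[R]_a) (f : R -> R) (t : R) df dv :
  is_derive t 1 f df -> is_derive t 1 v dv ->
  is_derive t 1 (fun s => f s *: v s) (df *: v t + f t *: dv).
Proof.
move=> fd /is_derive_rVP vd; apply/is_derive_rVP => k.
have -> : (fun y : R => (f y *: v y) 0 k) = f * (fun y => v y 0 k).
  by apply/funext => y; rewrite !mxE.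
by apply: (is_derive_eq (is_deriveM fd (vd k))); rewrite !mxE /GRing.scale /=; ring.
Qed.

(** A field given by an explicit formula is easier to differentiate along a
    line than as a map of several variables. *)
Lemma is_derive_line {m} {V : normedModType R} (F : 'rV[R]_m -> V) (z u : 'rV[R]_m) :
  differentiable F z -> is_derive (0 : R) 1 (fun s => F (z + s *: u)) ('D_u F z).
Proof.
move=> dF.
have dl : is_derive (0 : R) 1 (fun s => z + s *: u) u.
  have d1 : is_derive (0 : R) 1 (fun s : R => s *: u) u.
    rewrite -[X in is_derive _ _ _ X]scale1r; apply: is_derive_scale.
  by apply: (is_derive_eq (is_deriveD (is_derive_cst z (0 : R) 1) d1)); rewrite add0r.
have := is_derive_comp_vec dl; rewrite scale0r addr0; exact.
Qed.

End LineDerivative.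

(** * Existence of solutions and Gronwall's inequality *)

Section Picard.
Context {R : realType} {d : nat}.
Variables (G : R -> 'rV[R]_d -> 'rV[R]_d) (L B : R) (y0 : 'rV[R]_d).
Hypothesis L0 : 0 < L.
Hypothesis GL : forall t x x', `|G t x - G t x'| <= L * `|x - x'|.
Hypothesis Gc : forall x, continuous (G ^~ x).
Hypothesis GB : forall t, `|G t y0| <= B.

Let Gy_continuous (y : R -> 'rV[R]_d) : continuous y ->
  continuous (fun t => G t (y t)).
Proof.
move=> cy t; apply/cvgrPdist_lt => e e0.
have e2 : 0 < e / 2 by rewrite divr_gt0.
have /cvgrPdist_lt/(_ _ e2) H1 := @Gc (y t) t.
have eL : 0 < e / 2 / L by rewrite divr_gt0.
have /cvgrPdist_lt/(_ _ eL) H2 := cy t.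
near=> s.
have h1 : `|G t (y t) - G s (y t)| < e / 2 by near: s.
have h2 : `|y t - y s| < e / 2 / L by near: s.
rewrite (_ : _ - _ = (G t (y t) - G s (y t)) + (G s (y t) - G s (y s))); last first.
  by rewrite addrA subrK.
apply: (le_lt_trans (ler_normD _ _)); rewrite (splitr e) ltr_leD //.
apply: (le_trans (GL _ _ _)); rewrite mulrC -ler_pdivlMr //; exact: ltW.
Unshelve. all: by end_near. Qed.

Let step (y : R -> 'rV[R]_d) : exists z : R -> 'rV[R]_d,
  continuous y -> z 0 = y0 /\ forall t : R, is_derive t 1 z (G t (y t)).
Proof.
have [cy|ncy] := pselect (continuous y); last by exists y.
have H j : exists F : R -> R, F 0 = 0 /\
    forall t : R, is_derive t 1 F (G t (y t) 0 j).
  apply: primitive => t.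
  apply: (@continuous_comp _ _ _ (fun t => G t (y t)) (fun M => M 0 j)).
    exact: Gy_continuous.
  exact: coord_continuous.
have [F FP] := choice H.
exists (fun t => \row_j (y0 0 j + F j t)) => _; split.
  by apply/rowP => j; rewrite mxE (FP j).1 addr0.
move=> t; apply/is_derive_rVP => j.
have -> : (fun t => (\row_j (y0 0 j + F j t)) 0 j) = cst (y0 0 j) + F j.
  by apply/funext => s; rewrite mxE.
apply: (is_derive_eq (is_deriveD (is_derive_cst (y0 0 j) t 1) ((FP j).2 t))).
by rewrite add0r.
Qed.

Let contract (y1 y2 z1 z2 : R -> 'rV[R]_d) (c : R) : 0 <= c -> z1 0 = z2 0 ->
  (forall t : R, is_derive t 1 z1 (G t (y1 t))) ->
  (forall t : R, is_derive t 1 z2 (G t (y2 t))) ->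
  (forall t, `|y1 t - y2 t| <= c * expR (2 * L * `|t|)) ->
  forall t, `|z1 t - z2 t| <= c / 2 * expR (2 * L * `|t|).
Proof.
move=> c0 z0 d1 d2 y12 t.
apply/norm_rV_le => [|i j]; first by rewrite mulr_ge0 ?divr_ge0 ?expR_ge0.
rewrite ord1 !mxE.
have dj' (s : R) : is_derive s 1 (fun t => (z1 - z2) t 0 j) ((G s (y1 s) - G s (y2 s)) 0 j).
  by move: j; apply/is_derive_rVP; exact: is_deriveB.
have := @is_derive_weight_bound R (fun t => (z1 - z2) t 0 j) _ (2 * L) (c / 2) _ _ dj'.
have -> : (z1 - z2) 0 0 j = 0 by rewrite /= !mxE z0 subrr.
move=> /(_ _ _ _ t); rewrite subr0 !mxE; apply.
- by rewrite mulr_gt0.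
- by rewrite divr_ge0.
move=> s; apply: (le_trans (norm_coord_le _ _ _)).
apply: (le_trans (GL _ _ _)).
rewrite (_ : c / 2 * (2 * L * expR (2 * L * `|s|)) = L * (c * expR (2 * L * `|s|))); last by field.
by rewrite ler_pM2l.
Qed.

(** The iteration converges on the whole line at once: in the weight
    [exp (2 L |t|)] each step halves distances, so short-time solutions need
    not be glued. The bound [B] on the speed at the initial value controls the
    distance between the first two iterates. *)
Theorem picard_lindelof : exists y : R -> 'rV[R]_d,
  y 0 = y0 /\ forall t : R, is_derive t 1 y (G t (y t)).
Proof.
have [Pz PzP] := choice step.
pose it k := iter k Pz (cst y0).
have itc k : continuous (it k).
  elim: k => [|k IH]; first by move=> t; exact: cst_continuous.
  by move=> t; apply: is_derive_continuous; exact: (PzP _ IH).2.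
have it0 k : it k 0 = y0 by case: k => // k; exact: (PzP _ (itc k)).1.
have itd k (t : R) : is_derive t 1 (it k.+1) (G t (it k t)) by exact: (PzP _ (itc k)).2.
have B0 : 0 <= B by exact: le_trans (GB 0).
pose C := B / (2 * L).
have C0 : 0 <= C by rewrite divr_ge0 // mulr_ge0 // ltW.
have C20 : 0 <= 2 * C by rewrite mulr_ge0.
have itb k t : `|it k.+1 t - it k t| <= C / 2 ^+ k * expR (2 * L * `|t|).
  elim: k t => [|k IH] t; last first.
    have := contract (c := C / 2 ^+ k) _ _ (itd k.+1) (itd k) IH t.
    rewrite (_ : C / 2 ^+ k / 2 = C / 2 ^+ k.+1); last by rewrite exprSr invfM mulrA.
    by apply; [rewrite divr_ge0 ?exprn_ge0|rewrite !it0].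
  rewrite expr0 divr1; apply/norm_rV_le => [|i j]; first by rewrite mulr_ge0 ?expR_ge0.
  rewrite ord1 !mxE.
  have dj' (s : R) : is_derive s 1 (fun t => it 1%N t 0 j) (G s y0 0 j).
    by move: j; apply/is_derive_rVP; exact: (itd 0%N).
  have := @is_derive_weight_bound R _ _ (2 * L) C _ _ dj'.
  rewrite [it 1%N 0]it0; apply => //; first by rewrite mulr_gt0.
  move=> s; apply: (le_trans (norm_coord_le _ _ _)).
  apply: (le_trans (GB _)).
  rewrite /C mulrA divfK ?mulf_neq0 ?gt_eqF // ler_peMr //.
  by rewrite (le_trans _ (expR_ge1Dx _)) // lerDl mulr_ge0 // mulr_ge0 // ltW.
have H t : exists l : 'rV[R]_d, forall k,
    `|l - it k t| <= 2 * C / 2 ^+ k * expR (2 * L * `|t|).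
  have Hj j : exists l, forall k, `|l - it k t 0 j| <= 2 * (C * expR (2 * L * `|t|)) / 2 ^+ k.
    apply: geometric_limit => k.
    have := norm_coord_le (it k.+1 t - it k t) 0 j; rewrite !mxE => /le_trans; apply.
    by rewrite mulrAC; exact: itb.
  have [l lP] := choice Hj; exists (\row_j l j) => k.
  apply/norm_rV_le => [|i j].
    by rewrite mulr_ge0 ?expR_ge0 // divr_ge0 ?exprn_ge0 // mulr_ge0.
  by rewrite ord1 !mxE; apply: (le_trans (lP j k)); rewrite mulrA mulrAC.
have [y yP] := choice H.
have small (e c : R) : 0 < e -> 0 <= c -> exists k, c / 2 ^+ k <= e.
  move=> e0 c0.
  have H0 : c * (2^-1) ^+ k @[k --> \oo] --> c * 0.
    by apply: cvgM; [exact: cvg_cst|apply: cvg_expr; rewrite ger0_norm // invf_lt1 // ltr1n].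
  move: H0; rewrite mulr0 => /cvgrPdist_lt/(_ _ e0)[k _ /(_ k (leqnn k))].
  rewrite sub0r normrN exprVn => /ltW ke; exists k; apply: le_trans ke.
  exact: ler_norm.
have yc : continuous y.
  move=> t; apply/cvgrPdist_lt => e e0.
  pose M := expR (2 * L * (`|t| + 1)).
  have M0 : 0 <= M by exact: expR_ge0.
  have e4 : 0 < e / 4 by rewrite divr_gt0.
  have [k kP] := small _ _ e4 (mulr_ge0 C20 M0).
  have /cvgrPdist_lt/(_ _ e4) H1 := itc k t.
  have H2 : \forall s \near t, `|t - s| < 1.
    exact: (@nbhsx_ballx _ _ t 1 ltr01).
  near=> s.
  have h1 : `|it k t - it k s| < e / 4 by near: s.
  have h2 : `|t - s| < 1 by near: s.
  have b r : `|r| <= `|t| + 1 -> `|y r - it k r| <= e / 4.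
    move=> rt; apply: (le_trans (yP r k)); apply: le_trans kP.
    rewrite mulrAC ler_pM2r ?invr_gt0 ?exprn_gt0 //; apply: (ler_wpM2l C20).
    by rewrite /M ler_expR ler_pM2l // mulr_gt0.
  have bt : `|y t - it k t| <= e / 4 by apply: b; rewrite lerDl.
  have bs : `|y s - it k s| <= e / 4.
    apply: b; have -> : s = t - (t - s) by lra.
    by rewrite (le_trans (ler_normB _ _)) // lerD2l ltW.
  have -> : y t - y s = (y t - it k t) + (it k t - it k s) - (y s - it k s).
    by rewrite opprB !addrA subrK subrK.
  apply: (le_lt_trans (ler_normB _ _)).
  apply: (@le_lt_trans _ _ (`|y t - it k t| + `|it k t - it k s| + `|y s - it k s|)).
    by rewrite lerD2r ler_normD.
  lra.
have [z0 zd] := PzP _ yc.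
suff E : Pz y = y by exists y; rewrite -{1}E; split=> // t; rewrite -{1}E.
apply/funext => t; apply/eqP; rewrite -subr_eq0 -normr_le0.
apply/ler_addgt0Pr => e e0; rewrite add0r.
have [k kP] := small _ _ e0 (mulr_ge0 C20 (expR_ge0 (2 * L * `|t|))).
apply: le_trans kP.
have Ck0 : 0 <= 2 * C / 2 ^+ k by rewrite divr_ge0 ?exprn_ge0.
have h1 := contract Ck0 (etrans z0 (esym (it0 k.+1))) zd (itd k) (yP^~ k) t.
have h2 := yP t k.+1.
rewrite (_ : Pz y t - y t = (Pz y t - it k.+1 t) - (y t - it k.+1 t)); last first.
  by rewrite opprB addrA subrK.
apply: (le_trans (ler_normB _ _)); apply: (le_trans (lerD h1 h2)).
rewrite exprSr invfM; set E := expR _; set p := _ ^- k; lra.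
Unshelve. all: by end_near. Qed.

End Picard.

Section Gronwall.
Context {R : realType}.

(** The sup norm is not differentiable; it is traded for the sum of the squared
    coordinates. *)
Lemma sqr_norm_rV d (u : 'rV[R]_d) :
  `|u| ^+ 2 <= \sum_j u 0 j ^+ 2 /\ \sum_j u 0 j ^+ 2 <= d%:R * `|u| ^+ 2.
Proof.
split.
  have E0 : 0 <= \sum_j u 0 j ^+ 2 by apply: sumr_ge0 => j _; exact: sqr_ge0.
  rewrite -(sqr_sqrtr E0) ler_pXn2r ?nnegrE ?sqrtr_ge0 //.
  apply/norm_rV_le => [|i j]; first exact: sqrtr_ge0.
  rewrite ord1 -sqrtr_sqr ler_wsqrtr // (bigD1 j) //= lerDl.
  by apply: sumr_ge0 => k _; exact: sqr_ge0.
apply: (@le_trans _ _ (\sum_(j < d) `|u| ^+ 2)); last first.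
  by rewrite sumr_const card_ord mulr_natl.
apply: ler_sum => j _; rewrite -real_normK ?num_real //.
by rewrite ler_pXn2r ?nnegrE // norm_coord_le.
Qed.

(** The sum [E] of the squared coordinates of [u] satisfies a linear scalar
    differential inequality, so [(E + e^2) exp (- c t)] decreases. The constant
    is uniform because the time is at most 1. *)
Lemma gronwall d (L : R) : 0 <= L -> exists K : R, 0 < K /\
  forall (u du : R -> 'rV[R]_d) (T e : R), 0 <= T <= 1 -> 0 <= e ->
  (forall t : R, 0 <= t <= T -> is_derive t 1 u (du t)) ->
  (forall t, 0 <= t <= T -> `|du t| <= L * `|u t| + e) ->
  `|u T| <= K * (`|u 0| + e).
Proof.
move=> L0.
(* 2 * u_j * u_j' <= u_j^2 + u_j'^2 gives the first two terms, and the last one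
   absorbs the contribution of e *)
pose c : R := 1 + 2 * d%:R * L ^+ 2 + 2 * d%:R.
have d0 : 0 <= d%:R :> R by exact: ler0n.
have c0 : 0 < c.
  by rewrite /c; have := mulr_ge0 d0 (sqr_ge0 L); nra.
pose K := (d%:R + 1) * expR c.
have K1 : 1 <= K.
  rewrite /K -[leLHS]mulr1 ler_pM // ?lerDr //.
  by rewrite (le_trans _ (expR_ge1Dx _)) // lerDl ltW.
exists K; split; first exact: lt_le_trans K1.
move=> u du T e /andP[T0 T1] e0 ud ub.
pose E t := \sum_j u t 0 j ^+ 2.
pose dE t := \sum_j 2 * (u t 0 j * du t 0 j).
have Ed (t : R) : 0 <= t <= T -> is_derive t 1 E (dE t).
  move=> tT.
  have -> : E = \sum_j (fun t => u t 0 j * u t 0 j).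
    by apply/funext => s; rewrite fct_sumE; apply: eq_bigr => j _; rewrite expr2.
  apply: is_derive_sum => j.
  have /is_derive_rVP/(_ j) h := ud t tT.
  apply: (is_derive_eq (is_deriveM h h)).
  by rewrite /GRing.scale /=; ring.
pose h t := (E t + e ^+ 2) * expR (- c * t).
pose dh t := (dE t - c * (E t + e ^+ 2)) * expR (- c * t).
have hd (t : R) : 0 <= t <= T -> is_derive t 1 h (dh t).
  move=> tT.
  have h1 : is_derive t 1 (fun s => E s + e ^+ 2) (dE t).
    by apply: (is_derive_eq (is_deriveD (Ed t tT) (is_derive_cst (e ^+ 2) t 1))); rewrite addr0.
  have h2 : is_derive t 1 (fun s => expR (- c * s)) (- c * expR (- c * t)).
    apply: (is_derive_comp_real (u := fun s => - c * s)).
    rewrite -[X in is_derive _ _ _ X]mulr1; exact: is_deriveZ.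
  apply: (is_derive_eq (is_deriveM h1 h2)).
  by rewrite /GRing.scale /= /dh; ring.
have dh0 (t : R) : 0 <= t <= T -> dh t <= 0.
  move=> tT; rewrite /dh pmulr_lle0 ?expR_gt0 // subr_le0.
  apply: (@le_trans _ _ (\sum_j (u t 0 j ^+ 2 + du t 0 j ^+ 2))).
    by apply: ler_sum => j _; have := sqr_ge0 (u t 0 j - du t 0 j); nra.
  rewrite big_split /= -/(E t).
  have [h1 _] := sqr_norm_rV (u t); have [_ h2] := sqr_norm_rV (du t).
  have h3 := ub t tT.
  have h4 : `|du t| ^+ 2 <= 2 * L ^+ 2 * E t + 2 * e ^+ 2.
    apply: (@le_trans _ _ ((L * `|u t| + e) ^+ 2)).
      by rewrite ler_pXn2r ?nnegrE // addr_ge0 // mulr_ge0.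
    have := sqr_ge0 (L * `|u t| - e).
    have : L ^+ 2 * `|u t| ^+ 2 <= L ^+ 2 * E t by rewrite ler_wpM2l ?sqr_ge0.
    nra.
  have h5 : d%:R * `|du t| ^+ 2 <= d%:R * (2 * L ^+ 2 * E t + 2 * e ^+ 2).
    by rewrite ler_wpM2l.
  have E0 : 0 <= E t by apply: sumr_ge0 => j _; exact: sqr_ge0.
  have := mulr_ge0 d0 E0; have := sqr_ge0 e.
  have : 0 <= d%:R * L ^+ 2 * e ^+ 2 by rewrite !mulr_ge0 ?sqr_ge0.
  rewrite /c; nra.
have hT : h T <= h 0.
  rewrite -lerN2.
  apply: (@is_derive_ndecr _ (fun t => - h t) (fun t => - dh t)) => // t tT.
    by apply: is_deriveN; exact: hd.
  by rewrite oppr_ge0 dh0.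
have ET : E T <= expR c * (E 0 + e ^+ 2).
  move: hT; rewrite /h mulr0 expR0 mulr1 mulNr expRN ler_pdivrMr ?expR_gt0 // => hT.
  apply: (@le_trans _ _ (E T + e ^+ 2)); first by rewrite lerDl sqr_ge0.
  apply: (le_trans hT); rewrite mulrC ler_wpM2r //.
    by rewrite addr_ge0 ?sqr_ge0 //; apply: sumr_ge0 => j _; exact: sqr_ge0.
  by rewrite ler_expR ler_piMr // ltW.
have [h1 _] := sqr_norm_rV (u T); have [_ h2] := sqr_norm_rV (u 0).
have X0 : 0 <= `|u 0| + e by rewrite addr_ge0.
have K0 : 0 <= K by exact: le_trans K1.
rewrite -(@ler_pXn2r _ 2) ?nnegrE ?(mulr_ge0 K0 X0) //.
apply: (le_trans h1); apply: (le_trans ET).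
rewrite exprMn.
apply: (@le_trans _ _ (K * (`|u 0| + e) ^+ 2)); last first.
  by rewrite ler_wpM2r ?sqr_ge0 // expr2 ler_peMr.
rewrite /K (mulrC _ (expR c)) -mulrA ler_pM2l ?expR_gt0 //.
have := mulr_ge0 (normr_ge0 (u 0)) e0.
have := mulr_ge0 d0 (mulr_ge0 (normr_ge0 (u 0)) e0).
have := mulr_ge0 d0 (sqr_ge0 e); have := sqr_ge0 (`|u 0|); rewrite -/(E 0) in h2 *.
nra.
Qed.

Lemma clamp_continuous (a b : R) : continuous (fun t : R => Num.min b (Num.max a t)).
Proof.
move=> t; apply: (@continuous_min _ _ (cst b) (fun t => Num.max a t)).
  exact: cst_continuous.
apply: (@continuous_max _ _ (cst a) id); first exact: cst_continuous.
exact: cvg_id.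
Qed.

Lemma clamp_itv (a b t : R) : a <= b -> a <= Num.min b (Num.max a t) <= b.
Proof.
by move=> ab; rewrite ge_min lexx andbT le_min ab le_max lexx.
Qed.

Lemma continuous_clamp (V : topologicalType) (g : R -> V) (a b : R) : a <= b ->
  (forall t : R, a <= t <= b -> {for t, continuous g}) ->
  continuous (fun t : R => g (Num.min b (Num.max a t))).
Proof.
move=> ab cg t; apply: (@continuous_comp _ _ _ (fun t : R => Num.min b (Num.max a t)) g).
  exact: clamp_continuous.
exact: cg (clamp_itv _ _).
Qed.

(** Continuous induction: at the first time where the bound is attained, it
    has held so far, so the hypothesis makes it strict. *)
Lemma no_exit (g : R -> R) (r : R) :
  (forall t : R, 0 <= t <= 1 -> {for t, continuous g}) -> g 0 < r ->
  (forall T, 0 <= T <= 1 -> (forall t, 0 <= t <= T -> g t <= r) -> g T < r) ->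
  forall t, 0 <= t <= 1 -> g t < r.
Proof.
move=> cg g0 gT t t01; rewrite ltNge; apply/negP => rt.
pose g' t := g (Num.min 1 (Num.max 0 t)).
have g'E s : 0 <= s <= 1 -> g' s = g s by move=> s01; rewrite /g' clampE.
have cg' : continuous g' by exact: continuous_clamp.
have ivt s : 0 <= s <= 1 -> r <= g s -> exists2 c, 0 <= c <= s & g c = r.
  move=> s01 rs; have /andP[s0 s1] := s01.
  have [||c] := @IVT R g' 0 s r s0.
  - exact: continuous_subspaceT.
  - have g0s : g 0 <= g s by exact: le_trans (ltW g0) rs.
    by rewrite !g'E ?lexx ?ler01 // min_l ?max_r // (ltW g0).
  rewrite in_itv /= => /andP[c0 cs] gc; exists c; first by rewrite c0.
  by rewrite -gc g'E // c0 (le_trans cs).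
pose A : set R := `[0, 1]%classic `&` g' @^-1` [set r].
have cA : compact A.
  apply: compact_closedI; first exact: segment_compact.
  by apply: preimage_closed => [x _|]; [exact: cg'|exact: closed_eq].
have [c ct gc] := ivt t t01 rt.
have A0 : A !=set0.
  exists c; have c01 : 0 <= c <= 1 by move: ct t01; lra.
  by split; rewrite /= ?in_itv //= g'E.
have [m Am mP] := @compact_EVT_min _ R id A A0 cA (continuous_subspaceT (fun x => cvg_id)).
move: Am; rewrite inE /= => -[+ +]; rewrite ?in_itv /= => m01; rewrite g'E // => gm.
suff : g m < r by rewrite gm ltxx.
apply: gT => // s sm; rewrite leNgt; apply/negP => rs.
have s01 : 0 <= s <= 1.
  have /andP[-> s'm] := sm; have /andP[_ m1] := m01; exact: (le_trans s'm m1).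
have [c' cs gc'] := ivt s s01 (ltW rs).
have c'01 : 0 <= c' <= 1 by move: cs s01; lra.
have : m <= c' by apply: mP; rewrite inE; split; rewrite /= ?in_itv //= g'E.
move=> mc; have E : s = m.
  have /andP[_ c's] := cs; have /andP[_ s'm] := sm.
  by apply/eqP; rewrite eq_le s'm (le_trans mc c's).
by move: rs; rewrite E gm ltxx.
Qed.

End Gronwall.

(** * Stability of solutions *)

Section MeanValue.
Context {R : realType} {d : nat}.

Lemma mean_value_ineq {q} (F : 'rV[R]_d -> 'rV[R]_q) (x x' : 'rV[R]_d) (M : R) :
  0 <= M ->
  (forall s : R, 0 <= s <= 1 -> differentiable F (x' + s *: (x - x')) /\
     forall j, `|partial j F (x' + s *: (x - x'))| <= M) ->
  `|F x - F x'| <= d%:R * M * `|x - x'|.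
Proof.
move=> M0 H.
have c0 : 0 <= d%:R * M * `|x - x'| by rewrite !mulr_ge0.
pose p (s : R) := x' + s *: (x - x').
have pd (s : R) : is_derive s 1 p (x - x').
  have h1 : is_derive s 1 (fun s : R => s *: (x - x')) (x - x').
    apply/is_derive_rVP => j.
    have -> : (fun y : R => (y *: (x - x')) 0 j) = (fun y => (x - x') 0 j * y).
      by apply/funext => y; rewrite !mxE mulrC.
    rewrite -[X in is_derive _ _ _ X]mulr1; exact: is_deriveZ.
  by apply: (is_derive_eq (is_deriveD (is_derive_cst x' s 1) h1)); rewrite add0r.
have Fd (s : R) : 0 <= s <= 1 ->
    is_derive s 1 (fun s => F (p s)) ('D_(x - x') F (p s)).
  by move=> s01; apply: is_derive_comp_vec => //; exact: (H s s01).1.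
apply/norm_rV_le => // i j; rewrite ord1.
have := @is_derive_dominated R (fun s => F (p s) 0 j) (fun s => 'D_(x - x') F (p s) 0 j)
   (fun s => d%:R * M * `|x - x'| * s) (fun=> d%:R * M * `|x - x'|) 0 1 ler01.
rewrite mulr1 mulr0 subr0 /p scale1r scale0r addr0 [x' + (x - x')]addrC subrK !mxE; apply.
- by move=> s /Fd /is_derive_rVP; apply.
- by move=> s _; rewrite -[X in is_derive _ _ _ X]mulr1; exact: is_deriveZ.
move=> s s01; have [dF pF] := H s s01.
apply: (le_trans (norm_coord_le _ _ _)).
rewrite deriveE_partial // (le_trans (ler_norm_sum _ _ _)) //.
rewrite -mulrA mulr_natl -[X in _ *+ X]card_ord -sumr_const ler_sum // => k _.
by rewrite normrZ mulrC ler_pM // norm_coord_le.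
Qed.

Lemma ball_convex (c x x' : 'rV[R]_d) r (s : R) : 0 <= s <= 1 ->
  `|x - c| <= r -> `|x' - c| <= r -> `|x' + s *: (x - x') - c| <= r.
Proof.
move=> /andP[s0 s1] xr x'r.
have -> : x' + s *: (x - x') - c = s *: (x - c) + (1 - s) *: (x' - c).
  by rewrite scalerBl scale1r !scalerBr; apply/rowP => j; rewrite !mxE; ring.
apply: (le_trans (ler_normD _ _)); rewrite !normrZ (ger0_norm s0) ger0_norm ?subr_ge0 //.
have -> : r = s * r + (1 - s) * r by ring.
by rewrite lerD // ler_wpM2l // subr_ge0.
Qed.

(** All that the estimates along a solution use of the field: its first and
    second partial derivatives are bounded by one constant on a ball. *)
Definition tame (W : 'rV[R]_d -> 'rV[R]_d) (Om : set 'rV[R]_d) (c : 'rV[R]_d) (r M : R) :=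
  forall x, `|x - c| <= r -> [/\ Om x, differentiable W x, forall j, differentiable (partial j W) x,
    forall j, `|partial j W x| <= M & forall i j, `|partial i (partial j W) x| <= M].

Lemma tame_lip W Om c r M x x' : 0 <= M -> tame W Om c r M -> `|x - c| <= r -> `|x' - c| <= r ->
  `|W x - W x'| <= d%:R * M * `|x - x'|.
Proof.
move=> M0 H xr x'r; apply: mean_value_ineq => // s s01.
by have [_ ? _ ? _] := H _ (ball_convex s01 xr x'r).
Qed.

Lemma tame_taylor W Om c r M x : 0 <= M -> tame W Om c r M -> `|x - c| <= r ->
  `|W x - W c - 'D_(x - c) W c| <= d%:R * (d%:R * M) * `|x - c| ^+ 2.
Proof.
move=> M0 H xr.
have r0 : 0 <= r by apply: le_trans xr.
have cc : `|c - c| <= r by rewrite subrr normr0.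
pose A : 'M[R]_d := \matrix_i (partial i W c).
have AE v : v *m A = 'D_v W c.
  have [_ dW _ _ _] := H c cc.
  rewrite deriveE_partial // mulmx_sum_row; apply: eq_bigr => i _.
  by rewrite rowK.
have dA y := differentiable_mulmxr A y.
(* W minus its linear part at c: its partials vanish at c *)
pose F y := W y - mulmxr A y.
have pA j y : partial j (mulmxr A) y = partial j W c.
  by rewrite /partial derive_mulmxr -rowE rowK.
have := @mean_value_ineq _ F x c (d%:R * M * `|x - c|).
have -> : F x - F c = W x - W c - 'D_(x - c) W c.
  rewrite -AE mulmxBl /F /=; move: (x *m A) (c *m A) => a b.
  by apply/rowP => j; rewrite !mxE; ring.
rewrite expr2 !mulrA; apply; first by rewrite !mulr_ge0.
move=> s s01; set y := c + _.
have yr := ball_convex s01 xr cc; have [_ dW dpW _ ppW] := H _ yr.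
split; first exact: differentiableB.
move=> j.
have -> : partial j F y = partial j W y - partial j W c.
  rewrite -(pA j y) {1}/partial deriveB //; exact: diff_derivable.
have ys : `|y - c| <= `|x - c|.
  rewrite /y addrC addKr normrZ ler_piMl //.
  by have /andP[s0 s1] := s01; rewrite ger0_norm.
apply: (@le_trans _ _ (d%:R * M * `|y - c|)); last by rewrite ler_wpM2l // mulr_ge0.
apply: mean_value_ineq => // s' s'01.
by have [_ _ ? _ ?] := H _ (ball_convex s'01 yr cc).
Qed.

Lemma ler_term (I : finType) (F : I -> R) i : (forall i, 0 <= F i) ->
  F i <= \sum_j F j.
Proof. by move=> F0; rewrite (bigD1 i) //= lerDl sumr_ge0. Qed.

Lemma near_normB (x : 'rV[R]_d) (P : set 'rV[R]_d) : (\near x, P x) ->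
  exists2 e : R, 0 < e & forall y, `|y - x| < e -> P y.
Proof.
move=> /nbhs_ballP[e /= e0 eP]; exists e => // y yx; apply: eP.
by rewrite -ball_normE /= distrC.
Qed.

Lemma smooth_tame W Om x : open Om -> smooth_on Om W -> Om x ->
  exists r M, [/\ 0 < r, 0 <= M & tame W Om x r M].
Proof.
move=> oO sW Ox.
have bnd (F : 'rV[R]_d -> 'rV[R]_d) : smooth_on Om F ->
    \forall y \near x, `|F y| <= `|F x| + 1.
  move=> sF; have cF : {for x, continuous F}.
    exact: differentiable_continuous (smooth_diff sF Ox).
  have /cvgrPdist_lt/(_ _ ltr01) := cF; apply: filterS => y /ltW h.
  by rewrite -lerBlDl (le_trans (lerB_dist _ _)) // distrC.
have s1 j : smooth_on Om (partial j W) by exact: smooth_partial.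
have s2 i j : smooth_on Om (partial i (partial j W)) by exact: smooth_partial.
have n1 : \forall y \near x, forall j, `|partial j W y| <= `|partial j W x| + 1.
  exact: (@filter_forall _ _ (fun j => [set y | `|partial j W y| <= _]) _ _
    (fun j => bnd _ (s1 j))).
have n2 : \forall y \near x, forall i j,
    `|partial i (partial j W) y| <= `|partial i (partial j W) x| + 1.
  have n2 i : \forall y \near x, forall j,
      `|partial i (partial j W) y| <= `|partial i (partial j W) x| + 1.
    exact: (@filter_forall _ _ (fun j => [set y | `|partial i (partial j W) y| <= _])
      _ _ (fun j => bnd _ (s2 i j))).
  exact: (@filter_forall _ _ (fun i => [set y | forall j,
    `|partial i (partial j W) y| <= `|partial i (partial j W) x| + 1]) _ _ n2).
have nO : \forall y \near x, Om y by exact: open_nbhs_nbhs.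
have [e e0 eP] := near_normB (filterI nO (filterI n1 n2)).
pose M := \sum_j (`|partial j W x| + 1)
  + \sum_i \sum_j (`|partial i (partial j W) x| + 1).
have p1 j : 0 <= `|partial j W x| + 1 by rewrite addr_ge0.
have p2 i j : 0 <= `|partial i (partial j W) x| + 1 by rewrite addr_ge0.
have S1 : 0 <= \sum_j (`|partial j W x| + 1) by rewrite sumr_ge0.
have S2 : 0 <= \sum_i \sum_j (`|partial i (partial j W) x| + 1).
  by apply: sumr_ge0 => i _; apply: sumr_ge0 => j _; exact: p2.
exists (e / 2), M; split; [by rewrite divr_gt0|exact: addr_ge0|].
move=> y ye; have [|Oy [b1 b2]] := eP y.
  by rewrite (le_lt_trans ye) // ltr_pdivrMr // ltr_pMr // ltr1n.
split=> //; first exact: smooth_diff sW Oy.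
- by move=> j; exact: smooth_diff (s1 j) Oy.
- move=> j; apply: (le_trans (b1 j)); apply: ler_wpDr => //.
  by rewrite (bigD1 j) //= lerDl sumr_ge0.
move=> i j; apply: (le_trans (b2 i j)); apply: ler_wpDl => //.
apply: (le_trans (@ler_term _ (fun j => `|partial i (partial j W) x| + 1) j (p2 i))).
by apply: (@ler_term _ (fun i => \sum_j _) i) => k; apply: sumr_ge0 => j' _; exact: p2.
Qed.

Lemma tame_shrink W Om x y r r' M M' : tame W Om x r M -> `|y - x| + r' <= r ->
  M <= M' -> tame W Om y r' M'.
Proof.
move=> H yr MM z zr; have [|? ? ? b1 b2] := H z.
  have -> : z - x = (z - y) + (y - x) by rewrite addrA subrK.
  by rewrite (le_trans (ler_normD _ _)) // addrC (le_trans _ yr) // lerD2l.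
split=> //; first by move=> j; exact: le_trans MM.
by move=> i j; exact: le_trans MM.
Qed.

(** Compactness of the time interval: one radius and one bound serve along the
    whole curve. *)
Lemma tame_tube W Om (y : R -> 'rV[R]_d) : open Om -> smooth_on Om W ->
  (forall t : R, 0 <= t <= 1 -> {for t, continuous y}) ->
  (forall t : R, 0 <= t <= 1 -> Om (y t)) ->
  exists r M, [/\ 0 < r, 0 <= M & forall t, 0 <= t <= 1 -> tame W Om (y t) r M].
Proof.
move=> oO sW cy Oy.
have cK : compact (`[0, 1]%classic : set R) by exact: segment_compact.
move/compact_near_coveringP : cK => cov.
pose P (N : nat) (t : R) := tame W Om (y t) (N.+1%:R^-1) N%:R.
have [|N _ NP] := cov nat \oo P _.
  move=> t; rewrite /= in_itv /= => t01.
  have [r [M [r0 M0 H]]] := smooth_tame oO sW (Oy t t01).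
  have r2 : 0 < r / 2 by rewrite divr_gt0.
  have /cvgrPdist_lt/(_ _ r2) c1 := cy t t01.
  have c2 : \forall N \near \oo, M < N%:R by exact: nbhs_infty_gtr.
  have c3 : \forall N \near \oo, (r / 2)^-1 < N%:R by exact: nbhs_infty_gtr.
  exists ([set s | `|y t - y s| < r / 2],
     [set N | M < N%:R] `&` [set N | (r / 2)^-1 < N%:R]).
    by split=> //=; exact: filterI.
  move=> [s N] /= [sr [MN rN]]; apply: (tame_shrink H); last exact: ltW.
  rewrite distrC (splitr r) lerD ?ltW //.
  rewrite -[ltRHS]invrK ltf_pV2 ?posrE ?invr_gt0 ?ltr0n //.
  by rewrite (lt_trans rN) // ltr_nat.
exists N.+1%:R^-1, N%:R; split; [by rewrite invr_gt0 ltr0n|exact: ler0n|].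
by move=> t t01; apply: (NP N) => //=; rewrite in_itv.
Qed.

Definition solves (W : 'rV[R]_d -> 'rV[R]_d) Om (y : R -> 'rV[R]_d) :=
  forall t : R, 0 <= t <= 1 -> Om (y t) /\ is_derive t 1 y (W (y t)).

Lemma solves_continuous W Om y : solves W Om y ->
  forall t : R, 0 <= t <= 1 -> {for t, continuous y}.
Proof. by move=> H t /H[_ /is_derive_continuous]. Qed.

(** Gronwall's inequality applies as long as [z] stays in the tube around [y];
    the estimate that it gives shows, by [no_exit], that [z] does stay there. *)
Lemma solution_dependence W Om (y : R -> 'rV[R]_d) (r M : R) :
  0 < r -> 0 <= M -> (forall t, 0 <= t <= 1 -> tame W Om (y t) r M) ->
  solves W Om y ->
  exists K, 0 < K /\ forall z, solves W Om z -> K * `|z 0 - y 0| < r ->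
    forall t, 0 <= t <= 1 -> `|z t - y t| <= K * `|z 0 - y 0| /\ `|z t - y t| <= r.
Proof.
move=> r0 M0 H sy.
have [K [K0 KP]] := @gronwall R d (d%:R * M) (mulr_ge0 (ler0n _ _) M0).
pose K' := K + 1; have K'1 : 1 <= K' by rewrite /K' lerDr ltW.
have K'0 : 0 < K' by exact: lt_le_trans K'1.
exists K'; split=> // z sz zr.
have G T : 0 <= T <= 1 -> (forall t, 0 <= t <= T -> `|z t - y t| <= r) ->
    `|z T - y T| <= K' * `|z 0 - y 0|.
  move=> T01 b; have /andP[T0 T1] := T01.
  apply: (@le_trans _ _ (K * (`|z 0 - y 0| + 0))); last first.
    by rewrite addr0 ler_wpM2r // /K' lerDl.
  apply: (KP (z - y) (fun t => W (z t) - W (y t)) T 0) => //.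
    move=> t /andP[t0 tT]; have t01 : 0 <= t <= 1 by rewrite t0 (le_trans tT).
    by apply: is_deriveB; [exact: (sz t t01).2|exact: (sy t t01).2].
  move=> t tT; have /andP[t0 tT'] := tT.
  have t01 : 0 <= t <= 1 by rewrite t0 (le_trans tT').
  rewrite addr0; apply: (tame_lip M0 (H t t01)); first exact: b.
  by rewrite subrr normr0 ltW.
have ne t : 0 <= t <= 1 -> `|z t - y t| < r.
  apply: (no_exit (g := fun t => `|z t - y t|)).
  - move=> s s01; apply: (@continuous_comp _ _ _ (fun t => z t - y t) (fun u => `|u|)).
      by apply: continuousB; [exact: (solves_continuous sz)|exact: (solves_continuous sy)].
    exact: norm_continuous.
  - by rewrite (le_lt_trans _ zr) // ler_peMl.
  - by move=> T T01 b; rewrite (le_lt_trans (G T T01 b)).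
move=> t t01; split; last exact: ltW (ne t t01).
apply: G => // s /andP[s0 st]; apply: ltW; apply: ne.
by rewrite s0 (le_trans st) //; case/andP: t01.
Qed.

Lemma solution_unique W Om (y z : R -> 'rV[R]_d) : open Om -> smooth_on Om W ->
  solves W Om y -> solves W Om z -> y 0 = z 0 -> forall t, 0 <= t <= 1 -> y t = z t.
Proof.
move=> oO sW sy sz yz0 t t01.
have [r [M [r0 M0 H]]] := tame_tube oO sW (solves_continuous sy) (fun t t01 => (sy t t01).1).
have [K [K0 /(_ z sz)]] := solution_dependence r0 M0 H sy.
rewrite yz0 subrr normr0 mulr0 => /(_ r0 t t01)[+ _].
by rewrite normr_le0 subr_eq0 => /eqP.
Qed.

End MeanValue.

(** * Smooth dependence on initial values *)

Section Variation.
Context {R : realType} {d : nat}.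
Variables (W : 'rV[R]_d -> 'rV[R]_d) (Om : set 'rV[R]_d).
Hypotheses (oO : open Om) (sW : smooth_on Om W).

(** The variational equation is linear, hence globally Lipschitz once time is
    clamped to the interval where the coefficients are controlled. *)
Lemma linear_variation (y : R -> 'rV[R]_d) v0 : solves W Om y ->
  exists v : R -> 'rV[R]_d, v 0 = v0 /\
    forall t : R, 0 <= t <= 1 -> is_derive t 1 v ('D_(v t) W (y t)).
Proof.
move=> sy.
have [r [M [r0 M0 H]]] :=
  tame_tube oO sW (solves_continuous sy) (fun t t01 => (sy t t01).1).
pose y' t := y (Num.min 1 (Num.max 0 t)).
have cl (t : R) : 0 <= Num.min 1 (Num.max 0 t) <= 1 by exact: clamp_itv.
have cy' : continuous y' by apply: continuous_clamp => //; exact: solves_continuous sy.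
pose G t (v : 'rV[R]_d) := \sum_j v 0 j *: partial j W (y' t).
have pM t j : `|partial j W (y' t)| <= M.
  by have [|_ _ _ b _] := H _ (cl t) (y' t); first by rewrite subrr normr0 ltW.
have GB t v : `|G t v| <= d%:R * M * `|v|.
  rewrite (le_trans (ler_norm_sum _ _ _)) //.
  rewrite -mulrA mulr_natl -[X in _ *+ X]card_ord -sumr_const ler_sum // => k _.
  by rewrite normrZ mulrC ler_pM // norm_coord_le.
have GL t v v' : `|G t v - G t v'| <= (d%:R * M + 1) * `|v - v'|.
  have -> : G t v - G t v' = G t (v - v').
    by rewrite /G -sumrB; apply: eq_bigr => j _; rewrite !mxE scalerBl.
  by rewrite (le_trans (GB _ _)) // ler_wpM2r // lerDl.
have Gc v : continuous (G ^~ v).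
  move=> t; rewrite /G.
  have h j : {for t, continuous (fun t => v 0 j *: partial j W (y' t))}.
    apply: (@continuous_comp _ _ _ y' (fun z => v 0 j *: partial j W z)); first exact: cy'.
    apply: differentiable_continuous; apply: differentiableZ.
    apply: smooth_diff (smooth_partial _ sW) _; exact: (sy _ (cl t)).1.
  have -> : (fun x => \sum_j v 0 j *: partial j W (y' x)) =
            \sum_j (fun t => v 0 j *: partial j W (y' t)).
    by apply/funext => s; rewrite fct_sumE.
  elim/big_rec: _ => [|j f _ cf]; first exact: cst_continuous.
  by apply: continuousD; [exact: h|exact: cf].
have L0 : 0 < d%:R * M + 1 by rewrite ltr_wpDl // mulr_ge0.
have [v [v00 vd]] := picard_lindelof L0 GL Gc (GB^~ v0).
exists v; split=> // t t01; have := vd t.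
rewrite /G /y' clampE // -deriveE_partial //.
exact: smooth_diff sW (sy t t01).1.
Qed.

(** The difference between [y (h + p)] and its candidate linear approximation
    satisfies the variational equation up to a Taylor remainder of order
    [|h|^2], and starts at [o(|h|)]; Gronwall's inequality propagates this. *)
Lemma flow_derivative {e} (S : set 'rV[R]_e) (y : 'rV[R]_e -> R -> 'rV[R]_d) p :
  open S -> S p -> (forall q, S q -> solves W Om (y q)) ->
  differentiable (y ^~ 0) p ->
  exists A : R -> 'M[R]_(e, d), forall t : R, 0 <= t <= 1 ->
    [/\ differentiable (y ^~ t) p, forall h, 'D_h (y ^~ t) p = h *m A t
      & forall h, is_derive t 1 (fun t => h *m A t) ('D_(h *m A t) W (y p t))].
Proof.
move=> oS Sp sy dy0; have syp := sy p Sp.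
have /choice[v vP] : forall i, exists v : R -> 'rV[R]_d, v 0 = partial i (y ^~ 0) p /\
    forall t : R, 0 <= t <= 1 -> is_derive t 1 v ('D_(v t) W (y p t)).
  by move=> i; exact: linear_variation.
pose A t : 'M[R]_(e, d) := \matrix_i v i t.
have AE h t : h *m A t = \sum_i h 0 i *: v i t.
  by rewrite mulmx_sum_row; apply: eq_bigr => i _; rewrite rowK.
have A0 h : h *m A 0 = 'D_h (y ^~ 0) p.
  by rewrite AE deriveE_partial //; apply: eq_bigr => i _; rewrite (vP i).1.
have Ad h (t : R) : 0 <= t <= 1 ->
    is_derive t 1 (fun t => h *m A t) ('D_(h *m A t) W (y p t)).
  move=> t01.
  have dW : differentiable W (y p t) by exact: smooth_diff sW (syp t t01).1.
  have -> : (fun t => h *m A t) = \sum_i (fun t => h 0 i *: v i t).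
    by apply/funext => s; rewrite AE fct_sumE.
  rewrite deriveE // AE linear_sum; apply: is_derive_sum => i.
  by rewrite linearZ -deriveE //; apply: is_deriveZ; exact: (vP i).2.
exists A => t t01.
suff D : forall eps : R, 0 < eps ->
    \forall h \near (0 : 'rV[R]_e), `|y (h + p) t - y p t - h *m A t| <= eps * `|h|.
  have [dy yE] := @differentiable_eps R _ _ (y ^~ t) p (mulmxr (A t))
    (@continuous_mulmxr _ _ _ (A t)) D.
  by split=> // h; [rewrite deriveE // yE|exact: Ad].
move=> eps eps0.
have [r [M [r0 M0 H]]] :=
  tame_tube oO sW (solves_continuous syp) (fun t t01 => (syp t t01).1).
have [K1 [K10 dep]] := solution_dependence r0 M0 H syp.
have [K2 [K20 gr]] := @gronwall R d (d%:R * M) (mulr_ge0 (ler0n _ _) M0).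
pose a := \sum_i `|v i 0|.
have a0 : 0 <= a by apply: sumr_ge0 => i _; exact: normr_ge0.
have hA0 (h : 'rV[R]_e) : `|h *m A 0| <= a * `|h|.
  rewrite AE (le_trans (ler_norm_sum _ _ _)) // /a mulr_suml ler_sum // => i _.
  by rewrite normrZ mulrC ler_wpM2l // norm_coord_le.
(* C * |h|^2 bounds the Taylor remainder of the field along the curve of p + h *)
pose C := d%:R * (d%:R * M) * (K1 * (1 + a)) ^+ 2.
have a1 : 0 < 1 + a by rewrite ltr_wpDr.
have C0 : 0 <= C by apply: mulr_ge0; [rewrite !mulr_ge0|exact: sqr_ge0].
pose eps' := eps / (2 * K2).
have eps'0 : 0 < eps' by rewrite divr_gt0 // mulr_gt0.
have near_small c : 0 < c -> \forall h \near (0 : 'rV[R]_e), `|h| < c.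
  by move=> c0; have /cvgrPdist_lt/(_ _ c0) := @cvg_id _ (nbhs (0 : 'rV[R]_e));
     apply: filterS => h; rewrite sub0r normrN.
have n1 : \forall h \near (0 : 'rV[R]_e), S (h + p).
  have : \forall q \near p, S q by exact: open_nbhs_nbhs.
  by rewrite (near_shift 0) subr0.
have n2 : \forall h \near (0 : 'rV[R]_e), `|h| < r / (K1 * (1 + a)).
  by apply: near_small; rewrite divr_gt0 // mulr_gt0.
have n3 : \forall h \near (0 : 'rV[R]_e), `|h| < eps' / (C + 1).
  by apply: near_small; rewrite divr_gt0 // ltr_wpDl.
have n4 := eps_differentiable dy0 eps'0.
have n5 := eps_differentiable dy0 ltr01.
near=> h.
have Sq : S (h + p) by near: h.
have h2 : `|h| < r / (K1 * (1 + a)) by near: h.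
have h3 : `|h| < eps' / (C + 1) by near: h.
have h4 : `|y (h + p) 0 - y p 0 - h *m A 0| <= eps' * `|h|.
  by rewrite A0 deriveE //; near: h.
have h5 : `|y (h + p) 0 - y p 0| <= (1 + a) * `|h|.
  have b5 : `|y (h + p) 0 - y p 0 - h *m A 0| <= 1 * `|h|.
    by rewrite A0 deriveE //; near: h.
  rewrite -[_ - _](subrK (h *m A 0)) (le_trans (ler_normD _ _)) // mulrDl lerD //.
have syq := sy _ Sq.
have h6 : K1 * `|y (h + p) 0 - y p 0| < r.
  rewrite (le_lt_trans (ler_wpM2l (ltW K10) h5)) // mulrA mulrC -ltr_pdivlMr //.
  by rewrite mulr_gt0.
pose q := h + p; rewrite -/q in syq h4 h5 h6 *.
have h7 s : 0 <= s <= 1 -> `|y q s - y p s| <= K1 * (1 + a) * `|h| /\ `|y q s - y p s| <= r.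
  move=> s01; have [b1 b2] := dep (y q) syq h6 s s01; split=> //.
  by rewrite (le_trans b1) // -mulrA ler_wpM2l // ltW.
pose u s := y q s - y p s - h *m A s.
have /andP[t0 t1] := t01.
have : `|u t| <= K2 * (`|u 0| + C * `|h| ^+ 2).
  apply: (gr u (fun s => W (y q s) - W (y p s) - 'D_(h *m A s) W (y p s)) t) => //.
  - by rewrite mulr_ge0 ?sqr_ge0.
  - move=> s /andP[s0 st]; have s01 : 0 <= s <= 1 by rewrite s0 (le_trans st).
    apply: is_deriveB; last exact: Ad.
    by apply: is_deriveB; [exact: (syq s s01).2|exact: (syp s s01).2].
  move=> s /andP[s0 st]; have s01 : 0 <= s <= 1 by rewrite s0 (le_trans st).
  have [b1 b2] := h7 s s01.
  have dW : differentiable W (y p s) by exact: smooth_diff sW (syp s s01).1.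
  have -> : W (y q s) - W (y p s) - 'D_(h *m A s) W (y p s) =
     'D_(u s) W (y p s) + (W (y q s) - W (y p s) - 'D_(y q s - y p s) W (y p s)).
    rewrite !deriveE //.
    have -> : 'd W (y p s) (u s) = 'd W (y p s) (y q s - y p s) - 'd W (y p s) (h *m A s).
      exact: linearB.
    by rewrite [RHS]addrC [RHS]addrA subrK.
  apply: (le_trans (ler_normD _ _)); apply: lerD.
    rewrite deriveE_partial // (le_trans (ler_norm_sum _ _ _)) //.
    rewrite -mulrA mulr_natl -[X in _ *+ X]card_ord -sumr_const ler_sum // => k _.
    rewrite normrZ mulrC ler_pM // ?norm_coord_le //.
    by have [|_ _ _ b _] := H s s01 (y p s); first by rewrite subrr normr0 ltW.
  apply: (le_trans (tame_taylor M0 (H s s01) b2)).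
  have K1a : 0 <= K1 * (1 + a) by rewrite mulr_ge0 // ltW.
  rewrite /C -[leRHS]mulrA; apply: ler_wpM2l; first by rewrite !mulr_ge0.
  by rewrite -exprMn ler_pXn2r // nnegrE ?(mulr_ge0 K1a).
move=> /le_trans; apply.
have h8 : C * `|h| ^+ 2 <= eps' * `|h|.
  rewrite expr2 mulrA ler_wpM2r //.
  apply: (@le_trans _ _ ((C + 1) * `|h|)); first by rewrite ler_wpM2r // lerDl.
  by rewrite mulrC -ler_pdivlMr ?ltW // ltr_wpDl.
apply: (@le_trans _ _ (K2 * (eps' * `|h| + eps' * `|h|))).
  by apply: ler_wpM2l; [exact: ltW|exact: lerD].
rewrite -mulrDl mulrA /eps' (_ : K2 * _ = eps) //; field.
by rewrite gt_eqF.
Unshelve. all: by end_near. Qed.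

End Variation.

Section FlowSmooth.
Context {R : realType}.

(** The field on the tangent bundle whose integral curves are the integral
    curves of [W] together with their variations. *)
Definition tangent_lift {d} (W : 'rV[R]_d -> 'rV[R]_d) (z : 'rV[R]_(d + d)) : 'rV[R]_(d + d) :=
  row_mx (W (lsubmx z)) ('D_(rsubmx z) W (lsubmx z)).

Lemma smooth_lsubmx {a b} (U : set 'rV[R]_(a + b)) : open U -> smooth_on U (lsubmx : _ -> 'rV[R]_a).
Proof.
move=> oU; apply/smooth_rVP => // j.
apply: (smooth_ext (F := fun x => x 0 (lshift b j)) oU); last exact: smooth_coord.
by move=> x _; rewrite mxE.
Qed.

Lemma smooth_rsubmx {a b} (U : set 'rV[R]_(a + b)) : open U -> smooth_on U (rsubmx : _ -> 'rV[R]_b).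
Proof.
move=> oU; apply/smooth_rVP => // j.
apply: (smooth_ext (F := fun x => x 0 (rshift a j)) oU); last exact: smooth_coord.
by move=> x _; rewrite mxE.
Qed.

Lemma smooth_row_mx {n a b} (U : set 'rV[R]_n) (F : _ -> 'rV[R]_a) (G : _ -> 'rV[R]_b) :
  open U -> smooth_on U F -> smooth_on U G -> smooth_on U (fun x => row_mx (F x) (G x)).
Proof.
move=> oU /(smooth_rVP _ oU) sF /(smooth_rVP _ oU) sG; apply/smooth_rVP => // j.
case: (splitP j) => k jk.
  have -> : j = lshift b k by exact: val_inj.
  by apply: (smooth_ext oU _ (sF k)) => x _; rewrite row_mxEl.
have -> : j = rshift a k by exact: val_inj.
by apply: (smooth_ext oU _ (sG k)) => x _; rewrite row_mxEr.
Qed.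

Lemma open_lsubmx {a b} (Om : set 'rV[R]_a) : open Om ->
  open [set z : 'rV[R]_(a + b) | Om (lsubmx z)].
Proof.
move=> oO; apply: (open_comp (f := lsubmx : 'rV[R]_(a + b) -> 'rV[R]_a)) => // z _.
exact: (smooth_continuous (smooth_lsubmx openT) I).
Qed.

Lemma smooth_tangent_lift {d} (W : 'rV[R]_d -> 'rV[R]_d) Om : open Om -> smooth_on Om W ->
  smooth_on [set z | Om (lsubmx z)] (tangent_lift W).
Proof.
move=> oO sW; have oO' := @open_lsubmx d d Om oO.
have comp (F : 'rV[R]_d -> 'rV[R]_d) : smooth_on Om F ->
    smooth_on [set z : 'rV[R]_(d + d) | Om (lsubmx z)] (fun z => F (lsubmx z)).
  by move=> sF; apply: (smooth_comp (V := Om)) => //; exact: smooth_lsubmx.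
apply: smooth_row_mx => //; first exact: comp.
apply: (smooth_ext (F := fun z => \sum_j rsubmx z 0 j *: partial j W (lsubmx z)) oO').
  by move=> z Oz; rewrite deriveE_partial //; exact: smooth_diff sW Oz.
apply: smooth_sum => // j _; apply/smooth_rVP => // k.
apply: (smooth_ext (F := fun z => rsubmx z 0 j * partial j W (lsubmx z) 0 k) oO').
  by move=> z _; rewrite [RHS]mxE.
apply: smoothM => //.
  by have /(smooth_rVP _ oO')/(_ j) := smooth_rsubmx oO'.
by have /(smooth_rVP _ oO')/(_ k) := comp _ (smooth_partial j sW).
Qed.

(** Bootstrapping: a partial derivative of a family of solutions is a component
    of a family of solutions of the lifted field, whose order of
    differentiability is known by induction. It is essential that the domain
    of the parameters stays the same at each step. *)
Lemma flow_Ck k : forall (d e : nat) (W : 'rV[R]_d -> 'rV[R]_d) Om (S : set 'rV[R]_e)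
    (y : 'rV[R]_e -> R -> 'rV[R]_d),
  open Om -> smooth_on Om W -> open S -> (forall q, S q -> solves W Om (y q)) ->
  smooth_on S (y ^~ 0) -> forall t : R, 0 <= t <= 1 -> Ck k S (y ^~ t).
Proof.
elim: k => [|k IH] d e W Om S y oO sW oS sy sy0 t t01.
  case=> // _ x Sx /=.
  by have [A /(_ t t01)[]] := flow_derivative oO sW oS Sx sy (smooth_diff sy0 Sx).
have /choice[A AP] : forall x, exists A : R -> 'M[R]_(e, d), S x -> forall t : R, 0 <= t <= 1 ->
    [/\ differentiable (y ^~ t) x, forall h, 'D_h (y ^~ t) x = h *m A t
      & forall h, is_derive t 1 (fun t => h *m A t) ('D_(h *m A t) W (y x t))].
  move=> x; have [Sx|nSx] := pselect (S x); last by exists (fun=> 0).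
  have [A AP] := flow_derivative oO sW oS Sx sy (smooth_diff sy0 Sx).
  by exists A.
apply/CkSP; split=> [x Sx|i]; first by have [] := AP x Sx t t01.
pose z x s := row_mx (y x s) (delta_mx 0 i *m A x s).
have sz q : S q -> solves (tangent_lift W) [set z | Om (lsubmx z)] (z q).
  move=> Sq s s01; have [Oy dy] := sy q Sq s s01.
  rewrite /= /z /tangent_lift row_mxKl row_mxKr; split=> //.
  have [_ _ /(_ (delta_mx 0 i)) dA] := AP q Sq s s01.
  by apply: is_derive_row_mx.
have t00 : 0 <= (0:R) <= 1 by rewrite lexx ler01.
have sz0 : smooth_on S (z ^~ 0).
  apply: smooth_row_mx => //.
  apply: (smooth_ext oS _ (smooth_partial i sy0)) => x Sx.
  by have [_ E _] := AP x Sx 0 t00; rewrite /partial E.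
have := IH _ _ _ _ _ _ (open_lsubmx oO) (smooth_tangent_lift oO sW) oS sz sz0 t t01.
move=> /(Ck_mxP _ _ oS) cz; apply/Ck_mxP => // i' j.
apply: (Ck_ext oS _ (cz 0 (rshift d j))) => x Sx.
by have [_ E _] := AP x Sx t t01; rewrite /z row_mxEr /partial E ord1.
Qed.

Theorem flow_smooth {d e : nat} (W : 'rV[R]_d -> 'rV[R]_d) Om (S : set 'rV[R]_e)
    (y : 'rV[R]_e -> R -> 'rV[R]_d) (t : R) :
  open Om -> smooth_on Om W -> open S -> (forall q, S q -> solves W Om (y q)) ->
  smooth_on S (y ^~ 0) -> 0 <= t <= 1 -> smooth_on S (y ^~ t).
Proof.
by move=> oO sW oS sy sy0 t01; apply/smoothE => k; apply: flow_Ck sy _ _ t01.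
Qed.

End FlowSmooth.

(** * Local flows of a frame *)

Section LocalFlow.
Context {R : realType} {n : nat}.
Variables (X : 'rV[R]_n -> 'M[R]_n) (V : set 'rV[R]_n) (p0 : 'rV[R]_n).
Hypotheses (oV : open V) (Vp0 : V p0).
Hypothesis sX : forall i j, smooth_on V (fun p => X p i j).

(** The coefficients [a] of the combination are frozen state variables: smooth
    dependence on parameters becomes smooth dependence on initial values. *)
Definition frame_field (z : 'rV[R]_(n + n)) : 'rV[R]_(n + n) :=
  row_mx 0 (lsubmx z *m X (rsubmx z)).

Definition frame_dom : set 'rV[R]_(n + n) := [set z | V (rsubmx z)].

Lemma open_frame_dom : open frame_dom.
Proof.
apply: (open_comp (f := rsubmx : 'rV[R]_(n + n) -> 'rV[R]_n)) => // z _.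
exact: (smooth_continuous (smooth_rsubmx openT) I).
Qed.

Lemma smooth_frame_field : smooth_on frame_dom frame_field.
Proof.
have oF := open_frame_dom.
apply: smooth_row_mx => //; first exact: smooth_cst.
apply/smooth_rVP => // j.
apply: (smooth_ext (F := fun z => \sum_k lsubmx z 0 k * X (rsubmx z) k j) oF).
  by move=> z _; rewrite [RHS]mxE.
apply: smooth_sum => // k _; apply: smoothM => //.
  by have /(smooth_rVP _ oF)/(_ k) := smooth_lsubmx oF.
apply/smoothE => K.
apply: (Ck_comp (F := fun p => X p k j) (G := rsubmx) oV oF) => //.
  by have /smoothE := sX k j.
by have /smoothE := smooth_rsubmx oF.
Qed.

Definition coord_clamp (r : R) (x : 'rV[R]_n) : 'rV[R]_n :=
  \row_j Num.min (p0 0 j + r) (Num.max (p0 0 j - r) (x 0 j)).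

Lemma clamp_lip (a b s t : R) :
  `|Num.min b (Num.max a s) - Num.min b (Num.max a t)| <= `|s - t|.
Proof.
wlog st : s t / s <= t.
  move=> H; case/orP: (le_total s t) => [/H//|/H].
  by rewrite distrC (distrC s).
have : 0 <= Num.max a t - Num.max a s <= t - s.
  by case: (leP a s) => ?; case: (leP a t) => ?; lra.
move: (Num.max a t) (Num.max a s) => u v uv.
have : 0 <= Num.min b u - Num.min b v <= u - v.
  by case: (leP b u) => ?; case: (leP b v) => ?; lra.
by move=> H; rewrite distrC (distrC s) !ger0_norm ?subr_ge0 //; lra.
Qed.

Lemma coord_clamp_lip r x y : `|coord_clamp r x - coord_clamp r y| <= `|x - y|.
Proof.
apply/norm_rV_le => // i j; rewrite ord1 !mxE.
apply: (le_trans (clamp_lip _ _ _ _)).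
by have := norm_coord_le (x - y) 0 j; rewrite !mxE.
Qed.

Lemma coord_clamp_ball r x : 0 <= r -> `|coord_clamp r x - p0| <= r.
Proof.
move=> r0; apply/norm_rV_le => // i j; rewrite ord1 !mxE ler_norml.
have [|h1 h2] := andP (@clamp_itv R (p0 0 j - r) (p0 0 j + r) (x 0 j) _); first by lra.
by apply/andP; split; lra.
Qed.

Lemma coord_clamp_id r x : `|x - p0| <= r -> coord_clamp r x = x.
Proof.
move=> xr; apply/rowP => j; rewrite mxE clampE //.
have := le_trans (norm_coord_le (x - p0) 0 j) xr; rewrite !mxE ler_norml => /andP[? ?].
by apply/andP; split; lra.
Qed.

Lemma norm_row_mx {a b} (u : 'rV[R]_a) (v : 'rV[R]_b) c : 0 <= c ->
  `|row_mx u v| <= c <-> `|u| <= c /\ `|v| <= c.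
Proof.
move=> c0; split=> [H|[Hu Hv]].
  split; apply/norm_rV_le => // i j.
    by have := norm_coord_le (row_mx u v) i (lshift b j); rewrite row_mxEl => /le_trans; apply.
  by have := norm_coord_le (row_mx u v) i (rshift a j); rewrite row_mxEr => /le_trans; apply.
apply/norm_rV_le => // i j; case: (splitP j) => k jk.
  have -> : j = lshift b k by exact: val_inj.
  by rewrite row_mxEl (le_trans (norm_coord_le _ _ _)).
have -> : j = rshift a k by exact: val_inj.
by rewrite row_mxEr (le_trans (norm_coord_le _ _ _)).
Qed.

(** The field vanishes at [a = 0], so for small [a] the speed is small and
    solutions starting near [p0] exist up to time 1 without leaving the ball.
    Clamping the coordinates to that ball makes the field globally Lipschitz
    and does not change it along these solutions. *)
Lemma local_flow : exists (rho : R) (h : 'rV[R]_n -> 'rV[R]_n -> R -> 'rV[R]_n),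
  0 < rho /\ forall a q, `|a| < rho -> `|q - p0| < rho ->
    h a q 0 = q /\ forall t : R, 0 <= t <= 1 ->
      V (h a q t) /\ is_derive t 1 (h a q) (a *m X (h a q t)).
Proof.
have z0dom : frame_dom (row_mx 0 p0) by rewrite /frame_dom /= row_mxKr.
have [r [M [r0 M0 H]]] := smooth_tame open_frame_dom smooth_frame_field z0dom.
pose L := (n + n)%:R * M.
have L0 : 0 <= L by rewrite mulr_ge0.
have inball (a q : 'rV[R]_n) : `|a| <= r -> `|q - p0| <= r ->
    `|row_mx a q - row_mx 0 p0| <= r.
  move=> ar qr; rewrite opp_row_mx add_row_mx subr0.
  by apply/norm_row_mx => //; exact: ltW.
have lip (a q a' q' : 'rV[R]_n) (c : R) : `|a| <= r -> `|q - p0| <= r -> `|a'| <= r -> `|q' - p0| <= r ->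
    `|a - a'| <= c -> `|q - q'| <= c -> `|a *m X q - a' *m X q'| <= L * c.
  move=> ar qr a'r q'r ac qc.
  have c0 : 0 <= c by apply: le_trans ac.
  have := tame_lip M0 H (inball _ _ ar qr) (inball _ _ a'r q'r).
  rewrite /frame_field !row_mxKl !row_mxKr !opp_row_mx !add_row_mx subrr => H1.
  have Lc0 : 0 <= L * c by rewrite mulr_ge0.
  have : `|row_mx (0 : 'rV[R]_n) (a *m X q - a' *m X q')| <= L * c.
    apply: (le_trans H1); apply: ler_wpM2l => //.
    by apply/norm_row_mx.
  by move/(norm_row_mx _ _ Lc0) => [].
(* the initial displacement and the distance L * rho travelled in unit time are
   both at most r / 2 *)
pose rho := r / (2 * (L + 1)).
have L1 : 0 < L + 1 by rewrite ltr_wpDl.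
have rho0 : 0 < rho by rewrite divr_gt0 // mulr_gt0.
have rhor : rho <= r / 2.
  rewrite /rho invfM mulrA ler_piMr ?divr_ge0 ?(ltW r0) // invf_le1 //; lra.
have rhoL : L * rho <= r / 2.
  have -> : r / 2 = (L + 1) * rho by rewrite /rho; field; rewrite gt_eqF.
  by rewrite ler_wpM2r ?(ltW rho0) // lerDl.
have /choice[h hP] : forall aq : 'rV[R]_n * 'rV[R]_n, exists h : R -> 'rV[R]_n,
   `|aq.1| < rho -> `|aq.2 - p0| < rho -> h 0 = aq.2 /\ forall t : R, 0 <= t <= 1 ->
      V (h t) /\ is_derive t 1 h (aq.1 *m X (h t)).
  move=> [a q] /=.
  have [[ar qr]|nar] := pselect (`|a| < rho /\ `|q - p0| < rho); last first.
    by exists (fun=> 0) => ? ?; exfalso; apply: nar.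
  have ar' : `|a| <= r by rewrite (le_trans (ltW ar)) // (le_trans rhor) //; lra.
  have cb x : `|coord_clamp r x - p0| <= r by exact: coord_clamp_ball (ltW r0).
  pose G (t : R) x := a *m X (coord_clamp r x).
  have GL t x x' : `|G t x - G t x'| <= (L + 1) * `|x - x'|.
    apply: (@le_trans _ _ (L * `|x - x'|)); last by rewrite ler_wpM2r // lerDl.
    by apply: lip => //; [rewrite subrr normr0|exact: coord_clamp_lip].
  have GB t x : `|G t x| <= L * rho.
    have := @lip a (coord_clamp r x) 0 (coord_clamp r x) rho ar' (cb x).
    rewrite mul0mx !subr0 subrr normr0 => -> //; [exact: ltW|exact: ltW|exact: ltW].
  have Gc x : continuous (G ^~ x) by move=> t; exact: cst_continuous.
  have [h [h0 hd]] := picard_lindelof L1 GL Gc (GB^~ q).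
  exists h => _ _; split=> // t /andP[t0 t1].
  have hq : `|h t - q| <= r / 2.
    apply/norm_rV_le => [|i j]; first by rewrite divr_ge0 // ltW.
    rewrite ord1 !mxE.
    have := @is_derive_dominated R (fun t => h t 0 j) (fun t => G t (h t) 0 j)
      (fun t => L * rho * t) (fun=> L * rho) 0 t t0.
    rewrite mulr0 subr0 h0 => HH; apply: le_trans (HH _ _ _) _.
    - by move=> s _; have /is_derive_rVP := hd s; apply.
    - by move=> s _; rewrite -[X in is_derive _ _ _ X]mulr1; exact: is_deriveZ.
    - by move=> s _; rewrite (le_trans (norm_coord_le _ _ _)).
    apply: le_trans rhoL; rewrite ler_piMr // mulr_ge0 //; exact: ltW.
  have hr : `|h t - p0| <= r.
    have -> : h t - p0 = (h t - q) + (q - p0) by rewrite addrA subrK.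
    rewrite (le_trans (ler_normD _ _)) // (splitr r) lerD //.
    by rewrite (le_trans (ltW qr)).
  split; last by have := hd t; rewrite /G coord_clamp_id.
  have r0' : `|0 : 'rV[R]_n| <= r by rewrite normr0 ltW.
  by have [+ _ _ _ _] := H _ (inball _ _ r0' hr); rewrite /frame_dom /= row_mxKr.
by exists rho, (fun a q => h (a, q)); split=> // a q; exact: (hP (a, q)).
Qed.

End LocalFlow.

(** * Straightening a commuting frame *)

Section FrobeniusChart.
Context {R : realType} {n : nat}.
Variables (X : 'rV[R]_n -> 'M[R]_n) (V : set 'rV[R]_n) (p0 : 'rV[R]_n) (l : nat).
Variable Q : 'M[R]_n.
Hypotheses (oV : open V) (Vp0 : V p0).
Hypothesis sX : forall i j, smooth_on V (fun p => X p i j).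
Hypothesis ln : (l <= n)%N.
Hypothesis uQ : Q \in unitmx.
Let Pi : 'M[R]_n := pid_mx l.
(* The first l rows of X are the frame, normalised against the first l columns
   of Q; its other rows vanish. *)
Hypothesis XQ : forall p, V p -> X p *m Q *m Pi = Pi.
Hypothesis PX : forall p, V p -> Pi *m X p = X p.
Hypothesis XX : forall i j p, V p ->
  lie_bracket (fun q => row i (X q)) (fun q => row j (X q)) p = 0.

Let Cp : 'M[R]_n := copid_mx l.

Let PiPi : Pi *m Pi = Pi. Proof. exact: pid_mx_id. Qed.
Let CpPi : Cp *m Pi = 0. Proof. exact: mul_copid_mx_pid. Qed.
Let CpCp : Cp *m Cp = Cp. Proof. exact: copid_mx_id. Qed.
Let PiCp : Pi + Cp = 1%:M. Proof. by rewrite /Cp /copid_mx addrC subrK. Qed.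

Let sxi i : smooth_on V (fun q => row i (X q)).
Proof.
apply/smooth_rVP => // j.
by apply: (smooth_ext (F := fun q => X q i j) oV) => [q _|]; [rewrite mxE|].
Qed.

Let t0 : 0 <= (0 : R) <= 1. Proof. by rewrite lexx ler01. Qed.
Let t1 : 0 <= (1 : R) <= 1. Proof. by rewrite lexx ler01. Qed.

Section WithFlow.
Variables (rho : R) (h : 'rV[R]_n -> 'rV[R]_n -> R -> 'rV[R]_n).
Hypothesis rho0 : 0 < rho.
Hypothesis hP : forall a q, `|a| < rho -> `|q - p0| < rho ->
    h a q 0 = q /\ forall t : R, 0 <= t <= 1 ->
      V (h a q t) /\ is_derive t 1 (h a q) (a *m X (h a q t)).

Let oF := @open_frame_dom R n V oV.
Let sF := smooth_frame_field oV sX.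

Let near0 (a : 'rV[R]_n) := `|a| < rho.
Let nearp (q : 'rV[R]_n) := `|q - p0| < rho.

Lemma flow_solves a q : near0 a -> nearp q ->
  solves (frame_field X) (frame_dom V) (fun t => row_mx a (h a q t)).
Proof.
move=> na nq t t01; have [_ /(_ t t01)[Vh dh]] := hP na nq.
rewrite /frame_dom /frame_field /= row_mxKl row_mxKr; split=> //.
by apply: is_derive_row_mx => //; exact: is_derive_cst.
Qed.

(** The normalisation of the frame makes the projection of the velocity
    constant. *)
Lemma flow_proj a q t : near0 a -> nearp q -> 0 <= t <= 1 ->
  (h a q t - q) *m Q *m Pi = t *: (a *m Pi).
Proof.
move=> na nq t01; have [h0 hd] := hP na nq.
have /andP[t_ge0 t_le1] := t01.
pose B := Q *m Pi; pose f s := (h a q s - q) *m B.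
have fd (s : R) : 0 <= s <= t -> is_derive s 1 f (a *m Pi).
  move=> /andP[s0 st]; have s01 : 0 <= s <= 1 by rewrite s0 (le_trans st).
  have [Vh dh] := hd s s01.
  rewrite -(XQ Vh) -mulmxA -/B mulmxA.
  have dhq : is_derive s 1 (fun s => h a q s - q) (a *m X (h a q s)).
    by apply: (is_derive_eq (is_deriveB dh (is_derive_cst q s 1))); rewrite subr0.
  by have := is_derive_comp_vec dhq (differentiable_mulmxr B _); rewrite derive_mulmxr.
rewrite -mulmxA -/B -/(f t); apply/eqP; rewrite -subr_eq0 -normr_le0.
apply/norm_rV_le => // i j; rewrite ord1 {i}.
have := @is_derive_dominated R (fun s => (f s - s *: (a *m Pi)) 0 j) (fun=> 0)
   (cst 0) (cst 0) 0 t t_ge0.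
rewrite scale0r subr0 /f h0 subrr mul0mx -/(f t) [(0 : 'rV_n) 0 j]mxE subr0.
rewrite [cst 0 t - cst 0 0]subrr; apply=> // s st; last by rewrite normr0.
have sa : is_derive s 1 (fun s => s *: (a *m Pi)) (a *m Pi).
  rewrite -[X in is_derive _ _ _ X]scale1r; apply: is_derive_scale.
have /is_derive_rVP/(_ j) := is_deriveB (fd s st) sa.
by rewrite subrr mxE.
Qed.

(** Run the curve backwards and use uniqueness of solutions. *)
Lemma flow_back a q : near0 a -> nearp q -> nearp (h a q 1) ->
  h (- a) (h a q 1) 1 = q.
Proof.
move=> na nq nh; have nNa : near0 (- a) by rewrite /near0 normrN.
have s1 := flow_solves nNa nh.
have s2 : solves (frame_field X) (frame_dom V) (fun t => row_mx (- a) (h a q (1 - t))).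
  move=> t t01; have t01' : 0 <= 1 - t <= 1 by move: t01; lra.
  have [_ /(_ _ t01')[Vh dh]] := hP na nq.
  rewrite /frame_dom /frame_field /= row_mxKl row_mxKr; split=> //.
  have d1 : is_derive t 1 (fun t => h a q (1 - t)) (- a *m X (h a q (1 - t))).
    rewrite mulNmx -scaleN1r; apply: (is_derive_comp_real (u := fun t => 1 - t)) dh.
    by apply: (is_derive_eq (is_deriveB (is_derive_cst (1 : R) t 1) (is_derive_id t 1))); rewrite sub0r.
  by apply: is_derive_row_mx => //; exact: is_derive_cst.
have := solution_unique oF sF s1 s2.
have [h0 _] := hP nNa nh; rewrite h0 subr0 => /(_ erefl 1 t1).
by move=> /eq_row_mx[_ ->]; rewrite subrr; have [] := hP na nq.
Qed.

Lemma flow_smooth_init {e} (S : set 'rV[R]_e) (a q : 'rV[R]_e -> 'rV[R]_n) t :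
  open S -> smooth_on S a -> smooth_on S q ->
  (forall x, S x -> near0 (a x)) -> (forall x, S x -> nearp (q x)) ->
  0 <= t <= 1 -> smooth_on S (fun x => h (a x) (q x) t).
Proof.
move=> oS sa sq na nq t01.
have sol x : S x -> solves (frame_field X) (frame_dom V) (fun t => row_mx (a x) (h (a x) (q x) t)).
  by move=> Sx; apply: flow_solves; [exact: na|exact: nq].
have init : smooth_on S (fun x => row_mx (a x) (h (a x) (q x) 0)).
  apply: smooth_row_mx => //; apply: (smooth_ext oS _ sq) => x Sx.
  by have [-> _] := hP (na x Sx) (nq x Sx).
have /(smooth_rVP _ oS) s := flow_smooth oF sF oS sol init t01.
apply/smooth_rVP => // j; apply: (smooth_ext oS _ (s (rshift n j))) => x _.
by rewrite row_mxEr.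
Qed.

(** [Ap p] holds the coefficients of the combination of the frame that moves
    [p] in unit time to the point [H p] of the transversal through [p0] on
    which the projected coordinates vanish. Following the frame does not change
    [H p], which makes its coordinates first integrals. *)
Let Ap (p : 'rV[R]_n) := - ((p - p0) *m Q *m Pi).
Let H p := h (Ap p) p 1.
Let V1 : set 'rV[R]_n := [set p | near0 (Ap p) /\ nearp p].

Let smoothAp U : open U -> smooth_on U Ap.
Proof.
move=> oU; apply: (smooth_ext (F := fun p => p *m (- (Q *m Pi)) + p0 *m (Q *m Pi)) oU).
  by move=> p _; rewrite /Ap -mulmxA mulmxN mulmxBl opprB addrC.
by apply: smoothD => //; [exact: smooth_linear|exact: smooth_cst].
Qed.

Let smooth_idB U (c : 'rV[R]_n) : open U -> smooth_on U (fun p => p - c).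
Proof.
move=> oU; apply: (smooth_ext (F := fun p => p *m 1%:M - c) oU).
  by move=> p _; rewrite mulmx1.
by apply: smoothD => //; [exact: smooth_linear|exact: smooth_cst].
Qed.

Let open_norm_lt (F : 'rV[R]_n -> 'rV[R]_n) : smooth_on setT F ->
  open [set p | `|F p| < rho].
Proof.
move=> sFF.
have -> : [set p | `|F p| < rho] = (fun p => `|F p|) @^-1` [set x | x < rho] by [].
apply: open_comp => [p _|]; last exact: open_lt.
apply: (@continuous_comp _ _ _ F (fun u => `|u|)); last exact: norm_continuous.
exact: smooth_continuous sFF I.
Qed.

Let oV1 : open V1.
Proof.
apply: openI; apply: open_norm_lt; first exact: smoothAp openT.
exact: smooth_idB openT.
Qed.

Let V1V p : V1 p -> V p.
Proof.
move=> [na nq]; have [h0 hd] := hP na nq.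
by have [] := hd 0 t0; rewrite h0.
Qed.

Let smoothH : smooth_on V1 H.
Proof.
apply: flow_smooth_init => //; first exact: smoothAp.
- apply: (smooth_ext (F := fun q => q - 0) oV1); first by move=> q _; rewrite subr0.
  exact: smooth_idB.
- by move=> q [].
- by move=> q [].
Qed.

(** The variation of the curve [g] from [p] to [H p] caused by displacing [p]
    along the [i]-th frame field is [c t]: a first component that changes the
    coefficients, and the [i]-th frame field at [g t] scaled by [1 - t]. The
    commutation of the frame is what makes [c] solve the variational equation,
    and the second component of [c] vanishes at the end of the curve. *)
Lemma first_integral p i : V1 p -> 'D_(row i (X p)) H p = 0.
Proof.
move=> V1p; have Vp := V1V V1p.
pose y q t := row_mx (Ap q) (h (Ap q) q t).
have sy q : V1 q -> solves (frame_field X) (frame_dom V) (y q).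
  by move=> [? ?]; exact: flow_solves.
have y0E q : V1 q -> y q 0 = row_mx (Ap q) q.
  by move=> [na nq]; rewrite /y (hP na nq).1.
have sid : smooth_on V1 (fun q : 'rV[R]_n => q).
  apply: (smooth_ext (F := fun q => q - 0) oV1); first by move=> q _; rewrite subr0.
  exact: smooth_idB.
have sy0 : smooth_on V1 (y ^~ 0).
  apply: (smooth_ext (F := fun q => row_mx (Ap q) q) oV1).
    by move=> q /y0E ->.
  by apply: smooth_row_mx => //; exact: smoothAp.
have [A AP] := flow_derivative oF sF oV1 V1p sy (smooth_diff sy0 V1p).
pose v := row i (X p).
pose g t := h (Ap p) p t.
have [g0 gd] := hP V1p.1 V1p.2; rewrite -/(g 0) in g0.
pose b : 'rV[R]_n := - row i Pi.
pose c t := row_mx b ((1 - t) *: row i (X (g t))).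
have bX q : V q -> b *m X q = - row i (X q).
  by move=> Vq; rewrite /b mulNmx -row_mul PX.
have dX j q : V q -> differentiable (fun q => row j (X q)) q.
  by move=> Vq; exact: smooth_diff (sxi j) Vq.
have dc (t : R) : 0 <= t <= 1 -> is_derive t 1 c ('D_(c t) (frame_field X) (y p t)).
  move=> t01; have [Vg dg] := gd t t01; rewrite -/g in Vg dg.
  have Fy : frame_dom V (y p t) by rewrite /frame_dom /= row_mxKr.
  have dF : differentiable (frame_field X) (y p t) by exact: smooth_diff sF Fy.
  have DF w : 'D_(row_mx b w) (frame_field X) (y p t) =
      row_mx 0 (- row i (X (g t)) + \sum_k Ap p 0 k *: 'D_w (fun q => row k (X q)) (g t)).
    pose u : 'rV[R]_(n + n) := row_mx b w.
    have d1 := is_derive_line u dF.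
    have d2 : is_derive (0 : R) 1 (fun s => row_mx (0 : 'rV[R]_n)
        (\sum_k (Ap p 0 k + b 0 k * s) *: row k (X (g t + s *: w))))
        (row_mx 0 (\sum_k (b 0 k *: row k (X (g t)) +
           Ap p 0 k *: 'D_w (fun q => row k (X q)) (g t)))).
      apply: is_derive_row_mx.
      have -> : (fun s : R => \sum_k (Ap p 0 k + b 0 k * s) *: row k (X (g t + s *: w))) =
          \sum_k (fun s : R => (Ap p 0 k + b 0 k * s) *: row k (X (g t + s *: w))).
        by apply/funext => s; rewrite fct_sumE.
      apply: is_derive_sum => k.
      have e1 : is_derive (0 : R) 1 (fun s : R => Ap p 0 k + b 0 k * s) (b 0 k).
        have e2 := is_deriveZ (b 0 k) (is_derive_id (0 : R) 1).
        apply: (is_derive_eq (is_deriveD (is_derive_cst (Ap p 0 k) (0 : R) 1) e2)).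
        by rewrite add0r /GRing.scale /= mulr1.
      apply: (is_derive_eq (is_derive_scaleM e1 (is_derive_line w (dX k _ Vg)))).
      by rewrite scale0r mulr0 !addr0.
    have <- : \sum_k b 0 k *: row k (X (g t)) = - row i (X (g t)).
      by rewrite -bX // mulmx_sum_row.
    rewrite -big_split /=.
    have E : (fun s : R => frame_field X (y p t + s *: u)) =
        (fun s => row_mx 0 (\sum_k (Ap p 0 k + b 0 k * s) *: row k (X (g t + s *: w)))).
      apply/funext => s; rewrite /frame_field /y /u scale_row_mx add_row_mx row_mxKl row_mxKr.
      congr row_mx; rewrite mulmx_sum_row; apply: eq_bigr => k _.
      by rewrite !mxE mulrC.
    by rewrite E in d1; have [_ <-] := d1; have [_ ->] := d2.
  rewrite DF; apply: is_derive_row_mx.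
  have e1 : is_derive t 1 (fun t : R => 1 - t) (-1).
    by apply: (is_derive_eq (is_deriveB (is_derive_cst (1 : R) t 1) (is_derive_id t 1))); rewrite sub0r.
  have e2 := is_derive_comp_vec dg (dX i _ Vg).
  apply: (is_derive_eq (is_derive_scaleM e1 e2)).
  rewrite scaleN1r; congr (_ + _).
  have Dlin (F : 'rV[R]_n -> 'rV[R]_n) (w : 'rV[R]_n) s : differentiable F (g t) ->
      'D_(s *: w) F (g t) = s *: 'D_w F (g t).
    by move=> dFF; rewrite !deriveE // linearZ.
  rewrite mulmx_sum_row deriveE ?linear_sum; last exact: dX.
  apply: eq_bigr => k _ /=.
  rewrite linearZ -deriveE; last exact: dX.
  rewrite Dlin; last exact: dX.
  rewrite !scalerA mulrC; congr (_ *: _).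
  have := XX i k Vg; rewrite /lie_bracket => /eqP; rewrite subr_eq0 => /eqP ->.
  by [].
have c0E : v *m A 0 = c 0.
  have [_ DE0 _] := AP 0 t0; rewrite -DE0.
  have -> : 'D_v (y ^~ 0) p = 'D_v (fun q => row_mx (Ap q) q) p.
    by apply: near_eq_derive; exact: (open_near oV1 V1p y0E).
  have dI : differentiable (fun q => row_mx (Ap q) q) p.
    by apply: smooth_diff V1p; apply: smooth_row_mx => //; exact: smoothAp.
  have [_ <-] := is_derive_line v dI.
  have vQ : v *m Q *m Pi = row i Pi by rewrite /v -!row_mul XQ.
  have -> : (fun s : R => row_mx (Ap (p + s *: v)) (p + s *: v)) =
      (fun s => row_mx (Ap p) p + s *: row_mx b v).
    apply/funext => s; rewrite scale_row_mx add_row_mx; congr row_mx.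
    by rewrite /Ap /b -vQ addrAC !mulmxDl opprD -!scalemxAl scalerN.
  have d1 : is_derive (0 : R) 1 (fun s : R => s *: row_mx b v) (1 *: row_mx b v).
    exact: is_derive_scale.
  have [_ ->] := is_deriveD (is_derive_cst (row_mx (Ap p) p) (0 : R) 1) d1.
  by rewrite add0r scale1r /c subr0 scale1r g0.
have E1 : v *m A 1 = c 1.
  have lift (w : R -> 'rV[R]_(n + n)) :
      (forall t : R, 0 <= t <= 1 -> is_derive t 1 w ('D_(w t) (frame_field X) (y p t))) ->
      solves (tangent_lift (frame_field X)) [set z | frame_dom V (lsubmx z)]
        (fun t => row_mx (y p t) (w t)).
    move=> dw t t01; have [Oy dy] := sy p V1p t t01.
    rewrite /tangent_lift /= row_mxKl row_mxKr; split=> //.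
    by apply: is_derive_row_mx => //; exact: dw.
  have s1 := lift (fun t => v *m A t) (fun t t01 => let: And3 _ _ d := AP t t01 in d v).
  have s2 := lift c dc.
  have := solution_unique (open_lsubmx oF) (smooth_tangent_lift oF sF) s1 s2.
  rewrite c0E => /(_ erefl 1 t1).
  by move=> /eq_row_mx[].
have [dy1 DE _] := AP 1 t1.
apply/rowP => j; rewrite derive_coord; last exact: smooth_diff smoothH V1p.
have -> : (fun q => H q 0 j) = (fun q => y q 1 0 (rshift n j)).
  by apply/funext => q; rewrite row_mxEr.
rewrite -derive_coord // DE -/v E1 /c row_mxEr subrr scale0r.
by [].
Qed.

(** The projected coordinates of [p], and the coordinates of the point where
    the integral manifold through [p] meets the transversal. [Ps] is the
    inverse: it places a point on the transversal and follows the frame. *)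
Let phi p := (p - p0) *m Q *m Pi + (H p - p0) *m Q *m Cp.
Let Ps z := h (z *m Pi) (p0 + z *m Cp *m invmx Q) 1.
Let Z1 : set 'rV[R]_n := [set z | near0 (z *m Pi) /\ nearp (p0 + z *m Cp *m invmx Q)].

Let oZ1 : open Z1.
Proof.
have -> : Z1 = [set z | `|z *m Pi| < rho] `&` [set z | `|z *m (Cp *m invmx Q)| < rho].
  by apply/seteqP; split=> z; rewrite /Z1 /nearp /= addrC addKr mulmxA.
by apply: openI; apply: open_norm_lt; exact: (smooth_linear _ openT).
Qed.

Let smooth_phi : smooth_on V1 phi.
Proof.
apply: smoothD => //.
  apply: (smooth_ext (F := fun p => (p - p0) *m (Q *m Pi)) oV1).
    by move=> p _; rewrite mulmxA.
  apply: (smooth_comp (V := setT) (F := fun p => p *m (Q *m Pi)) openT oV1) => //.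
    exact: (smooth_linear _ openT).
  exact: smooth_idB.
apply: (smooth_ext (F := fun p => (H p - p0) *m (Q *m Cp)) oV1).
  by move=> p _; rewrite mulmxA.
apply: (smooth_comp (V := setT) (F := fun p => p *m (Q *m Cp)) openT oV1) => //.
  exact: (smooth_linear _ openT).
apply: (smooth_comp (V := setT) (F := fun p => p - p0) openT oV1) => //.
exact: (smooth_idB _ openT).
Qed.

Let smooth_Ps : smooth_on Z1 Ps.
Proof.
apply: flow_smooth_init => //.
- exact: (smooth_linear _ oZ1).
- apply: (smooth_ext (F := fun z => z *m (Cp *m invmx Q) + p0) oZ1).
    by move=> z _; rewrite mulmxA addrC.
  by apply: smoothD => //; [exact: smooth_linear|exact: smooth_cst].
- by move=> z [].
- by move=> z [].
Qed.

Let ApPi p : Ap p *m Pi = Ap p.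
Proof. by rewrite /Ap mulNmx -!mulmxA PiPi. Qed.

Let HPi p : V1 p -> (H p - p0) *m Q *m Pi = 0.
Proof.
move=> [na nq]; have := flow_proj na nq t1; rewrite scale1r ApPi -/(H p).
have -> : H p - p0 = (H p - p) + (p - p0) by rewrite addrA subrK.
by rewrite !mulmxDl => ->; rewrite -!mulmxDl /Ap addNr.
Qed.

Let phiPi p : phi p *m Pi = - Ap p.
Proof.
by rewrite /phi mulmxDl -!mulmxA PiPi CpPi !mulmx0 addr0 /Ap opprK !mulmxA.
Qed.

Let PiCp0 : Pi *m Cp = 0. Proof. exact: mul_pid_mx_copid. Qed.

Let phiCp p : V1 p -> p0 + phi p *m Cp *m invmx Q = H p.
Proof.
move=> V1p.
have -> : phi p *m Cp = (H p - p0) *m Q *m Cp.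
  by rewrite /phi mulmxDl -[_ *m Pi *m Cp]mulmxA PiCp0 mulmx0 add0r -[LHS]mulmxA CpCp.
have -> : (H p - p0) *m Q *m Cp = (H p - p0) *m Q.
  by rewrite -[RHS]mulmx1 -PiCp (mulmxDr _ Pi Cp) HPi // add0r.
by rewrite mulmxK // addrC subrK.
Qed.

Let PsK p : V1 p -> Z1 (phi p) -> Ps (phi p) = p.
Proof.
move=> V1p [nz nq]; rewrite /Ps phiCp // phiPi.
apply: flow_back; [exact: V1p.1|exact: V1p.2|].
by move: nq; rewrite phiCp.
Qed.

Let phiK z : Z1 z -> V1 (Ps z) -> phi (Ps z) = z.
Proof.
move=> [nz nq] V1P; set q := p0 + z *m Cp *m invmx Q in nq.
have qP : (q - p0) *m Q = z *m Cp.
  by rewrite /q addrC addKr mulmxKV.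
have e1 : (Ps z - p0) *m Q *m Pi = z *m Pi.
  have -> : Ps z - p0 = (Ps z - q) + (q - p0) by rewrite addrA subrK.
  rewrite (mulmxDl (Ps z - q)) qP (mulmxDl ((Ps z - q) *m Q)).
  rewrite -[z *m Cp *m Pi]mulmxA CpPi mulmx0 addr0.
  by rewrite (flow_proj nz nq t1) scale1r -mulmxA PiPi.
have e2 : H (Ps z) = q.
  rewrite /H /Ap e1; apply: flow_back => //; exact: V1P.2.
by rewrite /phi e1 e2 qP -mulmxA CpCp -(mulmxDr _ Pi Cp) PiCp mulmx1.
Qed.

Let H0 : V1 p0 /\ H p0 = p0.
Proof.
have A0 : Ap p0 = 0 by rewrite /Ap subrr !mul0mx oppr0.
have V10 : V1 p0 by rewrite /V1 /near0 /nearp /= A0 subrr normr0.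
have [n0 nq] := V10.
have [h0 _] := hP n0 nq.
have s1 := flow_solves n0 nq.
have s2 : solves (frame_field X) (frame_dom V) (fun=> row_mx (Ap p0) p0).
  move=> t t01; rewrite /frame_dom /frame_field /= row_mxKl row_mxKr; split=> //.
  by rewrite A0 mul0mx row_mx0; exact: is_derive_cst.
split=> //; rewrite /H; have := solution_unique oF sF s1 s2.
by rewrite h0 => /(_ erefl 1 t1)/eq_row_mx[].
Qed.

Lemma frobenius_chart_of_flow : exists U phi, [/\ U p0, U `<=` V, is_chart U phi &
  forall p i (j : 'I_n), U p -> (l <= j)%N -> 'D_(row i (X p)) phi p 0 j = 0].
Proof.
have [V10 H00] := H0.
have oU : open (V1 `&` phi @^-1` Z1).
  rewrite openE => p [V1p Zp].
  apply: filterI; first exact: open_nbhs_nbhs.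
  have cphi := smooth_continuous smooth_phi V1p.
  by apply: cphi; exact: open_nbhs_nbhs.
have Z10 : Z1 (phi p0).
  rewrite /Z1 /= phiPi phiCp // /near0 /nearp H00 subrr normr0 normrN.
  by have [] := V10.
have imE : phi @` (V1 `&` phi @^-1` Z1) = Z1 `&` Ps @^-1` V1.
  apply/seteqP; split=> [z [p [V1p Zp] <-]|z [Zz V1z]].
    by split=> //=; rewrite PsK.
  exists (Ps z); last exact: phiK.
  by split; [exact: V1z|rewrite /preimage /mkset phiK].
exists (V1 `&` phi @^-1` Z1), phi; split.
- by split.
- by move=> p [/V1V].
- split=> //.
  + by apply: smooth_sub smooth_phi => p [].
  + rewrite imE openE => z [Zz Vz].
    apply: filterI; first exact: open_nbhs_nbhs.
    have cPs := smooth_continuous smooth_Ps Zz.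
    by apply: cPs; exact: open_nbhs_nbhs.
  + exists Ps; first by rewrite imE; apply: smooth_sub smooth_Ps => z [].
    by move=> p [V1p Zp]; exact: PsK.
move=> p i j [V1p Zp] lj.
have dphi : differentiable phi p by exact: smooth_diff smooth_phi V1p.
have dH : differentiable H p by exact: smooth_diff smoothH V1p.
rewrite derive_coord //.
have PiE (B : 'rV[R]_n) : (B *m Pi) 0 j = 0.
  rewrite mxE big1 // => k _; rewrite /Pi mxE.
  by case: eqP => [->|]; rewrite ?ltnNge ?lj /= mulr0.
have CpE (B : 'rV[R]_n) : (B *m Cp) 0 j = B 0 j.
  have := mulmx1 B; rewrite -PiCp (mulmxDr _ Pi Cp) => /matrixP/(_ 0 j).
  by rewrite mxE PiE add0r.
have -> : (fun y => phi y 0 j) = (fun y => \sum_k (H y - p0) 0 k * Q k j).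
  by apply/funext => y; rewrite /phi mxE PiE add0r CpE mxE.
have dk k : differentiable (fun y => (H y - p0) 0 k * Q k j) p.
  apply: differentiableM; last exact: differentiable_cst.
  have : differentiable (fun y => H y - p0) p.
    by apply: differentiableB => //; exact: differentiable_cst.
  by move/differentiable_mxP.
have -> : (fun y => \sum_k (H y - p0) 0 k * Q k j) = \sum_k (fun y => (H y - p0) 0 k * Q k j).
  by apply/funext => y; rewrite fct_sumE.
rewrite derive_sum => [|k]; last exact: diff_derivable.
apply: big1 => k _.
have -> : (fun y => (H y - p0) 0 k * Q k j) =
    Q k j \*: ((fun y => H y 0 k) - cst (p0 0 k)).
  by apply/funext => y; rewrite !mxE mulrC.
have dHk : differentiable (fun y => H y 0 k) p by move/differentiable_mxP : dH.
have dHk' : derivable (fun y => H y 0 k) p (row i (X p)) by exact: diff_derivable.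
have dC : derivable (cst (p0 0 k)) p (row i (X p)) by exact: derivable_cst.
rewrite deriveZ; last exact: derivableB.
rewrite deriveB //.
rewrite derive_cst subr0 -derive_coord // first_integral //.
by rewrite mxE scaler0.
Qed.

End WithFlow.

(** The Frobenius theorem for a commuting frame that is normalised by [Q]; the
    normalisation yields the inverse of the chart in closed form. *)
Theorem frobenius_chart : exists U phi, [/\ U p0, U `<=` V, is_chart U phi &
  forall p i (j : 'I_n), U p -> (l <= j)%N -> 'D_(row i (X p)) phi p 0 j = 0].
Proof.
have [rho [h [rho0 hP]]] := local_flow oV Vp0 sX.
exact: frobenius_chart_of_flow rho0 hP.
Qed.

End FrobeniusChart.

(** * The foliation by level sets of a chart *)

Section FoliationOfChart.
Context {R : realType} {n : nat}.

Lemma eball_center (p : 'rV[R]_n) r : 0 < r -> eball p r p.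
Proof.
move=> r0; rewrite /eball /= big1 ?exprn_gt0 // => i _.
by rewrite subrr expr0n.
Qed.

Lemma open_eball (p : 'rV[R]_n) r : open (eball p r).
Proof.
pose F (x : 'rV[R]_n) := \sum_i (x 0 i - p 0 i) ^+ 2.
have -> : eball p r = F @^-1` [set s | s < r ^+ 2] by [].
apply: open_comp => [x _|]; last exact: open_lt.
have sF : smooth_on setT F.
  apply: smooth_sum => [|i _]; first exact: openT.
  have s1 : smooth_on setT (fun x : 'rV[R]_n => x 0 i + (- p 0 i)).
    by apply: smoothD => //; [exact: openT|exact: smooth_coord|exact: smooth_cst].
  apply: (smooth_ext (F := fun x => (x 0 i - p 0 i) * (x 0 i - p 0 i)) openT).
    by move=> y _; rewrite expr2.
  by apply: smoothM => //; exact: openT.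
exact: smooth_continuous sF I.
Qed.

Lemma eball_norm (p x : 'rV[R]_n) r : 0 < r -> eball p r x -> `|x - p| < r.
Proof.
move=> r0 xr; have [h _] := sqr_norm_rV (x - p).
rewrite -(@ltr_pXn2r _ 2) ?nnegrE // ?(ltW r0) //.
by apply: (le_lt_trans h); under eq_bigr do rewrite !mxE.
Qed.

Lemma open_box_nbhs (O : set 'rV[R]_n) z : open O -> O z ->
  exists B, [/\ open_box B, open B, B z & B `<=` O].
Proof.
move=> oO Oz.
have [e e0 eP] := near_normB (open_nbhs_nbhs (conj oO Oz)).
have e2 : 0 < e / 2 by rewrite divr_gt0.
pose B := [set y : 'rV[R]_n | forall i, z 0 i - e / 2 < y 0 i < z 0 i + e / 2].
exists B; split.
- exists (\row_i (z 0 i - e / 2)), (\row_i (z 0 i + e / 2)).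
  by apply/seteqP; split=> y Hy i; have := Hy i; rewrite !mxE.
- have oi i : open [set y : 'rV[R]_n | z 0 i - e / 2 < y 0 i < z 0 i + e / 2].
    have -> : [set y : 'rV[R]_n | z 0 i - e / 2 < y 0 i < z 0 i + e / 2] =
        (fun y : 'rV[R]_n => y 0 i) @^-1` `]z 0 i - e / 2, z 0 i + e / 2[%classic.
      by apply/seteqP; split=> y; rewrite /= in_itv.
    apply: open_comp => [y _|]; first exact: coord_continuous.
    exact: interval_open.
  rewrite openE => y By.
  exact: (@filter_forall _ _ (fun i => [set y : 'rV[R]_n | z 0 i - e / 2 < y 0 i < z 0 i + e / 2])
    (nbhs y) _ (fun i => open_nbhs_nbhs (conj (oi i) (By i)))).
- by move=> i; lra.
move=> y By; apply: eP; apply: (@le_lt_trans _ _ (e / 2)); last lra.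
apply/norm_rV_le => [|i j]; first exact: ltW.
rewrite ord1 !mxE; have := By j => /andP[? ?].
rewrite ler_norml; apply/andP; split; lra.
Qed.

(** Absorbs the switching times of a piecewise constant control. *)
Lemma constant_off_finite (e : seq R) (F : R -> R) (a b : R) : a <= b ->
  {within `[a, b], continuous F} ->
  (forall s, a < s < b -> s \notin e -> is_derive s 1 F 0) -> F a = F b.
Proof.
elim: e a b => [|c e IH] a b ab cF dF.
  have [->//|aneb] := eqVneq a b.
  have altb : a < b by rewrite lt_neqAle aneb.
  have [x||c _] := @MVT R F (cst 0) a b altb.
  - by rewrite in_itv /= => xab; exact: dF.
  - exact: cF.
  by rewrite mul0r => /subr0_eq.
have [/andP[ac cb]|ncab] := boolP (a < c < b); last first.
  apply: IH => // s sab se; apply: dF => //; rewrite inE negb_or se andbT.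
  by apply: contra ncab => /eqP <-.
have sub u v : a <= u -> v <= b -> {within `[u, v], continuous F}.
  move=> au vb; apply: continuous_subspaceW cF => s /=; rewrite !in_itv /= => /andP[? ?].
  by apply/andP; split; [exact: le_trans au _|exact: le_trans vb].
transitivity (F c).
  apply: IH; [exact: ltW|apply: sub => //; exact: ltW|].
  move=> s /andP[a_s sc] se; apply: dF; first by rewrite a_s (lt_trans sc).
  by rewrite inE negb_or se andbT lt_eqF.
apply: IH; [exact: ltW|apply: sub => //; exact: ltW|].
move=> s /andP[cs sb] se; apply: dF; first by rewrite sb (lt_trans ac).
by rewrite inE negb_or se andbT gt_eqF.
Qed.

Variables (m l : nat) (p0 : 'rV[R]_n) (r : R).
Variables (f : 'rV[R]_n -> 'rV[R]_n) (g : 'I_m -> 'rV[R]_n -> 'rV[R]_n).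
Variables (U : set 'rV[R]_n) (phi : 'rV[R]_n -> 'rV[R]_n).
Hypotheses (r0 : 0 < r) (Up0 : U p0) (chU : is_chart U phi).
Hypothesis tgt : forall p (u : 'I_m -> R) (j : 'I_n), U p -> (l <= j)%N ->
  'D_(f p + \sum_j u j *: g j p) phi p 0 j = 0.

Section Leaves.
Variable M : set 'rV[R]_n.
Hypotheses (oM : open M) (MU : M `<=` U).

Definition level (x : 'rV[R]_n) : set 'rV[R]_n :=
  [set p | M p /\ forall i : 'I_n, (l <= i)%N -> phi p 0 i = phi x 0 i].

(** Components, because a level set of the chart inside a ball can be
    disconnected. *)
Definition leaf x := connected_component (level x) x.

Definition leaves : set (set 'rV[R]_n) := [set L | exists2 x, M x & L = leaf x].

Lemma level_eq x y : level x y -> level x = level y.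
Proof.
move=> [_ xy]; apply/seteqP; split=> p [Mp Hp]; split=> // i li.
  by rewrite Hp // xy.
by rewrite Hp // xy.
Qed.

Lemma leaf_level x : leaf x `<=` level x.
Proof. exact: connected_component_sub. Qed.

Lemma leaf_refl x : M x -> leaf x x.
Proof. by move=> Mx; apply: connected_component_refl. Qed.

Lemma leaf_eq x y : leaf x y -> leaf x = leaf y.
Proof.
move=> xy; rewrite /leaf (same_connected_component xy).
by rewrite (level_eq (leaf_level xy)).
Qed.

Lemma leaf_connected_sub x A : connected A -> A `<=` level x ->
  (exists2 p, A p & leaf x p) -> A `<=` leaf x.
Proof.
move=> cA Ax [p Ap xp] q Aq.
apply: (connected_component_trans xp).
by exists A.
Qed.

(** Every point has a chart domain [W] inside [M] with image a box. A segment
    in a slice of the box lifts to a connected part of a level set, so a leaf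
    contains each plaque of [W] that it meets. *)
Lemma small_box x : M x -> exists W, [/\ W x, W `<=` M, is_chart W phi,
  open_box (phi @` W) & forall L p q, leaves L -> L p -> W p -> W q ->
     (forall i : 'I_n, (l <= i)%N -> phi q 0 i = phi p 0 i) -> L q].
Proof.
move=> Mx; have [oU sphi oI [psi spsi psiK]] := chU.
have Ux := MU Mx.
have cpsi z : (phi @` U) z -> {for z, continuous psi}.
  by move=> Iz; exact: smooth_continuous spsi Iz.
have cphi p : U p -> {for p, continuous phi}.
  by move=> Up; exact: smooth_continuous sphi Up.
have oO : open ((phi @` U) `&` psi @^-1` M).
  rewrite openE => z [Iz Mz]; apply: filterI; first exact: open_nbhs_nbhs.
  by apply: (cpsi z Iz); exact: open_nbhs_nbhs.
have Oz : ((phi @` U) `&` psi @^-1` M) (phi x).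
  by split; [exists x|rewrite /preimage /mkset psiK].
have [B [bB oB Bx BO]] := open_box_nbhs oO Oz.
pose W := U `&` phi @^-1` B.
have imW : phi @` W = B.
  apply/seteqP; split=> [z [p [_ Bp] <-//]|z Bz].
  have [[p Up pz] _] := BO z Bz.
  by exists p => //; split=> //; rewrite /preimage /mkset pz.
have WM : W `<=` M.
  by move=> p [Up Bp]; have [_] := BO _ Bp; rewrite /preimage /mkset psiK.
exists W; split=> //.
- split.
  + rewrite openE => p [Up Bp]; apply: filterI; first exact: open_nbhs_nbhs.
    by apply: (cphi p Up); exact: open_nbhs_nbhs.
  + by apply: smooth_sub sphi => p [].
  + by rewrite imW.
  exists psi; last by move=> p [Up _]; exact: psiK.
  by rewrite imW; apply: smooth_sub spsi => z /BO[].
- by rewrite imW.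
move=> L p q [x0 Mx0 ->] Lp Wp Wq pq.
(* the segment from phi p to phi q stays in the slice *)
pose c (s : R) := phi p + s *: (phi q - phi p).
have cB s : 0 <= s <= 1 -> B (c s).
  move=> /andP[s0 s1]; case: bB Wp.2 Wq.2 => a [b ->] /= Hp Hq i.
  have /andP[p1 p2] := Hp i; have /andP[q1 q2] := Hq i.
  rewrite !mxE; have [s_lt1|s_ge1] := ltP s 1.
    have s1' : 0 < 1 - s by rewrite subr_gt0.
    have := mulr_gt0 s1' (_ : 0 < phi p 0 i - a 0 i); rewrite subr_gt0 => /(_ p1) h1.
    have := mulr_gt0 s1' (_ : 0 < b 0 i - phi p 0 i); rewrite subr_gt0 => /(_ p2) h2.
    have := mulr_ge0 s0 (_ : 0 <= phi q 0 i - a 0 i); rewrite subr_ge0 => /(_ (ltW q1)) h3.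
    have := mulr_ge0 s0 (_ : 0 <= b 0 i - phi q 0 i); rewrite subr_ge0 => /(_ (ltW q2)) h4.
    by apply/andP; split; lra.
  have -> : s = 1 by lra.
  by rewrite mul1r addrC subrK q1 q2.
have cc : continuous c.
  move=> s; apply: differentiable_continuous.
  have -> : c = cst (phi p) + (fun s => s *: (phi q - phi p)) by [].
  by apply: differentiableD; [exact: differentiable_cst|exact: differentiableZl].
pose A := (psi \o c) @` `[0, 1]%classic.
have cA : connected A.
  apply: connected_continuous_connected; first exact: segment_connected.
  apply: continuous_in_subspaceT => s; rewrite inE /= in_itv /= => s01.
  apply: continuous_comp; first exact: cc.
  by apply: cpsi; have [] := BO _ (cB s s01).
apply: (leaf_connected_sub cA).
- move=> q' [s /=]; rewrite in_itv /= => s01 <-.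
  have [[w Uw wE] Mw] := BO _ (cB s s01).
  have -> : psi (c s) = w by rewrite -wE psiK.
  split; first by move: Mw; rewrite /preimage /mkset -wE psiK.
  move=> i li; rewrite wE !mxE pq // subrr mulr0 addr0.
  by have [_ /(_ i li)] := leaf_level Lp.
- exists p => //; exists 0; first by rewrite /= in_itv /= lexx ler01.
  by rewrite /= /c scale0r addr0 psiK //; exact: Wp.1.
exists 1; first by rewrite /= in_itv /= lexx ler01.
by rewrite /= /c scale1r addrC subrK psiK //; exact: Wq.1.
Qed.

Lemma leaves_foliation : is_foliation M l leaves.
Proof.
split.
- move=> L [x Mx ->]; split; [by exists x; exact: leaf_refl|exact: component_connected|].
  split=> [p /leaf_level[]//|p xp].
  have Mp : M p by have [] := leaf_level xp.
  have [W [Wp WM chW bW WL]] := small_box Mp.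
  exists W, phi, (phi p); split=> //.
  apply/seteqP; split=> [q [xq Wq]|q [Wq qp]].
    split=> // i li; have [_ ->//] := leaf_level xq.
    by have [_ ->] := leaf_level xp.
  split=> //; apply: (WL (leaf x) p q) => //; by exists x.
- move=> L1 L2 [x Mx ->] [y My ->] [p [xp yp]].
  by rewrite (leaf_eq xp) (leaf_eq yp).
- apply/seteqP; split=> [p [L [x Mx ->]] /leaf_level[]//|p Mp].
  by exists (leaf p); [exists p|exact: leaf_refl].
move=> x Mx; have [W [Wx WM chW bW WL]] := small_box Mx.
exists W, phi; split=> //; split=> // L LL.
exists (phi @` (L `&` W)); apply/seteqP; split=> [p [Lp Wp]|p].
  by exists (phi p); [exists p|].
move=> [c [q [Lq Wq] <-] [Wp pq]]; split=> //.
exact: WL LL Lq Wq Wp pq.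
Qed.

(** The velocity is tangent to the level sets at all but finitely many times,
    so a trajectory is a connected subset of one level set. *)
Lemma leaves_invariant N : leaves N -> invariant_under_controls M f g N.
Proof.
move=> [x Mx ->] x0 u t q xx0 _ t0 [y [cy y0 yt yM [e ye]]].
have phi_cst s : 0 <= s <= t -> forall i : 'I_n, (l <= i)%N -> phi (y s) 0 i = phi (y 0) 0 i.
  move=> /andP[s0 st] i li; apply/esym.
  have [_ sphi _ _] := chU.
  apply: (constant_off_finite (e := e) (F := fun s => phi (y s) 0 i)) => //.
    apply/subspace_continuousP => w /= w0s.
    have w0t : 0 <= w <= t by move: w0s; rewrite in_itv /= => /andP[-> /le_trans]; exact.
    have cyw : y z @[z --> within `[0, s]%classic (nbhs w)] --> y w.
      have /subspace_continuousP := cy => /(_ w); rewrite /= in_itv /= => /(_ w0t).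
      apply: cvg_trans; apply: cvg_app; apply: within_subset => z /=.
      by rewrite !in_itv /= => /andP[-> /le_trans]; exact.
    apply: (@cvg_comp _ _ _ y (fun p => phi p 0 i) _ _ _ cyw).
    have /differentiable_mxP/(_ 0 i) := smooth_diff sphi (MU (yM w w0t)).
    exact: differentiable_continuous.
  move=> w /andP[w0 ws] we.
  have w0t : 0 < w < t by rewrite w0 (lt_le_trans ws).
  have w0t' : 0 <= w <= t by case/andP: w0t => ? ?; rewrite !ltW.
  have dy := ye w w0t we.
  have dphi := smooth_diff sphi (MU (yM w w0t')).
  have /is_derive_rVP/(_ i) := is_derive_comp_vec dy dphi.
  by rewrite (tgt (u w 0) (MU (yM w w0t')) li).
pose A := y @` `[0, t]%classic.
have cA : connected A.
  by apply: connected_continuous_connected; [exact: segment_connected|].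
apply: (leaf_connected_sub (A := A)) => //.
- move=> q' [s /=]; rewrite in_itv /= => s0t <-; split; first exact: yM.
  by move=> i li; rewrite phi_cst // y0; have [_ ->] := leaf_level xx0.
- by exists (y 0); [exists 0; rewrite //= in_itv /= lexx|rewrite y0].
by exists t; rewrite //= in_itv /= t0 lexx.
Qed.

End Leaves.

Theorem foliation_of_chart : exists r' : R, 0 < r' <= r /\
  exists F : set (set 'rV[R]_n), is_foliation (eball p0 r') l F /\
     forall N, F N -> invariant_under_controls (eball p0 r') f g N.
Proof.
have [oU _ _ _] := chU.
have [e e0 eP] := near_normB (open_nbhs_nbhs (conj oU Up0)).
pose r' := Num.min r e.
have r'0 : 0 < r' by rewrite lt_min r0.
exists r'; split; first by rewrite r'0 ge_min lexx.
have MU : eball p0 r' `<=` U.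
  move=> x /(eball_norm r'0) xr; apply: eP; apply: (lt_le_trans xr).
  by rewrite ge_min lexx orbT.
exists (leaves (eball p0 r')); split; first exact: leaves_foliation (@open_eball _ _) MU.
by move=> N; exact: leaves_invariant.
Qed.

End FoliationOfChart.

(** * Rank, spans and moving frames *)

Section Rank.
Context {F : fieldType}.

Lemma minor_rank {N n k} (A : 'M[F]_(N, n)) (f : 'I_k -> 'I_N) (h : 'I_k -> 'I_n) :
  \det (mxsub f h A) != 0 -> (k <= \rank A)%N.
Proof.
move=> d; have /mxrank_unit <- : mxsub f h A \in unitmx by rewrite unitmxE unitfE.
have -> : mxsub f h A = rowsub f 1%:M *m A *m colsub h 1%:M.
  rewrite -rowsubE; apply/matrixP => i j; rewrite !mxE (bigD1 (h j)) //=.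
  rewrite !mxE eqxx mulr1 big1 ?addr0 // => a /negPf ah.
  by rewrite !mxE ah mulr0.
exact: leq_trans (mxrankM_maxl _ _) (mxrankM_maxr _ _).
Qed.

Lemma rank_free_rows {N n k} (A : 'M[F]_(N, n)) : (k <= \rank A)%N ->
  exists f : 'I_k -> 'I_N, row_free (rowsub f A).
Proof.
move=> kA; pose Z := rowsub (maxrankfun A) A.
exists (maxrankfun A \o widen_ord kA).
have -> : rowsub (maxrankfun A \o widen_ord kA) A = rowsub (widen_ord kA) Z.
  by apply/matrixP => i j; rewrite !mxE.
rewrite rowsubE -pid_mxErow /row_free mxrankMfree ?maxrowsub_free //.
by rewrite rank_pid_mx.
Qed.

Lemma rank_minor {N n k} (A : 'M[F]_(N, n)) : (k <= \rank A)%N ->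
  exists (f : 'I_k -> 'I_N) (h : 'I_k -> 'I_n), \det (mxsub f h A) != 0.
Proof.
move=> /rank_free_rows[f fA]; exists f.
have fT : row_full (rowsub f A)^T by rewrite /row_full mxrank_tr; exact: fA.
exists (fullrankfun fT).
have := fullrowsub_unit fT; rewrite unitmxE unitfE.
suff -> : rowsub (fullrankfun fT) (rowsub f A)^T = (mxsub f (fullrankfun fT) A)^T.
  by rewrite det_tr.
by apply/matrixP => i j; rewrite !mxE.
Qed.

(** The rank condition as polynomial equations and inequations in the entries. *)
Lemma rank_minorsP {N n} (A : 'M[F]_(N, n)) k :
  \rank A = k <->
  (forall (f : {ffun 'I_k.+1 -> 'I_N}) (h : {ffun 'I_k.+1 -> 'I_n}), \det (mxsub f h A) = 0) /\
  (exists (f : {ffun 'I_k -> 'I_N}) (h : {ffun 'I_k -> 'I_n}), \det (mxsub f h A) != 0).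
Proof.
split=> [rA|[mA [f [h fh]]]].
  split=> [f h|].
    by apply/eqP/negP => /negP/minor_rank; rewrite rA ltnn.
  have [|f [h fh]] := @rank_minor N n k A; first by rewrite rA.
  exists (finfun f), (finfun h).
  suff -> : mxsub (finfun f) (finfun h) A = mxsub f h A by [].
  by apply/matrixP => i j; rewrite !mxE !ffunE.
apply/eqP; rewrite eqn_leq (minor_rank fh) andbT leqNgt; apply/negP.
move=> /rank_minor[f' [h' /eqP]]; apply.
rewrite -[RHS](mA (finfun f') (finfun h')); congr (\det _).
by apply/matrixP => i j; rewrite !mxE !ffunE.
Qed.

(** A linear change of coordinates in which the first [k] columns carry the
    rank; it replaces a selection of pivot columns. *)
Lemma row_free_complement {n k} (B : 'M[F]_(k, n)) : row_free B ->
  exists Q, Q \in unitmx /\ B *m Q *m (pid_mx k : 'M[F]_(n, k)) \in unitmx.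
Proof.
move=> fB; exists (invmx (row_ebase B)).
rewrite unitmx_inv row_ebase_unit; split=> //.
have kn : (k <= n)%N by rewrite -(eqP fB) rank_leq_col.
rewrite -{1}[B]mulmx_ebase mulmxK ?row_ebase_unit // (eqP fB) -mulmxA pid_mx_id //.
by rewrite pid_mx_1 mulmx1 col_ebase_unit.
Qed.

End Rank.

Section Spans.
Context {R : realType} {n : nat}.

Lemma lin_span_rows (S : set 'rV[R]_n) {N} (A : 'M[R]_(N, n)) :
  (forall v, S v -> (v <= A)%MS) -> (forall a, S (row a A)) ->
  lin_span S = [set v | (v <= A)%MS].
Proof.
move=> SA AS; apply/seteqP; split=> v.
  move=> [s sS]; rewrite -[s]/(tval (in_tuple s)) => /coord_span ->.
  apply: summx_sub => i _; apply: scalemx_sub; apply: SA; apply: sS.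
  by rewrite mem_nth.
move=> /submxP[c ->]; exists [seq row a A | a <- enum 'I_N].
  by move=> w /mapP[a _ ->].
rewrite mulmx_sum_row; apply: memv_suml => a _; apply: memvZ.
by apply: memv_span; apply: map_f; rewrite mem_enum.
Qed.

(** Translates between subspaces as fibres of a distribution and row spaces,
    on which rank computations take place. *)
Lemma vspace_rows {N} (A : 'M[R]_(N, n)) : exists2 V : {vspace 'rV[R]_n},
  \dim V = \rank A & forall v, (v \in V) = (v <= A)%MS.
Proof.
pose B := row_base A; pose X := [tuple row a B | a < \rank A].
have XE (a : 'I_(\rank A)) : X`_a = row a B by rewrite -tnth_nth tnth_mktuple.
have fX : free X.
  apply/freeP => k; under eq_bigr do rewrite XE.
  move=> k0 i; have : (\row_a k a) *m B = 0.
    by rewrite mulmx_sum_row -[RHS]k0; apply: eq_bigr => a _; rewrite mxE.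
  rewrite -(mul0mx _ B) => /(row_free_inj (row_base_free A)) /rowP/(_ i).
  by rewrite !mxE.
exists <<X>>%VS; first by rewrite (eqP fX) size_tuple.
move=> v; have <- : (v <= B)%MS = (v <= A)%MS by rewrite /B eq_row_base.
apply/idP/idP.
  move=> /coord_span ->; apply: summx_sub => i _; apply: scalemx_sub.
  by rewrite XE; exact: row_sub.
move=> /submxP[c ->]; rewrite mulmx_sum_row; apply: memv_suml => a _; apply: memvZ.
by rewrite -XE; apply: memv_span; rewrite mem_nth // size_tuple.
Qed.

Lemma constant_rank_rows Om (D : tangent_family) {N} (A : 'rV[R]_n -> 'M[R]_(N, n)) k :
  (forall x, Om x -> D x = [set v | (v <= A x)%MS]) ->
  constant_rank Om D k <-> forall x, Om x -> \rank (A x) = k.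
Proof.
move=> DA; split=> H x Ox.
  have [V <- DV] := H x Ox; have [V' <- V'A] := vspace_rows (A x).
  congr (\dim _); apply/vspaceP => v; rewrite V'A.
  have : D x v <-> D x v by [].
  rewrite {1}DV DA //= => -[h1 h2]; apply/idP/idP => h; [exact: h2|exact: h1].
have [V dV VA] := vspace_rows (A x); exists V; first by rewrite dV H.
by rewrite DA //; apply/seteqP; split=> v /=; rewrite VA.
Qed.

End Spans.

Section SmoothMatrices.
Context {R : realType} {n : nat}.
Variable (U : set 'rV[R]_n).
Hypothesis oU : open U.

Definition smooth_mx {p q} (A : 'rV[R]_n -> 'M[R]_(p, q)) :=
  forall i j, smooth_on U (fun x => A x i j).

Lemma smooth_mxM {p q s} (A : _ -> 'M[R]_(p, q)) (B : _ -> 'M[R]_(q, s)) :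
  smooth_mx A -> smooth_mx B -> smooth_mx (fun x => A x *m B x).
Proof.
move=> sA sB i j.
apply: (smooth_ext (F := fun x => \sum_k A x i k * B x k j) oU).
  by move=> x _; rewrite mxE.
by apply: smooth_sum => // k _; exact: smoothM.
Qed.

Lemma smooth_mx_cst {p q} (B : 'M[R]_(p, q)) : smooth_mx (fun=> B).
Proof. by move=> i j; exact: smooth_cst. Qed.

Lemma smooth_det {p} (A : _ -> 'M[R]_p) : smooth_mx A ->
  smooth_on U (fun x => \det (A x)).
Proof.
move=> sA; apply: smooth_sum => // s _; apply: smoothM => //.
  exact: smooth_cst.
by apply: smooth_prod => // i _; exact: sA.
Qed.

Lemma smooth_invmx {p} (A : _ -> 'M[R]_p) : smooth_mx A ->
  (forall x, U x -> A x \in unitmx) -> smooth_mx (fun x => invmx (A x)).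
Proof.
move=> sA uA i j.
apply: (smooth_ext (F := fun x => (\det (A x))^-1 * cofactor (A x) j i) oU).
  by move=> x Ux; rewrite /invmx uA // !mxE.
apply: smoothM => //.
  apply: smoothV => //; last exact: smooth_det.
  by move=> x Ux; rewrite -unitfE -unitmxE uA.
apply: smoothM => //; first exact: smooth_cst.
apply: smooth_det => a b.
apply: (smooth_ext (F := fun x => A x (lift j a) (lift i b)) oU); last exact: sA.
by move=> x _; rewrite !mxE.
Qed.

End SmoothMatrices.

Section Combinations.
Context {R : realType} {n : nat}.
Implicit Types (Om : set 'rV[R]_n).

Lemma unit_nbhs Om {k} (A : 'rV[R]_n -> 'M[R]_k) x : open Om -> smooth_mx Om A -> Om x ->
  A x \in unitmx -> exists U, [/\ open U, U x, U `<=` Om & forall y, U y -> A y \in unitmx].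
Proof.
move=> oO sA Ox uA; have sd := smooth_det oO sA.
exists (Om `&` [set y | \det (A y) != 0]); split.
- rewrite openE => y [Oy /= dy]; apply: filterI; first exact: open_nbhs_nbhs.
  have cd := smooth_continuous sd Oy.
  by have /cvgr_neq0 := cd; exact.
- by split=> //=; rewrite -unitfE -unitmxE.
- by move=> y [].
by move=> y [_ /=]; rewrite unitmxE unitfE.
Qed.

Lemma smooth_mx_sub Om U {p q} (A : 'rV[R]_n -> 'M[R]_(p, q)) :
  U `<=` Om -> smooth_mx Om A -> smooth_mx U A.
Proof. by move=> UO sA i j; exact: smooth_sub (sA i j). Qed.

Lemma smooth_rowsub Om {N k p} (A : 'rV[R]_n -> 'M[R]_(N, p)) (s : 'I_k -> 'I_N) : open Om ->
  smooth_mx Om A -> smooth_mx Om (fun x => rowsub s (A x)).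
Proof.
move=> oO sA i j; apply: (smooth_ext (F := fun x => A x (s i) j) oO); last exact: sA.
by move=> x _; rewrite mxE.
Qed.

(** Where the rank is constant, [k] rows that are independent at [x] stay a
    basis of the row space near [x]. Coordinates in this basis are found by
    inverting a square block, hence are smooth. *)
Lemma local_frame Om {N k} (A : 'rV[R]_n -> 'M[R]_(N, n)) x :
  open Om -> smooth_mx Om A -> (forall y, Om y -> \rank (A y) = k) -> Om x ->
  exists U (s : 'I_k -> 'I_N) (Q : 'M[R]_n),
  let W := Q *m (pid_mx k : 'M[R]_(n, k)) in
  [/\ open U, U x, U `<=` Om, Q \in unitmx &
    forall y, U y -> rowsub s (A y) *m W \in unitmx /\
     forall v : 'rV[R]_n, (v <= A y)%MS ->
       v = v *m W *m invmx (rowsub s (A y) *m W) *m rowsub s (A y)].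
Proof.
move=> oO sA rA Ox.
have [|s fs] := @rank_free_rows _ _ _ k (A x); first by rewrite rA.
have [Q [uQ uB]] := row_free_complement fs.
pose W := Q *m (pid_mx k : 'M[R]_(n, k)).
have sB : smooth_mx Om (fun y => rowsub s (A y) *m W).
  by apply: smooth_mxM => //; [exact: smooth_rowsub|exact: smooth_mx_cst].
have [|U [oU Ux UO uU]] := unit_nbhs oO sB Ox; first by rewrite mulmxA.
exists U, s, Q; split=> // y Uy; have uy := uU y Uy; split=> //.
move=> v vA; have : (v <= rowsub s (A y))%MS.
  apply: (submx_trans vA).
  rewrite -(geq_leqif (mxrank_leqif_sup (rowsub_sub s (A y)))) (rA _ (UO _ Uy)).
  by rewrite -{1}(mxrank_unit uy) mxrankM_maxl.
move=> /submxP[c ->].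
rewrite -/W; move: uy; set B := rowsub s (A y) => uy.
by rewrite -(mulmxA c B W) -(mulmxA c (B *m W)) mulmxV // mulmx1.
Qed.

Lemma local_coefficients Om {N k} (A : 'rV[R]_n -> 'M[R]_(N, n)) (X : 'rV[R]_n -> 'rV[R]_n) x :
  open Om -> smooth_mx Om A -> (forall y, Om y -> \rank (A y) = k) ->
  smooth_on Om X -> (forall y, Om y -> (X y <= A y)%MS) -> Om x ->
  exists c : 'rV[R]_n -> 'rV[R]_N, differentiable c x /\ \near x, X x = c x *m A x.
Proof.
move=> oO sA rA sX XA Ox.
have [U [s [Q [oU Ux UO uQ UP]]]] := local_frame oO sA rA Ox.
pose W := Q *m (pid_mx k : 'M[R]_(n, k)).
have sAU : smooth_mx U A by exact: smooth_mx_sub sA.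
have sXU : smooth_mx U X.
  by move=> i j; rewrite ord1; have /(smooth_rVP _ oU) := smooth_sub UO sX.
pose c y := X y *m W *m invmx (rowsub s (A y) *m W) *m rowsub s (1%:M : 'M[R]_N).
have sc : smooth_mx U c.
  have sAW : smooth_mx U (fun y => rowsub s (A y) *m W).
    by apply: smooth_mxM => //; [exact: smooth_rowsub|exact: smooth_mx_cst].
  apply: smooth_mxM => //; last exact: smooth_mx_cst.
  apply: smooth_mxM => //; last by apply: smooth_invmx => // y /UP[].
  by apply: smooth_mxM => //; exact: smooth_mx_cst.
exists c; split.
  apply/differentiable_mxP => i j; exact: smooth_diff (sc i j) Ux.
apply: (open_near oU Ux) => y Uy.
by rewrite /c -mulmxA -rowsubE; apply: (UP y Uy).2; apply: XA; exact: UO.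
Qed.

(** By the Leibniz rule, differentiating the coefficients contributes only
    combinations of the rows of [A] to the bracket. *)
Lemma lie_bracket_combination {N K} (A : 'rV[R]_n -> 'M[R]_(N, n))
    (X Y : 'rV[R]_n -> 'rV[R]_n) (c d : 'rV[R]_n -> 'rV[R]_N) x (S : 'M[R]_(K, n)) :
  (forall a, differentiable (fun y => row a (A y)) x) ->
  differentiable c x -> differentiable d x ->
  (\near x, X x = c x *m A x) -> (\near x, Y x = d x *m A x) ->
  (A x <= S)%MS ->
  (forall a b, (lie_bracket (fun y => row a (A y)) (fun y => row b (A y)) x <= S)%MS) ->
  (lie_bracket X Y x <= S)%MS.
Proof.
move=> dA.
have half X' Y' (c' d' : 'rV[R]_n -> 'rV[R]_N) : differentiable c' x -> differentiable d' x ->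
    (\near x, X' x = c' x *m A x) -> (\near x, Y' x = d' x *m A x) ->
    exists w : 'rV[R]_N, 'D_(X' x) Y' x = w *m A x +
      \sum_a \sum_b (c' x 0 a * d' x 0 b) *: 'D_(row a (A x)) (fun y => row b (A y)) x.
  move=> dc dd Xc Yd.
  have Xx := nbhs_singleton Xc.
  have dd' b : differentiable (fun y => d' y 0 b) x by move/differentiable_mxP : dd.
  pose v := X' x.
  exists (\row_b 'D_v (fun y => d' y 0 b) x).
  have -> : 'D_v Y' x = 'D_v (\sum_b (fun y => d' y 0 b *: row b (A y))) x.
    apply: near_eq_derive; apply: filterS Yd => y ->.
    by rewrite mulmx_sum_row fct_sumE.
  have dt b : is_derive x v (fun y => d' y 0 b *: row b (A y))
     ('D_v (fun y => d' y 0 b) x *: row b (A x) + d' x 0 b *: 'D_v (fun y => row b (A y)) x).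
    have Ed : differentiable (fun y => row b (A y)) x by exact: dA.
    have /is_derive_rVP Ed' : is_derive x v (fun y => row b (A y)) ('D_v (fun y => row b (A y)) x).
      by apply/derivableP/diff_derivable.
    have dd'' : is_derive x v (fun y => d' y 0 b) ('D_v (fun y => d' y 0 b) x).
      by apply/derivableP/diff_derivable.
    apply/is_derive_rVP => k.
    have -> : (fun y => (d' y 0 b *: row b (A y)) 0 k) =
        (fun y => d' y 0 b) * (fun y => row b (A y) 0 k).
      by apply/funext => y; rewrite [LHS]mxE.
    apply: (is_derive_eq (is_deriveM dd'' (Ed' k))).
    by rewrite [RHS]mxE [X in _ = X + _]mxE [X in _ = _ + X]mxE /GRing.scale /=; ring.
  rewrite derive_sum => [|b]; last by have [] := dt b.
  rewrite mulmx_sum_row exchange_big /= -big_split /=; apply: eq_bigr => b _.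
  have [_ ->] := dt b; rewrite mxE; congr (_ + _).
  rewrite /v Xx mulmx_sum_row deriveE // linear_sum scaler_sumr.
  apply: eq_bigr => a _; rewrite linearZ /= scalerA mulrC -deriveE //.
move=> dc dd Xc Yd AS brS.
have [w1 e1] := half _ _ _ _ dc dd Xc Yd.
have [w2 e2] := half _ _ _ _ dd dc Yd Xc.
rewrite /lie_bracket e1 e2 opprD addrACA [X in _ + X](_ : _ = \sum_a \sum_b
  (c x 0 a * d x 0 b) *: lie_bracket (fun y => row a (A y)) (fun y => row b (A y)) x).
  rewrite -mulmxBl; apply: addmx_sub; first by apply: (submx_trans _ AS); exact: submxMl.
  by do 2 (apply: summx_sub => ? _); apply: scalemx_sub.
rewrite [X in _ - X]exchange_big /= -sumrB; apply: eq_bigr => a _.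
rewrite -sumrB; apply: eq_bigr => b _.
by rewrite (mulrC (d x 0 b)) -scalerBr.
Qed.

End Combinations.

(** * Differential polynomials and iterated brackets *)

Section DiffPoly.
Context {R : realType} {n m : nat}.
Local Notation dpoly := (diff_poly R n m).

Fixpoint dp_deriv (j : 'I_n) (P : dpoly) : dpoly :=
  match P with
  | DConst _ => DConst 0
  | DPartial k i s => DPartial k i (j :: s)
  | DAdd P1 P2 => DAdd (dp_deriv j P1) (dp_deriv j P2)
  | DMul P1 P2 => DAdd (DMul (dp_deriv j P1) P2) (DMul P1 (dp_deriv j P2))
  end.

Definition dp_sum (s : seq dpoly) : dpoly := foldr DAdd (DConst 0) s.
Definition dp_prod (s : seq dpoly) : dpoly := foldr DMul (DConst 1) s.

Definition dp_det k (M : 'I_k -> 'I_k -> dpoly) : dpoly :=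
  dp_sum [seq DMul (DConst ((-1) ^+ s)) (dp_prod [seq M i (s i) | i <- enum 'I_k])
         | s : {perm 'I_k} <- enum {perm 'I_k}].

(** Brackets are taken formally, so that the order of their components as
    differential polynomials in the fields can be read off. *)
Definition dp_bracket (X Y : 'I_n -> dpoly) (i : 'I_n) : dpoly :=
  dp_sum [seq DAdd (DMul (X j) (dp_deriv j (Y i)))
                   (DMul (DConst (-1)) (DMul (Y j) (dp_deriv j (X i)))) | j <- enum 'I_n].

Lemma dp_order_deriv j P : (dp_order (dp_deriv j P) <= (dp_order P).+1)%N.
Proof.
elim: P => //= P1 IH1 P2 IH2; rewrite !geq_max.
  by rewrite (leq_trans IH1) ?(leq_trans IH2) // ltnS ?leq_maxl ?leq_maxr.
have h1 : (dp_order P1 <= (maxn (dp_order P1) (dp_order P2)).+1)%N.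
  by rewrite ltnW // ltnS leq_maxl.
have h2 : (dp_order P2 <= (maxn (dp_order P1) (dp_order P2)).+1)%N.
  by rewrite ltnW // ltnS leq_maxr.
by rewrite h1 h2 (leq_trans IH1) ?ltnS ?leq_maxl // (leq_trans IH2) // ltnS leq_maxr.
Qed.

Lemma dp_order_sum k (s : seq dpoly) : all (fun P => dp_order P <= k)%N s ->
  (dp_order (dp_sum s) <= k)%N.
Proof. by elim: s => //= P s IH /andP[Pk /IH]; rewrite geq_max Pk. Qed.

Lemma dp_order_prod k (s : seq dpoly) : all (fun P => dp_order P <= k)%N s ->
  (dp_order (dp_prod s) <= k)%N.
Proof. by elim: s => //= P s IH /andP[Pk /IH]; rewrite geq_max Pk. Qed.

Lemma dp_order_det k (M : 'I_k -> 'I_k -> dpoly) K :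
  (forall i j, dp_order (M i j) <= K)%N -> (dp_order (dp_det M) <= K)%N.
Proof.
move=> MK; apply: dp_order_sum; rewrite all_map; apply/allP => s _ /=.
rewrite max0n; apply: dp_order_prod; rewrite all_map; apply/allP => i _ /=.
exact: MK.
Qed.

Lemma dp_order_bracket X Y K : (forall i, dp_order (X i) <= K)%N ->
  (forall i, dp_order (Y i) <= K)%N -> forall i, (dp_order (dp_bracket X Y i) <= K.+1)%N.
Proof.
move=> XK YK i; apply: dp_order_sum; rewrite all_map; apply/allP => j _ /=.
rewrite !geq_max /= !(leq_trans (dp_order_deriv _ _)) ?ltnS ?XK ?YK //=.
by rewrite !(leq_trans _ (leqnSn K)).
Qed.

Section Eval.
Variables (f : 'rV[R]_n -> 'rV[R]_n) (g : 'I_m -> 'rV[R]_n -> 'rV[R]_n).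

Lemma dp_eval_sum (s : seq dpoly) x : dp_eval f g (dp_sum s) x = \sum_(P <- s) dp_eval f g P x.
Proof. by elim: s => [|P s IH] /=; rewrite ?big_nil // big_cons IH. Qed.

Lemma dp_eval_prod (s : seq dpoly) x : dp_eval f g (dp_prod s) x = \prod_(P <- s) dp_eval f g P x.
Proof. by elim: s => [|P s IH] /=; rewrite ?big_nil // big_cons IH. Qed.

Lemma dp_eval_det k (M : 'I_k -> 'I_k -> dpoly) x :
  dp_eval f g (dp_det M) x = \det (\matrix_(i, j) dp_eval f g (M i j) x).
Proof.
rewrite dp_eval_sum big_map big_enum /=; apply: eq_bigr => s _.
rewrite dp_eval_prod big_map big_enum /=; congr (_ * _); apply: eq_bigr => i _.
by rewrite mxE.
Qed.

Definition dp_field (X : 'I_n -> dpoly) (x : 'rV[R]_n) : 'rV[R]_n :=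
  \row_i dp_eval f g (X i) x.

Variable Om : set 'rV[R]_n.
Hypotheses (oO : open Om) (sf : smooth_on Om f) (sg : forall j, smooth_on Om (g j)).

Lemma smooth_system_field k : smooth_on Om (system_field f g k).
Proof. by case: k => [j|] /=. Qed.

Lemma smooth_iter_partial {W : normedModType R} (F : 'rV[R]_n -> W) s :
  smooth_on Om F -> smooth_on Om (iter_partial s F).
Proof. by move=> sF; elim: s => //= i s; exact: smooth_partial. Qed.

Lemma smooth_dp_eval P : smooth_on Om (dp_eval f g P).
Proof.
elim: P => [c|k i s|P1 IH1 P2 IH2|P1 IH1 P2 IH2] /=.
- exact: smooth_cst.
- by have /(smooth_rVP _ oO)/(_ i) := smooth_iter_partial s (smooth_system_field k).
- exact: smoothD.
exact: smoothM.
Qed.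

Lemma partial_dp_eval P j x : Om x ->
  partial j (dp_eval f g P) x = dp_eval f g (dp_deriv j P) x.
Proof.
move=> Ox; have dP P' : derivable (dp_eval f g P') x (delta_mx 0 j).
  by apply: diff_derivable; exact: smooth_diff (smooth_dp_eval P') Ox.
elim: P => [c|k i s|P1 IH1 P2 IH2|P1 IH1 P2 IH2] /=.
- by rewrite /partial derive_cst.
- rewrite {1}/partial -(derive_coord _ _ _ (F := iter_partial s (system_field f g k))) //.
  exact: smooth_diff (smooth_iter_partial s (smooth_system_field k)) Ox.
- by rewrite /partial (deriveD (dP P1) (dP P2)) -IH1 -IH2.
rewrite /partial (deriveM (dP P1) (dP P2)) -IH1 -IH2 /GRing.scale /= addrC.
by rewrite [X in X + _]mulrC.
Qed.

Lemma smooth_dp_field X : smooth_on Om (dp_field X).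
Proof.
apply/smooth_rVP => // j; apply: (smooth_ext oO _ (smooth_dp_eval (X j))) => x _.
by rewrite mxE.
Qed.

Lemma dp_bracketE X Y x : Om x ->
  dp_field (dp_bracket X Y) x = lie_bracket (dp_field X) (dp_field Y) x.
Proof.
move=> Ox; apply/rowP => i; rewrite mxE dp_eval_sum big_map big_enum /=.
have D Z v : 'D_v (dp_field Z) x 0 i = \sum_j v 0 j * dp_eval f g (dp_deriv j (Z i)) x.
  have dZ : differentiable (dp_field Z) x by exact: smooth_diff (smooth_dp_field Z) Ox.
  rewrite deriveE_partial // summxE; apply: eq_bigr => j _.
  rewrite mxE -partial_dp_eval // /partial derive_coord //.
  have -> // : (fun y => dp_field Z y 0 i) = dp_eval f g (Z i).
  by apply/funext => y; rewrite mxE.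
rewrite /lie_bracket [RHS]mxE [X in _ + X]mxE !D -sumrB; apply: eq_bigr => j _.
by rewrite !mxE mulN1r.
Qed.

(** Indices of the iterated brackets of depth at most [j]. A finite type at
    each depth lets the brackets be the rows of one matrix. *)
Fixpoint bracket_index (j : nat) : finType :=
  if j is j'.+1 then (bracket_index j' + bracket_index j' * bracket_index j')%type
  else option 'I_m.

Fixpoint bracket_poly (j : nat) : bracket_index j -> 'I_n -> dpoly :=
  match j return bracket_index j -> 'I_n -> dpoly with
  | 0 => fun k i => DPartial k i [::]
  | j'.+1 => fun c => match c with
     | inl a => bracket_poly a
     | inr (a, b) => dp_bracket (bracket_poly a) (bracket_poly b)
     end
  end.

Lemma bracket_poly_order j (c : bracket_index j) i : (dp_order (bracket_poly c i) <= j)%N.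
Proof.
elim: j c i => [//|j IH] [a|[a b]] i /=; first by rewrite ltnW // ltnS IH.
by apply: dp_order_bracket => k; exact: IH.
Qed.

Definition bracket_mx j x : 'M[R]_(#|bracket_index j|, n) :=
  \matrix_(a, i) dp_eval f g (bracket_poly (enum_val a) i) x.

Lemma row_bracket_mx j c x :
  row (enum_rank c) (bracket_mx j x) = dp_field (bracket_poly c) x.
Proof. by apply/rowP => i; rewrite !mxE enum_rankK. Qed.

Lemma row_bracket_mxE j a :
  (fun x => row a (bracket_mx j x)) = dp_field (bracket_poly (enum_val a)).
Proof. by apply/funext => x; apply/rowP => i; rewrite !mxE. Qed.

Lemma bracket_field_sub j (c : bracket_index j) x :
  (dp_field (bracket_poly c) x <= bracket_mx j x)%MS.
Proof. by rewrite -row_bracket_mx row_sub. Qed.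

Lemma bracket_mxS j x : (bracket_mx j x <= bracket_mx j.+1 x)%MS.
Proof.
apply/row_subP => a; have -> : row a (bracket_mx j x) = dp_field (bracket_poly (enum_val a)) x.
  by apply/rowP => i; rewrite !mxE.
exact: (@bracket_field_sub j.+1 (inl (enum_val a))).
Qed.

Lemma smooth_bracket_mx j : smooth_mx Om (bracket_mx j).
Proof.
move=> a i; apply: (smooth_ext oO _ (smooth_dp_eval (bracket_poly (enum_val a) i))) => x _.
by rewrite mxE.
Qed.

Local Notation flag := (derived_flag Om (system_span f g)).

(** A section of a member of the flag of constant rank is locally a combination
    of the generating brackets with smooth coefficients, so brackets of
    arbitrary sections add nothing to the brackets of generators. Constancy of
    the ranks below [j] is what makes the [j]-th member computable. *)
Theorem derived_flag_rows j :
  (forall i, (i < j)%N -> exists k, constant_rank Om (flag i) k) ->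
  forall x, Om x -> flag j x = [set v | (v <= bracket_mx j x)%MS].
Proof.
elim: j => [|j IH] crk x Ox.
  apply: lin_span_rows => [v [k ->]|a].
    have -> : system_field f g k x = dp_field (@bracket_poly 0 k) x.
      by apply/rowP => i; rewrite mxE.
    exact: bracket_field_sub.
  by exists (enum_val a); apply/rowP => i; rewrite !mxE.
have {}IH y : Om y -> flag j y = [set v | (v <= bracket_mx j y)%MS].
  by apply: IH => i ij; apply: crk; exact: ltnW.
have [k /(constant_rank_rows _ IH) rk] := crk j (ltnSn j).
have sec X : section_of Om (flag j) X ->
    smooth_on Om X /\ forall y, Om y -> (X y <= bracket_mx j y)%MS.
  by move=> [sX XD]; split=> // y Oy; have := XD y Oy; rewrite IH.
have dsec (c : bracket_index j) : section_of Om (flag j) (dp_field (bracket_poly c)).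
  by split=> [|y Oy]; [exact: smooth_dp_field|rewrite IH //=; exact: bracket_field_sub].
apply: lin_span_rows => [v|a].
  case=> [[X /sec[_ XA] ->]|[X [Y [/sec[sX XA] /sec[sY YA] ->]]]].
    exact: (submx_trans (XA x Ox) (bracket_mxS j x)).
  have [c [dc Xc]] := local_coefficients oO (@smooth_bracket_mx j) rk sX XA Ox.
  have [d [dd Yd]] := local_coefficients oO (@smooth_bracket_mx j) rk sY YA Ox.
  apply: (lie_bracket_combination _ dc dd Xc Yd (bracket_mxS j x)).
    by move=> a; rewrite row_bracket_mxE; exact: smooth_diff (smooth_dp_field _) Ox.
  move=> a b; rewrite !row_bracket_mxE -dp_bracketE //.
  exact: (@bracket_field_sub j.+1 (inr (enum_val a, enum_val b))).
rewrite -[a]enum_valK row_bracket_mx; case: (enum_val a) => [c|[c d]] /=.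
  by left; exists (dp_field (bracket_poly c)).
right; exists (dp_field (bracket_poly c)), (dp_field (bracket_poly d)).
by rewrite dp_bracketE.
Qed.

End Eval.
End DiffPoly.

(** * The type condition *)

Lemma all_flatten (T : Type) (a : pred T) (ss : seq (seq T)) :
  all a (flatten ss) = all (all a) ss.
Proof. by elim: ss => //= s ss IH; rewrite all_cat IH. Qed.

Section TypeEquations.
Context {R : realType} {n m : nat}.

Definition minor_choice j k : finType :=
  ({ffun 'I_k -> 'I_#|bracket_index (m := m) j|} * {ffun 'I_k -> 'I_n})%type.

Definition minors_poly j k : seq (diff_poly R n m) :=
  [seq dp_det (fun a b => bracket_poly (enum_val (fh.1 a)) (fh.2 b))
  | fh : minor_choice j k <- enum (minor_choice j k)].

Lemma minors_poly_order j k : all (fun P => dp_order P <= j)%N (minors_poly j k).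
Proof.
rewrite all_map; apply/allP => fh _ /=; apply: dp_order_det => a b.
exact: bracket_poly_order.
Qed.

Lemma minors_polyE f g j k x :
  [seq dp_eval f g P x | P <- minors_poly j k] =
  [seq \det (mxsub fh.1 fh.2 (bracket_mx f g j x))
  | fh : minor_choice j k <- enum (minor_choice j k)].
Proof.
rewrite -map_comp; apply: eq_map => fh /=; rewrite dp_eval_det; congr (\det _).
by apply/matrixP => a b; rewrite !mxE.
Qed.

Lemma rank_bracket_mxP f g j k x :
  \rank (bracket_mx f g j x) = k <->
  all (fun P => dp_eval f g P x == 0) (minors_poly j k.+1) /\
  has (fun P => dp_eval f g P x != 0) (minors_poly j k).
Proof.
have allE k' : all (fun P => dp_eval f g P x == 0) (minors_poly j k') =
    all (fun c => c == 0) [seq dp_eval f g P x | P <- minors_poly j k'].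
  by rewrite [RHS]all_map.
have hasE k' : has (fun P => dp_eval f g P x != 0) (minors_poly j k') =
    has (fun c => c != 0) [seq dp_eval f g P x | P <- minors_poly j k'].
  by rewrite [RHS]has_map.
rewrite allE hasE !minors_polyE rank_minorsP; split.
  move=> [H0 [s [h sh]]]; split.
    by rewrite all_map; apply/allP => -[s' h'] _ /=; rewrite H0.
  by rewrite has_map; apply/hasP; exists (s, h); rewrite ?mem_enum.
move=> []; rewrite all_map has_map => /allP H0 /hasP[[s h] _ sh].
split; last by exists s, h.
by move=> s' h'; apply/eqP; apply: (H0 (s', h')); rewrite mem_enum.
Qed.

Lemma rank_conditionsP f g (js : seq nat) (K : nat -> nat) x :
  all (fun P => dp_eval f g P x == 0) (flatten [seq minors_poly j (K j).+1 | j <- js]) /\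
  all (has (fun P => dp_eval f g P x != 0)) [seq minors_poly j (K j) | j <- js] <->
  forall j, j \in js -> \rank (bracket_mx f g j x) = K j.
Proof.
rewrite all_flatten !all_map; split=> [[/allP h1 /allP h2] j jin|H].
  by apply/rank_bracket_mxP; split; [exact: h1|exact: h2].
by split; apply/allP => j jin; have /rank_bracket_mxP[] := H j jin.
Qed.

Variables nu l : nat.

(** The flag is pinned down through depth [nu + 1]: its ranks are those of
    [rho], and the last one repeats. The ranks strictly increase to [l] in a
    flag of type [(nu, l)], so for any other [rho] the equation is 1 = 0. *)
Definition type_system (rho : nat -> nat) : pde_system R n m :=
  if all (fun j => rho j < rho j.+1)%N (iota 0 nu) && (rho nu == l) then
    PDESystem (flatten [seq minors_poly j (rho (minn j nu)).+1 | j <- iota 0 nu.+2])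
              [seq minors_poly j (rho (minn j nu)) | j <- iota 0 nu.+2]
  else PDESystem [:: DConst 1] [::].

Lemma type_system_order rho : pde_order_le (type_system rho) nu.+1.
Proof.
rewrite /pde_order_le /type_system; case: ifP => _ //=.
have H k : all (fun P : diff_poly R n m => dp_order P <= nu.+1)%N
    (flatten [seq minors_poly j (k j) | j <- iota 0 nu.+2]).
  rewrite all_flatten all_map; apply/allP => j; rewrite mem_iota /= add0n ltnS => jnu.
  by apply: sub_all (minors_poly_order j (k j)) => P /leq_trans; apply.
by rewrite all_cat; apply/andP; split; [exact: (H (fun j => (rho (minn j nu)).+1))|
  exact: (H (fun j => rho (minn j nu)))].
Qed.

Lemma type_system_solution rho Om f g :
  (forall j, (j < nu)%N -> (rho j < rho j.+1)%N) -> rho nu = l ->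
  pde_solution (type_system rho) Om f g <->
  forall j, (j <= nu.+1)%N -> forall x, Om x -> \rank (bracket_mx f g j x) = rho (minn j nu).
Proof.
move=> incr rl; rewrite /type_system ifT; last first.
  rewrite rl eqxx andbT; apply/allP => j; rewrite mem_iota /= add0n; exact: incr.
split=> [H j jnu x Ox|H x Ox].
  have /rank_conditionsP := H x Ox; apply.
  by rewrite mem_iota /= add0n ltnS.
apply/rank_conditionsP => j; rewrite mem_iota /= add0n ltnS => jnu.
exact: H.
Qed.

Lemma type_system_incr rho (Om : set 'rV[R]_n) f g : Om !=set0 ->
  pde_solution (type_system rho) Om f g ->
  (forall j, (j < nu)%N -> (rho j < rho j.+1)%N) /\ rho nu = l.
Proof.
move=> [x Ox] /(_ x Ox); rewrite /type_system.
case: ifP => [/andP[/allP incr /eqP rl] _|_ [/=]]; last by rewrite oner_eq0.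
by split=> // j jnu; apply: incr; rewrite mem_iota.
Qed.

Section OnDomain.
Variables (Om : set 'rV[R]_n) (f : 'rV[R]_n -> 'rV[R]_n) (g : 'I_m -> 'rV[R]_n -> 'rV[R]_n).
Hypotheses (oO : open Om) (O0 : Om !=set0).
Hypotheses (sf : smooth_on Om f) (sg : forall j, smooth_on Om (g j)).
Local Notation flag := (derived_flag Om (system_span f g)).
Local Notation A := (bracket_mx f g).

Lemma rows_eqmx {N N'} (B : 'M[R]_(N, n)) (B' : 'M[R]_(N', n)) :
  [set v : 'rV[R]_n | (v <= B)%MS] = [set v | (v <= B')%MS] -> (B == B')%MS.
Proof.
move=> E; apply/andP; split; apply/row_subP => i.
  by have : [set v | (v <= B)%MS] (row i B) by [exact: row_sub]; rewrite E.
by have : [set v | (v <= B')%MS] (row i B') by [exact: row_sub]; rewrite -E.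
Qed.

(** Strict inclusion in the flag is a strict inequality of ranks, since the
    ranks are constant. In the converse direction the constancy of the ranks
    is recovered by induction on the depth, each member being the span of
    brackets once those before it have constant rank. *)
Lemma has_type_ranks rho :
  (has_type Om (system_span f g) nu l /\
    forall j, (j <= nu)%N -> constant_rank Om (flag j) (rho j)) <->
  [/\ forall j, (j < nu)%N -> (rho j < rho j.+1)%N, rho nu = l &
   forall j, (j <= nu.+1)%N -> forall x, Om x -> \rank (A j x) = rho (minn j nu)].
Proof.
split=> [[[crk stop strict last] crho]|[incr rl rk]].
  have rows j : (j <= nu.+1)%N -> forall x, Om x -> flag j x = [set v | (v <= A j x)%MS].
    by move=> jnu; apply: (derived_flag_rows oO sf sg) => i ij; apply: crk; rewrite (leq_trans (ltnW ij)).
  have rk j x : (j <= nu)%N -> Om x -> \rank (A j x) = rho j.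
    move=> jnu; move: x; apply/(constant_rank_rows _ (rows j (leqW jnu))).
    exact: crho.
  split.
  - move=> j jnu; rewrite ltnNge; apply/negP => rj; apply: (strict j jnu) => x Ox.
    rewrite !rows ?(ltnW jnu) ?leqW //; last exact: ltnW.
    have s := bracket_mxS f g j x.
    have : (A j.+1 x <= A j x)%MS.
      by rewrite -(geq_leqif (mxrank_leqif_sup s)) !rk // ltnW.
    by move=> s'; apply/seteqP; split=> v /= vA; [exact: submx_trans s|exact: submx_trans s'].
  - have [x Ox] := O0; rewrite -(rk nu x) //; move: x Ox.
    by apply/(constant_rank_rows _ (rows nu (leqnSn nu))).
  move=> j; rewrite leq_eqVlt ltnS => /orP[/eqP -> x Ox|jnu x Ox]; last first.
    by rewrite (minn_idPl jnu) rk.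
  rewrite (minn_idPr (leqnSn nu)) -(rk nu x) //.
  have := stop x Ox; rewrite !rows // => /rows_eqmx E.
  by have := eqmx_rank E => ->.
have crk j : (j <= nu.+1)%N -> constant_rank Om (flag j) (rho (minn j nu)).
  elim/ltn_ind: j => j IH jnu.
  have rows := derived_flag_rows oO sf sg (j := j) (fun i ij => ex_intro _ _ (IH i ij (leq_trans (ltnW ij) jnu))).
  by apply/(constant_rank_rows _ rows); exact: rk.
have rows j : (j <= nu.+1)%N -> forall x, Om x -> flag j x = [set v | (v <= A j x)%MS].
  move=> jnu; apply: (derived_flag_rows oO sf sg) => i ij; eexists; apply: crk.
  exact: leq_trans (ltnW ij) jnu.
split; last first.
  by move=> j jnu; have := crk j (leqW jnu); rewrite (minn_idPl jnu).
split.
- by move=> j jnu; eexists; exact: crk.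
- move=> x Ox; rewrite !rows //.
  have s := bracket_mxS f g nu x.
  have s' : (A nu.+1 x <= A nu x)%MS.
    rewrite -(geq_leqif (mxrank_leqif_sup s)) !rk //.
    by rewrite (minn_idPr (leqnSn nu)) minnn.
  by apply/seteqP; split=> v /= vA; [exact: submx_trans s|exact: submx_trans s'].
- move=> j jnu E; have [x Ox] := O0; have := E x Ox.
  rewrite !rows ?(ltnW jnu) ?leqW //; last exact: ltnW.
  move=> /rows_eqmx/eqmx_rank; rewrite !rk ?leqW //; last exact: ltnW.
  by rewrite (minn_idPl (ltnW jnu)) (minn_idPl jnu) => e; have := incr j jnu; rewrite e ltnn.
by have := crk nu (leqnSn nu); rewrite minnn rl.
Qed.

Lemma type_system_correct rho :
  (has_type Om (system_span f g) nu l /\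
    forall j, (j <= nu)%N -> constant_rank Om (flag j) (rho j)) <->
  pde_solution (type_system rho) Om f g.
Proof.
rewrite has_type_ranks; split=> [[incr rl rk]|sol].
  by apply/type_system_solution.
have [incr rl] := type_system_incr O0 sol; split=> //.
exact/type_system_solution.
Qed.

(** Brackets of depth at most [nu] span the last member of the flag, and bracketing
    them again gives nothing new. *)
Lemma type_involutive : has_type Om (system_span f g) nu l ->
  (forall x, Om x -> \rank (A nu x) = l) /\
  forall x, Om x -> (A nu.+1 x <= A nu x)%MS.
Proof.
move=> [crk stop _ last].
have rows j : (j <= nu.+1)%N -> forall x, Om x -> flag j x = [set v | (v <= A j x)%MS].
  by move=> jnu; apply: (derived_flag_rows oO sf sg) => i ij; apply: crk; rewrite (leq_trans (ltnW ij)).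
split; first by apply/(constant_rank_rows _ (rows nu (leqnSn nu))).
move=> x Ox; have := stop x Ox; rewrite !rows // => /rows_eqmx.
by move=> /andP[].
Qed.

Lemma flow_directions x (u : 'I_m -> R) : ((f x + \sum_j u j *: g j x)%R <= A nu x)%MS.
Proof.
have A0 k : (system_field f g k x <= A nu x)%MS.
  have : (system_field f g k x <= A 0 x)%MS.
    have -> : system_field f g k x = dp_field f g (@bracket_poly R n m 0 k) x.
      by apply/rowP => i; rewrite mxE.
    exact: bracket_field_sub.
  by elim: nu => // j IH /IH /submx_trans; apply; exact: bracket_mxS.
apply: addmx_sub; first exact: (A0 None).
by apply: summx_sub => j _; apply: scalemx_sub; exact: (A0 (Some j)).
Qed.

Hypothesis ln : (l <= n)%N.

(** The frame [X] is normalised to have identity coordinates against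
    [Q *m pid_mx l]. Its brackets lie in the distribution by involutivity and
    have zero coordinates there, so they vanish and [frobenius_chart]
    applies. *)
Theorem invariant_chart p0 : Om p0 -> has_type Om (system_span f g) nu l ->
  exists U phi, [/\ U p0, is_chart U phi &
    forall p (u : 'I_m -> R) (j : 'I_n), U p -> (l <= j)%N ->
      'D_(f p + \sum_j u j *: g j p) phi p 0 j = 0].
Proof.
move=> Op0 /type_involutive[rk inv].
have sA := smooth_bracket_mx oO sf sg (j := nu).
have [V [s [Q [oV Vp0 VO uQ VP]]]] := local_frame oO sA rk Op0.
pose E : 'M[R]_(n, l) := pid_mx l.
pose W : 'M[R]_(n, l) := Q *m E.
pose B y := rowsub s (A nu y).
(* E pads the l rows of the normalised frame with zero rows *)
pose X y : 'M[R]_n := E *m (invmx (B y *m W) *m B y).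
have uBW y : V y -> B y *m W \in unitmx by move=> /VP[].
have sAV : smooth_mx V (A nu) by exact: smooth_mx_sub sA.
have sB : smooth_mx V B by exact: smooth_rowsub.
have sBW : smooth_mx V (fun y => B y *m W) by apply: smooth_mxM => //; exact: smooth_mx_cst.
have sX : smooth_mx V X.
  apply: smooth_mxM => //; first exact: smooth_mx_cst.
  by apply: smooth_mxM => //; exact: smooth_invmx.
have EE : (pid_mx l : 'M[R]_n) = E *m pid_mx l by rewrite /E pid_mx_id.
have XQ y : V y -> X y *m Q *m (pid_mx l : 'M[R]_n) = pid_mx l.
  move=> Vy; rewrite [in LHS]EE mulmxA.
  have -> : X y *m Q *m E = E.
    rewrite /X -!mulmxA -/W mulVmx ?mulmx1 //; exact: uBW.
  by rewrite -EE.
have PX y : V y -> (pid_mx l : 'M[R]_n) *m X y = X y.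
  by move=> _; rewrite /X mulmxA /E pid_mx_id.
have XA y : (X y <= A nu y)%MS.
  by rewrite /X mulmxA; apply: (submx_trans (submxMl _ _)); exact: rowsub_sub.
have XX i j p : V p -> lie_bracket (fun q => row i (X q)) (fun q => row j (X q)) p = 0.
  move=> Vp.
  have dX i' : differentiable (fun q => row i' (X q)) p.
    apply/differentiable_mxP => a b.
    have := smooth_diff (sX i' b) Vp; congr (differentiable _ _).
    by apply/funext => q; rewrite [RHS]mxE.
  have wA : (lie_bracket (fun q => row i (X q)) (fun q => row j (X q)) p <= A nu p)%MS.
    pose c i' q := row i' (E *m invmx (B q *m W)) *m rowsub s (1%:M : 'M[R]_#|_|).
    have dc i' : differentiable (c i') p.
      apply/differentiable_mxP => a b; rewrite ord1.
      have sc : smooth_mx V (fun q => E *m invmx (B q *m W) *m rowsub s (1%:M : 'M[R]_#|_|)).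
        apply: smooth_mxM => //; last exact: smooth_mx_cst.
        by apply: smooth_mxM => //; [exact: smooth_mx_cst|exact: smooth_invmx].
      have := smooth_diff (sc i' b) Vp; congr (differentiable _ _).
      by apply/funext => q; rewrite /c -row_mul [RHS]mxE.
    have cE i' : \near p, row i' (X p) = c i' p *m A nu p.
      apply: (open_near oV Vp) => q _.
      by rewrite /c -mulmxA -rowsubE -row_mul /X mulmxA.
    apply: (lie_bracket_combination _ (dc i) (dc j) (cE i) (cE j)) => //.
      by move=> a; rewrite row_bracket_mxE; apply: smooth_diff (VO _ Vp); exact: smooth_dp_field.
    move=> a b; rewrite !row_bracket_mxE -(dp_bracketE oO sf sg); last exact: VO.
    apply: (submx_trans _ (inv p (VO _ Vp))).
    exact: (@bracket_field_sub _ _ _ f g nu.+1 (inr (enum_val a, enum_val b))).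
  (* the frame has constant coordinates, whose derivatives vanish *)
  have DW j' v : ('D_v (fun q => row j' (X q)) p) *m W = 0.
    have := derive_comp v (dX j') (differentiable_mulmxr W _).
    rewrite derive_mulmxr => <-.
    rewrite -(derive_cst (row j' E) p v); apply: near_eq_derive.
    apply: (open_near oV Vp) => q Vq /=.
    rewrite -row_mul /X -!mulmxA mulVmx ?mulmx1 //; exact: uBW.
  rewrite ((VP p Vp).2 _ wA) -/W /lie_bracket mulmxBl !DW subr0 !mul0mx.
  by [].
have [U [phi [Up0 UV chU D]]] := frobenius_chart oV Vp0 sX ln uQ XQ PX XX.
exists U, phi; split=> // p u j Up lj.
have Vp := UV p Up.
set v := _ + _.
have vE : v = (v *m W *m (pid_mx l : 'M[R]_(l, n))) *m X p.
  rewrite [LHS]((VP p Vp).2 v (flow_directions p u)) -/W.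
  rewrite /X (mulmxA (v *m W *m _) E) -(mulmxA (v *m W) _ E).
  have -> : (pid_mx l : 'M[R]_(l, n)) *m E = 1%:M by rewrite /E pid_mx_id // pid_mx_1.
  by rewrite mulmx1 -[LHS]mulmxA.
have dphi : differentiable phi p by have [_ sphi _ _] := chU; exact: smooth_diff sphi Up.
rewrite {1}vE mulmx_sum_row deriveE // linear_sum summxE; apply: big1 => i _.
by rewrite linearZ mxE -deriveE // D // mulr0.
Qed.

End OnDomain.
End TypeEquations.

Theorem theorem1p8 (R : realType) (n m nu l : nat)
    (hmn : (m <= n)%N) (hl : (1 <= l <= n)%N) :
  (forall (p0 : 'rV[R]_n) (r : R) (f : 'rV[R]_n -> 'rV[R]_n)
      (g : 'I_m -> 'rV[R]_n -> 'rV[R]_n),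
    0 < r ->
    smooth_on (eball p0 r) f ->
    (forall j, smooth_on (eball p0 r) (g j)) ->
    (exists k, constant_rank (eball p0 r) (system_span f g) k) ->
    has_type (eball p0 r) (system_span f g) nu l ->
    exists r' : R, 0 < r' <= r /\
      exists F : set (set 'rV[R]_n),
        is_foliation (eball p0 r') l F /\
        forall N, F N -> invariant_under_controls (eball p0 r') f g N)
  /\
  (forall rho : nat -> nat, exists S : pde_system R n m,
    pde_order_le S nu.+1 /\
    forall (p0 : 'rV[R]_n) (r : R) (f : 'rV[R]_n -> 'rV[R]_n)
      (g : 'I_m -> 'rV[R]_n -> 'rV[R]_n),
    0 < r ->
    smooth_on (eball p0 r) f ->
    (forall j, smooth_on (eball p0 r) (g j)) ->
    ((has_type (eball p0 r) (system_span f g) nu l /\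
      forall j, (j <= nu)%N ->
        constant_rank (eball p0 r)
          (derived_flag (eball p0 r) (system_span f g) j) (rho j))
     <-> pde_solution S (eball p0 r) f g)).
Proof.
have /andP[_ ln] := hl; split=> [p0 r f g r0 sf sg _ typ|rho].
  have [U [phi [Up0 chU tgt]]] :=
    invariant_chart (@open_eball _ _ p0 r) sf sg ln (eball_center p0 r0) typ.
  exact: foliation_of_chart r0 Up0 chU tgt.
exists (type_system nu l rho); split; first exact: type_system_order.
move=> p0 r f g r0 sf sg.
apply: type_system_correct => //; first exact: open_eball.
by exists p0; exact: eball_center.
Qed.
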